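(* Let $d\in\mathbb{R}$, let $f$ be a majority-type update function with parameters $m,\beta,\gamma$, and let the initial number of vertices with opinion $X$ be $X_0=n/2+d\sqrt{n}+o(\sqrt{n})$. Let $Z\stackrel{d}{=}\mathcal{N}\big(d,\tfrac{1}{4(\gamma^2-1)}\big)$. Then, as $n\to\infty$, $$\sup_{s\in\mathbb{Z}}\Big|\mathbb{P}\big(R_n(X_0)\ge s\big)-\mathbb{P}\big(Z_n+\log_m\ln n+g(Z_n)\ge s\big)\Big|=o(1),\quad\text{where } Z_n:=\tfrac12\log_\gamma(n/Z^2).$$
   Context: Majority-type update function: a function $f:[0,1]\to[0,1]$ such that (i) $f$ is $(m+1)$-times continuously differentiable for some integer $m\ge 2$; (ii) $f$ is convex on $[0,1/2]$; (iii) $1-f(1-x)=f(x)$ for all $x\in[0,1]$; (iv) there exist $\gamma>1$ and $\beta>0$ such that, as $x\to0$, $f(x)=\beta x^m+O(x^{m+1})$ and $f(1/2+x)=1/2+\gamma x+O(x^2)$. The numbers $m,\beta,\gamma$ are called its parameters. Iterates: $f^{(0)}(x)=x$, $f^{(i)}=f\circ f^{(i-1)}$ for $i\ge1$. Process: there are $n$ vertices, each holding opinion $X$ or $Y$. $X_t$ is the number of vertices with opinion $X$ after round $t$. The process $(X_t)_{t\in\mathbb{N}_0}$ (depending on $n$) is the Markov chain with deterministic initial value $X_0\in[0,n]$ (not required to be an integer) and, conditionally on $X_t$, $X_{t+1}\stackrel{d}{=}\mathrm{Bin}(n,f(X_t/n))$. Put $Y_t=n-X_t$. The runtime is $R_n(X_0)=\inf\{t\in\mathbb{N}_0: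 X_t=n\text{ or }Y_t=n\}$. The function $g:\mathbb{R}\to\mathbb{R}$ associated with $f$ is $$g(x)=1-x+\lim_{a\to\infty,\,a\in\mathbb{N}}\ \lim_{b\to\infty,\,b\in\mathbb{N}}\Big(b-a-\log_m\big|\ln f^{(b)}(1/2-\gamma^{-a-x})\big|\Big)$$ (these limits exist; for given $x$ only $a$ large enough that $1/2-\gamma^{-a-x}>0$ matter). $\mathcal{N}(\mu,\sigma^2)$ is the Gaussian distribution with mean $\mu$ and variance $\sigma^2$. *)

(* Defs.v *)
From HB Require Import structures.
From mathcomp Require Import all_boot all_order all_algebra.
From mathcomp Require Import all_classical all_reals all_analysis.

Set Implicit Arguments.
Unset Strict Implicit.
Unset Printing Implicit Defensive.

Import Order.TTheory GRing.Theory Num.Theory.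
Import numFieldNormedType.Exports.

Local Open Scope classical_set_scope.
Local Open Scope ring_scope.

(* A function on [0, 1] is a total function R -> R whose values outside [0, 1]
   are irrelevant. In particular derivatives on [0, 1] are limits of difference
   quotients taken within [0, 1], hence one-sided at 0 and 1. *)
Definition has_derivative01 (R : realType) (f df : R -> R) : Prop :=
  forall x : R, x \in `[0, 1] ->
    (f y - f x) / (y - x) @[y --> within (`[0, 1] : set R) x^'] --> df x.

Fixpoint cont_diff01 (R : realType) (k : nat) (f : R -> R) : Prop :=
  if k is k'.+1 then
    exists2 df : R -> R, has_derivative01 f df & cont_diff01 k' df
  else {within (`[0, 1] : set R), continuous f}.

Record majority_type (R : realType) (f : R -> R) (m : nat) (beta gamma : R) :
    Prop := MajorityType {
  maj_range : forall x : R, x \in `[0, 1] -> f x \in `[0, 1];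
  maj_m : (2 <= m)%N;
  maj_smooth : cont_diff01 m.+1 f;
  maj_convex : convex_function (`[0, 2^-1]%classic : set R) f;
  maj_sym : forall x : R, x \in `[0, 1] -> 1 - f (1 - x) = f x;
  maj_gamma : 1 < gamma;
  maj_beta : 0 < beta;
  maj_at0 :
    (fun x : R => f x - beta * x ^+ m) =O_ (0^'+) (fun x : R => x ^+ m.+1);
  maj_at_half :
    (fun x : R => f (2^-1 + x) - (2^-1 + gamma * x)) =O_ (0^')
      (fun x : R => x ^+ 2)
}.

(* X : nat -> {RV P >-> R} is the Markov chain with X 0 = x0 and
   X t.+1 ~ Bin(n, f (X t / n)) given the past. After time 0 the chain is
   supported on {0, .., n}, so that it suffices to condition on the paths
   (X 0, .., X t) = (x 0, .., x t); the equation is trivial for paths of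
   probability zero. The states are real because x0 need not be an integer. *)
Definition binomial_chain (R : realType) (f : R -> R) (n : nat) (x0 : R)
    (disp : measure_display) (T : measurableType disp) (P : probability T R)
    (X : nat -> {RV P >-> R}) : Prop :=
  (forall w, X 0%N w = x0) /\
  (forall (t : nat) (x : nat -> R) (k : nat),
    P [set w | (forall i, (i <= t)%N -> X i w = x i) /\ X t.+1 w = k%:R] =
    (P [set w | forall i, (i <= t)%N -> X i w = x i] *
     binomial_prob n (f (x t / n%:R)%R) [set k])%E).

(* The value is +oo if no consensus is ever reached. *)
Definition runtime (R : realType) (n : nat) (T : Type) (X : nat -> T -> R)
    (w : T) : \bar R :=
  ereal_inf [set (t%:R)%:E | t in
    [set t : nat | X t w = n%:R \/ n%:R - X t w = n%:R]].

Definition log (R : realType) (b x : R) : R := ln x / ln b.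

(* When gamma `^ (- a - x) >= 1 / 2 the inner limit is a junk value; this
   happens for finitely many a only, hence does not affect the outer limit. *)
Definition limit_g (R : realType) (f : R -> R) (m : nat) (gamma x : R) : R :=
  1 - x + limn (fun a : nat => limn (fun b : nat =>
    b%:R - a%:R -
      log m%:R `|ln (iter b f (2^-1 - gamma `^ (- a%:R - x)))| : R)).

(* Main.v *)
Require Import Defs.
From HB Require Import structures.
From mathcomp Require Import all_boot all_order all_algebra.
From mathcomp Require Import all_classical all_reals all_analysis.
From mathcomp Require Import ring lra.

Set Implicit Arguments.
Unset Strict Implicit.
Unset Printing Implicit Defensive.

Import Order.TTheory GRing.Theory Num.Theory.
Import numFieldNormedType.Exports.

Local Open Scope classical_set_scope.
Local Open Scope ring_scope.

(** Let [x = X_t / n]. Since [X_{t+1}] is binomial given the past, the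
    probability that the chain has not reached consensus after [j] rounds is
    [iter j (step f n) unresolved (X_0 / n)], where [step f n phi x] is the
    expectation of [phi (Bin (n, f x) / n)] ([open_until_prob]), and the event
    [T + 1 <= R_n] says that no consensus is reached up to time [T]
    ([runtime_gtE]). It remains to study this iterate, in two phases.

    Close to [1 / 2] the map [f] multiplies the deviation by [gamma], and a round
    adds a Gaussian noise of variance about [1 / 4] to [sqrt n (x - 1 / 2)].
    After [t] rounds this quantity, divided by [gamma ^ t], is therefore almost
    normal with mean [d] and variance [(1 / 4) (gamma ^ -2 + gamma ^ -4 + ...)
    = 1 / (4 (gamma ^ 2 - 1))], as long as [gamma ^ t <= e sqrt n] with [e] small
    ([clt_indicator]). The proof is Lindeberg's: the indicator of a half-line is
    smoothed into the solution [heat] of the heat equation, on which a round acts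
    by a change of variables up to a small error ([heat_binomial], [step_heat],
    [iter_step_heat]).

    At a fixed distance from [1 / 2] the chain follows the iteration of [f]. As
    [f x] is close to [beta x ^ m] at [0], the limit [boettcher x] of
    [- ln (f^(b) x) / m ^ b] exists, is multiplied by [m] under [f] and differs
    from [- ln x] by a bounded amount. The minority opinion disappears when
    [n f^(k) x] drops below [1], which happens when [m ^ k * boettcher x] passes
    [ln n], that is when [k] passes [abel x + log_m (ln n)] with
    [abel = - log_m boettcher] ([chain_tracking]).

    The phases are joined by [abel_half y], the limit of
    [abel (1 / 2 - y / gamma ^ a) - a]: it grows by [1] when [y] is divided by
    [gamma], it is close to [abel (1 / 2 - y)] for small [y], and
    [limit_g x = 1 - x + abel_half (gamma ^ -x)] ([limit_gE]). Hence, up to small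
    errors, [T + 1 <= R_n] means
    [T <= abel_half (|Z| / sqrt n) + log_m (ln n)], where [Z] is the Gaussian limit
    of the rescaled deviation, and this is also what
    [T + 1 <= Z_n + log_m (ln n) + g (Z_n)] says ([late_setE]). As [abel_half] is
    nonincreasing, both events compare [|Z|] with the same threshold. The errors
    move the threshold by a factor close to [1] only ([abel_half_gap],
    [end_game]), which changes the Gaussian probability by little, uniformly in
    [T] ([window_scale], [unresolved_asymptotic]). *)

Tactic Notation (at level 0) "lra_from" ne_hyp_list(hs) := clear - hs; lra.
Tactic Notation (at level 0) "nra_from" ne_hyp_list(hs) := clear - hs; nra.

(** * Elementary estimates for majority-type functions *)

Section MajorityFunction.
Variables (R : realType) (f : R -> R) (m : nat) (beta gamma : R).
Hypothesis hf : majority_type f m beta gamma.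

Lemma maj_half : f 2^-1 = 2^-1.
Proof.
have h : (2^-1 : R) \in `[0, 1] by rewrite in_itv /=; lra.
have := maj_sym hf h.
have -> : 1 - 2^-1 = 2^-1 :> R by lra.
lra.
Qed.

Lemma maj_convex_comb (t x y : R) : 0 <= t <= 1 -> 0 <= x <= 2^-1 ->
  0 <= y <= 2^-1 -> f (t * x + (1 - t) * y) <= t * f x + (1 - t) * f y.
Proof.
move=> /andP[t0 t1] hx hy.
have t01 : t \in `[0%Z%:~R, 1%Z%:~R]%R by rewrite in_itv /= t0.
have tE : (Itv01 t0 t1)%:num = t by [].
have := @maj_convex _ _ _ _ _ hf (Itv01 t0 t1) x y.
rewrite !inE /= !in_itv /= => /(_ hx hy).
by rewrite !convRE.
Qed.

(** Convexity with the denominators cleared, for use by linear arithmetic. *)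
Lemma maj_convex3 (a b c : R) : 0 <= a -> a <= b -> b <= c -> c <= 2^-1 ->
  (c - a) * f b <= (c - b) * f a + (b - a) * f c.
Proof.
move=> a0 ab bc c2.
have [ac|ac] := eqVneq a c.
  have -> : b = c by apply/eqP; rewrite eq_le bc -ac ab.
  by rewrite ac; lra.
have ca : 0 < c - a by rewrite subr_gt0 lt_neqAle ac (le_trans ab bc).
have := @maj_convex_comb ((c - b) / (c - a)) a c.
have -> : (c - b) / (c - a) * a + (1 - (c - b) / (c - a)) * c = b.
  by field; rewrite gt_eqF.
rewrite divr_ge0 ?(ltW ca) ?subr_ge0 // ler_pdivrMr // => H.
have {H} := H ltac:(lra) ltac:(lra) ltac:(lra).
have -> : (c - b) / (c - a) * f a + (1 - (c - b) / (c - a)) * f c =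
   ((c - b) * f a + (b - a) * f c) / (c - a).
  by field; rewrite gt_eqF.
by rewrite ler_pdivlMr // mulrC.
Qed.

Lemma maj_f_range (x : R) : 0 <= x <= 1 -> 0 <= f x <= 1.
Proof.
move=> hx; have /maj_range : x \in `[0, 1] by rewrite in_itv.
by move=> /(_ f m beta gamma hf); rewrite in_itv.
Qed.

Lemma maj_symE (x : R) : 0 <= x <= 1 -> f (1 - x) = 1 - f x.
Proof.
move=> hx; have h : x \in `[0, 1] by rewrite in_itv.
by have := maj_sym hf h; lra.
Qed.

Lemma maj_near0 : exists C e : R, [/\ 0 < C, 0 < e <= 2^-1 &
  forall x, 0 < x <= e -> `|f x - beta * x ^+ m| <= C * x ^+ m.+1].
Proof.
have /eqO_exP[C C0 /nbhs_ballP[e /= e0 H]] := maj_at0 hf.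
exists C, (Num.min (e / 2) 2^-1); split => //.
  by rewrite lt_min divr_gt0 // invr_gt0 ltr0n /= ge_min lexx orbT.
move=> x /andP[x0]; rewrite le_min => /andP[xe x2].
have := H x; rewrite /ball /= sub0r normrN (gtr0_norm x0) => /(_ _ x0).
by rewrite (ger0_norm (exprn_ge0 _ (ltW x0))); apply; lra.
Qed.

(** The expansion at [0] only concerns positive arguments; it determines [f 0]
    because [f] has a right derivative at [0]. *)
Lemma maj0 : f 0 = 0.
Proof.
have [df hdf _] := maj_smooth hf.
have h0 : (0 : R) \in `[0, 1] by rewrite in_itv /=; lra.
have /(_ 0 h0) := hdf.
move=> /cvgrPdist_le /(_ 1 ltr01); rewrite near_withinE => -/nbhs_ballP[e /= e0 He].
have [C [e1 [C0 /andP[e10 e12] H1]]] := maj_near0.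
have f0 : 0 <= f 0 by have /andP[] : 0 <= f 0 <= 1 by apply: maj_f_range; lra.
apply/eqP; rewrite eq_le f0 andbT.

pose D : R := `|df 0| + 1 + beta + C.
have b0 := maj_beta hf.
have D0 : 0 < D by rewrite /D; have := normr_ge0 (df 0); lra.
have key y : 0 < y -> y < e -> y <= e1 -> f 0 <= D * y.
  move=> y0 ye ye1.
  have y1 : y <= 1 by lra.
  have := He y; rewrite /ball /= sub0r normrN (gtr0_norm y0) => /(_ ye).
  have yin : y \in `[0, 1] by rewrite in_itv /=; lra.
  rewrite subr0 => /(_ _ _); rewrite gt_eqF // => /(_ isT yin) h.
  have {}h : `|(f y - f 0) / y| <= `|df 0| + 1.
    rewrite -[(f y - f 0) / y](subrK (df 0)).
    apply: le_trans (ler_normD _ _) _; rewrite addrC lerD2l.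
    by rewrite distrC.
  move: h; rewrite normrM normfV (gtr0_norm y0) ler_pdivrMr // => h.
  have := H1 y; rewrite y0 ye1 => /(_ isT) h2.
  have m2 := maj_m hf.
  have ym : y ^+ m <= y.
    by rewrite -[leRHS]expr1; apply: ler_wiXn2l; [lra_from y0 ye1 y1|lra_from y0 ye1 y1|exact: leq_trans m2].
  have ym1 : y ^+ m.+1 <= y.
    by rewrite -[leRHS]expr1; apply: ler_wiXn2l; [lra_from y0 y1 h|lra_from y0 y1 h|].
  have h3 : f y <= beta * y + C * y.
    have : beta * y ^+ m <= beta * y by rewrite ler_pM2l.
    have : C * y ^+ m.+1 <= C * y by rewrite ler_pM2l.
    move: h2; rewrite ler_norml => /andP[_]; lra.
  move: h; rewrite ler_norml => /andP[h _].
  by rewrite /D; nra.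
rewrite leNgt; apply/negP => f0p.
pose y := Num.min (e / 2) (Num.min e1 (f 0 / (2 * D))).
have y0 : 0 < y by rewrite !lt_min divr_gt0 //= e10 divr_gt0 // mulr_gt0.
have /key : y < e by rewrite /y gt_min; apply/orP; left; lra.
have -> : y <= e1 by rewrite /y !ge_min lexx orbT.
move=> /(_ y0 isT).
have : y <= f 0 / (2 * D) by rewrite /y !ge_min lexx !orbT.
rewrite ler_pdivlMr ?mulr_gt0 //; nra.
Qed.

(** Convexity and [f 0 = 0] make [f x / x] nondecreasing. *)
Lemma maj_scale (t x : R) : 0 <= t <= 1 -> 0 <= x <= 2^-1 -> f (t * x) <= t * f x.
Proof.
move=> ht hx; have := @maj_convex_comb t x 0 ht hx.
by rewrite maj0 !mulr0 !addr0; apply; lra.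
Qed.

Lemma maj_mono (x y : R) : 0 <= x -> x <= y -> y <= 2^-1 -> f x <= f y.
Proof.
move=> x0 xy y2.
have [y0|y0] := ltrP 0 y; last by have -> : x = y by lra.
have := @maj_scale (x / y) y; rewrite divfK ?gt_eqF //.
rewrite divr_ge0 ?(ltW y0) // ler_pdivrMr // mul1r xy => /(_ isT).
move=> h; apply: le_trans (h _) _; first lra.
have /andP[fy _] : 0 <= f y <= 1 by apply: maj_f_range; lra.
by apply: ler_piMl => //; rewrite ler_pdivrMr // mul1r.
Qed.

Lemma maj_le_half (x : R) : 0 <= x <= 2^-1 -> f x <= 2^-1.
Proof. by move=> hx; rewrite -maj_half; apply: maj_mono; lra. Qed.

Lemma maj_ge0 (x : R) : 0 <= x <= 1 -> 0 <= f x.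
Proof. by move=> /maj_f_range /andP[]. Qed.

(** The local expansion extends to the whole interval: where it does not apply,
    [x ^ 2] is bounded below and the remainder is bounded. *)
Lemma maj_half_expansion : exists2 C : R, 0 < C &
  forall x, `|x| <= 2^-1 -> `|f (2^-1 + x) - (2^-1 + gamma * x)| <= C * x ^+ 2.
Proof.
have /eqO_exP[C C0 /nbhs_ballP[e /= e0 H]] := maj_at_half hf.
have g1 := maj_gamma hf.
exists (C + (2 + gamma) / e ^+ 2) => [|x x2].
  by rewrite addr_gt0 // divr_gt0 ?exprn_gt0 //; lra.
have x20 : 0 <= x ^+ 2 by rewrite sqr_ge0.
rewrite mulrDl.
have h0 : 0 <= (2 + gamma) / e ^+ 2 * x ^+ 2.
  by rewrite mulr_ge0 // divr_ge0 ?exprn_ge0 ?(ltW e0) //; lra.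
have [->|xn0] := eqVneq x 0.
  by rewrite addr0 mulr0 addr0 maj_half subrr normr0 expr0n /= !mulr0 addr0.
have [xe|xe] := ltrP `|x| e.
  have := H x; rewrite /ball /= sub0r normrN => /(_ xe xn0).
  by rewrite normrX real_normK ?num_real // => /le_trans; apply; rewrite lerDl.
have h1 : 2 + gamma <= (2 + gamma) / e ^+ 2 * x ^+ 2.
  rewrite -mulrA ler_peMr; [by []|lra|].
  rewrite mulrC ler_pdivlMr ?exprn_gt0 // mul1r -(real_normK (num_real x)).
  by rewrite lerXn2r // ?nnegrE ?normr_ge0 // ltW.
apply: (@le_trans _ _ (2 + gamma)); last by apply: le_trans h1 _; rewrite lerDr mulr_ge0 // ltW.
move: x2; rewrite ler_norml => /andP[x2 x2'].
have := @maj_f_range (2^-1 + x); rewrite ler_norml => h.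
have {h} /andP[h h'] := h ltac:(lra).
by apply/andP; split; nra.
Qed.

(** On [[0, 1/2]] the convex function [f] lies above its tangent at [1/2], whose
    slope is [gamma]. *)
Lemma maj_tangent (y : R) : 0 <= y <= 2^-1 -> 2^-1 - gamma * y <= f (2^-1 - y).
Proof.
move=> /andP[y0 y2].
have [C C0 HC] := maj_half_expansion.
have g1 := maj_gamma hf.
have [y00|yp] := lerP y 0.
  have -> : y = 0 by lra.
  by rewrite mulr0 subr0 maj_half.
rewrite leNgt; apply/negP => lt.
pose d := 2^-1 - gamma * y - f (2^-1 - y).
have d0 : 0 < d by rewrite /d subr_gt0.
(* for small s the chord from 1/2 - y to 1/2 runs below 1/2 - gamma s - C s^2 *)
pose s := Num.min y (d / (2 * C * y)).
have s0 : 0 < s by rewrite lt_min yp divr_gt0 // !mulr_gt0.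
have sy : s <= y by rewrite /s ge_min lexx.
have := @maj_convex3 (2^-1 - y) (2^-1 - s) 2^-1.
rewrite maj_half => /(_ ltac:(lra_from y2 s0 sy) ltac:(lra_from y2 s0 sy) ltac:(lra_from y2 s0 sy) ltac:(lra_from y2 s0 sy)) H.
have := HC (- s); rewrite normrN gtr0_norm // => /(_ ltac:(lra)).
rewrite sqrrN ler_norml => /andP[H2 _].
have sd : s * (2 * C * y) <= d.
  by rewrite -ler_pdivlMr ?mulr_gt0 // /s ge_min lexx orbT.
have e1 : f (2^-1 - y) = 2^-1 - gamma * y - d by rewrite /d; ring.
rewrite e1 in H; clearbody d.
have H3 : y * (2^-1 - gamma * s - C * s ^+ 2) <= y * f (2^-1 - s).
  by rewrite ler_pM2l //; lra.
have H4 : s * d <= s * (C * y * s) by nra.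
have : d <= C * y * s by rewrite -(ler_pM2l s0).
nra.
Qed.

Lemma maj_half_lip (x : R) : `|x| <= 2^-1 -> `|f (2^-1 + x) - 2^-1| <= gamma * `|x|.
Proof.
move=> hx.
have neg y : 0 <= y <= 2^-1 -> `|f (2^-1 - y) - 2^-1| <= gamma * y.
  move=> hy; have := maj_tangent hy.
  have := @maj_le_half (2^-1 - y) ltac:(lra).
  by have := maj_gamma hf; rewrite ler_norml => *; apply/andP; split; nra.
move: hx; have [x0|x0] := ger0P x => hx; last first.
  by rewrite -[x in f (_ + x)]opprK; apply: neg; lra.
have -> : f (2^-1 + x) = 1 - f (2^-1 - x).
  by rewrite -maj_symE; [congr f|]; lra.
have -> : 1 - f (2^-1 - x) - 2^-1 = - (f (2^-1 - x) - 2^-1) by lra.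
by rewrite normrN; apply: neg; lra.
Qed.

Lemma maj_zero_expansion : exists2 C : R, 0 < C &
  forall x, 0 <= x <= 2^-1 -> `|f x - beta * x ^+ m| <= C * x ^+ m.+1.
Proof.
have [C [e [C0 /andP[e0 e2] H]]] := maj_near0.
have b0 := maj_beta hf; have m2 := maj_m hf.
have em : 0 < e ^+ m.+1 by rewrite exprn_gt0.
exists (C + (1 + beta) / e ^+ m.+1) => [|x /andP[x0 x2]].
  by rewrite addr_gt0 // divr_gt0 //; lra.
have xm : 0 <= x ^+ m.+1 by rewrite exprn_ge0.
rewrite mulrDl.
have h0 : 0 <= (1 + beta) / e ^+ m.+1 * x ^+ m.+1.
  by rewrite mulr_ge0 // divr_ge0 ?(ltW em) //; lra.
have [xx|xp] := lerP x 0.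
  have -> : x = 0 by lra.
  rewrite maj0 !expr0n /= gtn_eqF //; last by exact: leq_trans m2.
  by rewrite !mulr0 subr0 normr0 addr0.
have [xe|xe] := lerP x e.
  by have := H x; rewrite xp xe => /(_ isT) /le_trans; apply; rewrite lerDl.
apply: (@le_trans _ _ (1 + beta)); last first.
  have : 1 + beta <= (1 + beta) / e ^+ m.+1 * x ^+ m.+1.
    rewrite -mulrA ler_peMr; [by []|lra|].
    by rewrite mulrC ler_pdivlMr // mul1r lerXn2r // ?nnegrE ?(ltW e0) ?(ltW xe).
  by move=> /le_trans; apply; rewrite lerDr mulr_ge0 // ltW.
have /andP[f0 f1] : 0 <= f x <= 1 by apply: maj_f_range; lra.
have x1 : x ^+ m <= 1 by apply: exprn_ile1; lra.
have x1' : 0 <= x ^+ m by apply: exprn_ge0.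
by rewrite ler_norml; apply/andP; split; nra.
Qed.

Lemma maj_upper : exists2 C : R, 0 < C & forall x, 0 <= x <= 2^-1 -> f x <= C * x ^+ m.
Proof.
have [C C0 H] := maj_zero_expansion; have b0 := maj_beta hf.
exists (beta + C) => [|x hx]; first lra.
have := H x hx; rewrite ler_norml => /andP[_].
have : x ^+ m.+1 <= x ^+ m by apply: ler_wiXn2l => //; lra.
by nra.
Qed.

Lemma maj_lower : exists2 c : R, 0 < c & forall x, 0 <= x <= 2^-1 -> c * x ^+ m <= f x.
Proof.
have [C C0 H] := maj_zero_expansion; have b0 := maj_beta hf.
pose e := Num.min 2^-1 (beta / (2 * C)).
have e0 : 0 < e by rewrite lt_min invr_gt0 ltr0n divr_gt0 // mulr_gt0.
have eC : 2 * C * e <= beta.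
  by rewrite mulrC -ler_pdivlMr ?mulr_gt0 // /e ge_min lexx orbT.
have e2 : e <= 2^-1 by rewrite /e ge_min lexx.
have small x : 0 <= x <= e -> beta / 2 * x ^+ m <= f x.
  move=> hx; have := H x ltac:(lra); rewrite ler_norml => /andP[h _].
  have x0 : 0 <= x ^+ m by rewrite exprn_ge0 //; lra.
  have h2 : C * x <= beta / 2 by nra.
  have : C * x * x ^+ m <= beta / 2 * x ^+ m by apply: ler_wpM2r.
  by rewrite exprS mulrA in h; lra.
have fe : 0 < beta / 2 * e ^+ m by rewrite mulr_gt0 ?exprn_gt0 // divr_gt0.
exists (Num.min (beta / 2) (beta / 2 * e ^+ m)) => [|x hx].
  by rewrite lt_min fe divr_gt0.
have x0 : 0 <= x ^+ m by rewrite exprn_ge0 //; lra.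
have [xe|xe] := lerP x e.
  apply: le_trans (small x ltac:(lra)).
  by apply: ler_wpM2r => //; rewrite ge_min lexx.
apply: (@le_trans _ _ (beta / 2 * e ^+ m * 1)).
  apply: ler_pM => //; [by rewrite le_min ltW ?divr_gt0 // ltW|by rewrite ge_min lexx orbT|].
  by apply: exprn_ile1; lra.
rewrite mulr1; apply: le_trans (small e ltac:(lra)) _.
by apply: maj_mono; lra.
Qed.

Lemma maj_gt0 (x : R) : 0 < x <= 2^-1 -> 0 < f x.
Proof.
move=> hx; have [c c0 /(_ x ltac:(lra))] := maj_lower.
by apply: lt_le_trans; rewrite mulr_gt0 // exprn_gt0 //; lra.
Qed.

(** Near [0] this holds because [m >= 2]; convexity between a point near [0] and
    the fixed point [1/2] propagates the strict inequality. *)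
Lemma maj_lt_id (x : R) : 0 < x < 2^-1 -> f x < x.
Proof.
move=> /andP[x0 x2]; have [C C0 H] := maj_upper.
pose y := Num.min x (Num.min 4^-1 (2 * C)^-1).
have y0 : 0 < y by rewrite !lt_min x0 !invr_gt0 mulr_gt0 //= ltr0n.
have y4 : y <= 4^-1 by rewrite /y !ge_min lexx orbT.
have yx : y <= x by rewrite /y !ge_min lexx.
have yC : y * (2 * C) <= 1.
  by rewrite -ler_pdivlMr ?mulr_gt0 // mul1r /y !ge_min lexx !orbT.
have fy : f y < y.
  have := H y ltac:(lra).
  have : y ^+ m <= y ^+ 2 by apply: ler_wiXn2l; [lra|lra|exact: maj_m hf].
  rewrite expr2; nra.
have := @maj_convex3 y x 2^-1 ltac:(lra) yx ltac:(lra) ltac:(lra).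
rewrite maj_half => h; nra.
Qed.

Lemma maj_sq_bound : exists2 C : R, 0 < C & forall x, 0 <= x <= 1 -> f x <= C * x ^+ 2.
Proof.
have [C C0 H] := maj_upper.
exists (C + 4) => [|x hx]; first lra.
have [x2|x2] := lerP x 2^-1.
  have := H x ltac:(lra).
  have : x ^+ m <= x ^+ 2 by apply: ler_wiXn2l; [lra|lra|exact: maj_m hf].
  have := sqr_ge0 x; nra.
have /andP[_ f1] := maj_f_range hx.
rewrite expr2; nra.
Qed.

(** Convexity controls the relative variation of [f]: the slope of [f] left of
    [x] is at most its slope between [x] and [2 x], and [f (2 x) <= C f x]. *)
Lemma maj_elasticity : exists2 C : R, 1 <= C &
  forall x k, 0 <= x <= 2^-1 -> 0 <= k <= 1 -> (1 - C * k) * f x <= f ((1 - k) * x).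
Proof.
have [c c0 Hc] := maj_lower; have [C C0 HC] := maj_upper.
have g1 := maj_gamma hf.
have f4 : 0 < f 4^-1 by apply: maj_gt0; lra.
have r0 : 0 < C * 2 ^+ m / c by rewrite divr_gt0 // mulr_gt0 // exprn_gt0.
have r1 : 0 < gamma / f 4^-1 by rewrite divr_gt0 //; lra.
exists (1 + C * 2 ^+ m / c + gamma / f 4^-1) => [|x k hx hk]; first lra.
have fx := maj_ge0 (x := x) ltac:(lra).
have [x4|x4] := lerP x 4^-1.
  have h2 : f (2 * x) <= C * 2 ^+ m / c * f x.
    apply: le_trans (HC _ _) _; first lra.
    have -> : C * (2 * x) ^+ m = C * 2 ^+ m / c * (c * x ^+ m).
      by rewrite exprMn; field; rewrite gt_eqF.
    by apply: ler_wpM2l; [exact: ltW|exact: Hc].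
  have := @maj_convex3 ((1 - k) * x) x (2 * x) ltac:(nra) ltac:(nra) ltac:(lra) ltac:(lra).
  have -> : 2 * x - (1 - k) * x = (1 + k) * x by ring.
  have -> : 2 * x - x = x by ring.
  have -> : x - (1 - k) * x = k * x by ring.
  move=> h.
  have [x0|x0] := lerP x 0.
    have -> : x = 0 by lra.
    by rewrite !mulr0 maj0 mulr0.
  have h3 : (1 + k) * f x <= f ((1 - k) * x) + k * f (2 * x).
    by rewrite -(ler_pM2r x0); lra.
  set q := C * 2 ^+ m / c in h2 r0 *; set q' := gamma / _ in r1 *.
  clearbody q q'; have k0 : 0 <= k by lra.
  have : 0 <= q' * k * f x by rewrite !mulr_ge0 // ltW.
  have : k * f (2 * x) <= k * (q * f x) by apply: ler_wpM2l; lra.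
  have := mulr_ge0 (proj1 (andP hk)) fx; nra.
have f4x : f 4^-1 <= f x by apply: maj_mono; lra.
have h : f x - f ((1 - k) * x) <= gamma * (k * x).
  have [xh|xh] := lerP 2^-1 x.
    have -> : x = 2^-1 by lra.
    have := @maj_tangent (k * 2^-1) ltac:(nra).
    by rewrite maj_half mulrBl mul1r; lra.
  have := @maj_convex3 ((1 - k) * x) x 2^-1 ltac:(nra) ltac:(nra) ltac:(lra) ltac:(lra).
  have := @maj_tangent (2^-1 - x) ltac:(lra).
  have -> : 2^-1 - (2^-1 - x) = x by ring.
  rewrite maj_half => t h.
  have h' : k * x * (2^-1 - f x) <= k * x * (gamma * (2^-1 - x)).
    by apply: ler_wpM2l; [rewrite mulr_ge0 //; lra_from hx hk t|lra_from hx hk t].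
  have w0 : 0 < 2^-1 - x by lra.
  rewrite -(ler_pM2l w0); lra_from h h'.
have h2 : gamma * (k * x) <= gamma / f 4^-1 * k * f x.
  have -> : gamma * (k * x) = gamma / f 4^-1 * k * (x * f 4^-1).
    by field; rewrite gt_eqF.
  apply: ler_wpM2l; first by rewrite mulr_ge0 ?(ltW r1) //; lra_from hk h.
  nra.
set q := C * 2 ^+ m / c in r0 *; set q' := gamma / _ in r1 h2 *.
clearbody q q'; have k0 : 0 <= k by lra.
have : 0 <= q * k * f x by rewrite !mulr_ge0 // ltW.
have := mulr_ge0 (proj1 (andP hk)) fx; nra.
Qed.

End MajorityFunction.

(** * Boettcher coordinate of the attracting fixed point 0 *)

(** The intervals with ends [(u b - C) / M ^ b] and [(u b + C) / M ^ b] are nested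
    when [M >= 2]. *)
Lemma geometric_recurrence_cvg (R : realType) (M C : R) (u : nat -> R) :
  2 <= M -> (forall b, `|u b.+1 - M * u b| <= C) ->
  exists l : R, (u b / M ^+ b @[b --> \oo] --> l) /\
    (forall b, `|u b - M ^+ b * l| <= C).
Proof.
move=> M2 H.
have C0 : 0 <= C by apply: le_trans (H 0%N); exact: normr_ge0.
have M0 : 0 < M by lra.
have Mb b : 0 < M ^+ b by rewrite exprn_gt0.
pose lo b := (u b - C) / M ^+ b; pose hi b := (u b + C) / M ^+ b.
have lo_homo : {homo lo : a b / (a <= b)%N >-> a <= b}.
  apply: homo_leq => [//|y x z|b]; first exact: le_trans.
  rewrite /lo ler_pdivrMr // mulrAC ler_pdivlMr // exprS.
  have := H b; rewrite ler_norml => /andP[h _].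
  have : 0 <= (u b.+1 - C - M * (u b - C)) * M ^+ b by rewrite mulr_ge0 ?(ltW (Mb b)) //; nra.
  lra.
have hi_homo : {homo hi : a b / (a <= b)%N >-> b <= a}.
  apply: homo_leq => [//|y x z h1 h2|b]; first exact: le_trans h2 h1.
  rewrite /hi ler_pdivrMr // mulrAC ler_pdivlMr // exprS.
  have := H b; rewrite ler_norml => /andP[_ h].
  have : 0 <= (M * (u b + C) - (u b.+1 + C)) * M ^+ b by rewrite mulr_ge0 ?(ltW (Mb b)) //; nra.
  lra.
have lohi a b : lo a <= hi b.
  apply: (@le_trans _ _ (lo (maxn a b))); first by apply: lo_homo; rewrite leq_maxl.
  apply: (@le_trans _ _ (hi (maxn a b))); last by apply: hi_homo; rewrite leq_maxr.
  by rewrite ler_pM2r ?invr_gt0 //; lra.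
have cl : cvgn lo.
  apply: nondecreasing_is_cvgn => //.
  by exists (hi 0%N) => _ [b _ <-].
have geo : M^-1 ^+ b @[b --> \oo] --> (0 : R).
  apply: cvg_expr; rewrite ger0_norm ?invr_ge0 ?(ltW M0) // invf_lt1 //; lra.
exists (limn lo); split.
  rewrite (_ : (fun b => _) = (fun b => lo b + C * M^-1 ^+ b)); last first.
    by apply/funext => b; rewrite /lo exprVn -mulrDl subrK.
  rewrite -[X in _ --> X]addr0 -[X in _ + X](mulr0 C).
  by apply: cvgD => //; apply: cvgM => //; exact: cvg_cst.
move=> b; have h1 : lo b <= limn lo by apply: nondecreasing_cvgn_le.
have h2 : limn lo <= hi b by apply: limr_le => //; near=> k; exact: lohi.
by move: h1 h2; rewrite ler_pdivrMr // ler_pdivlMr // ler_norml => *; apply/andP; split; lra.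
Unshelve. all: by end_near. Qed.

Section Boettcher.
Variables (R : realType) (f : R -> R) (m : nat) (beta gamma : R).
Hypothesis hf : majority_type f m beta gamma.

Local Notation M := (m%:R : R).

Lemma maj_M : 2 <= M. Proof. by rewrite ler_nat; exact: maj_m hf. Qed.

Lemma iter_maj_range (x : R) b : 0 < x < 2^-1 -> 0 < iter b f x < 2^-1.
Proof.
move=> hx; elim: b => [//|b /= IH].
rewrite (maj_gt0 hf) /=; last lra.
by apply: lt_trans (maj_lt_id hf IH) _; lra.
Qed.

Lemma iter_maj_le (x : R) b : 0 < x < 2^-1 -> iter b f x <= x.
Proof.
move=> hx; elim: b => [//|b /= IH].
by apply: le_trans IH; apply: ltW; apply: (maj_lt_id hf); exact: iter_maj_range.
Qed.

Lemma iter_maj_mono (x y : R) b : 0 < x -> x <= y -> y < 2^-1 ->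
  iter b f x <= iter b f y.
Proof.
move=> x0 xy y2; elim: b => [//|b /= IH].
have /andP[? ?] := @iter_maj_range x b ltac:(lra).
have /andP[? ?] := @iter_maj_range y b ltac:(lra).
by apply: (maj_mono hf) => //; exact: ltW.
Qed.

(** [f x / x] is nondecreasing, so the orbit of [x] decays at least as fast as
    the powers of [f x / x < 1]. *)
Lemma iter_maj_geometric (x : R) b : 0 < x < 2^-1 ->
  iter b f x <= (f x / x) ^+ b * x.
Proof.
move=> hx; elim: b => [|b IH]; first by rewrite expr0 mul1r.
rewrite iterS; have /andP[p0 p2] := iter_maj_range b hx.
have x0 : 0 < x by lra.
have px := iter_maj_le b hx.
have := @maj_scale _ _ _ _ _ hf (iter b f x / x) x.
rewrite divfK ?gt_eqF // => /(_ _ _)/le_trans; apply.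
- by rewrite divr_ge0 ?(ltW p0) ?(ltW x0) //= ler_pdivrMr // mul1r.
- lra.
have -> : iter b f x / x * f x = f x / x * iter b f x by ring.
rewrite exprS -[leRHS]mulrA; apply: ler_wpM2l => //.
by rewrite divr_ge0 ?(ltW x0) // (maj_ge0 hf) //; lra.
Qed.

Lemma iter_maj_cvg0 (x e : R) : 0 < x < 2^-1 -> 0 < e ->
  exists b, iter b f x <= e.
Proof.
move=> hx e0.
have x0 : 0 < x by lra.
have fx := maj_lt_id hf hx.
have r0 : 0 <= f x / x by rewrite divr_ge0 ?(ltW x0) // (maj_ge0 hf) //; lra.
have : (f x / x) ^+ b @[b --> \oo] --> (0 : R).
  by apply: cvg_expr; rewrite ger0_norm // ltr_pdivrMr // mul1r.
move=> /cvgrPdist_le /(_ e e0)[b _ /(_ b (leqnn _))] /=.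
rewrite sub0r normrN ger0_norm ?exprn_ge0 // => h.
exists b; apply: le_trans (iter_maj_geometric b hx) _.
by apply: le_trans h; rewrite ler_piMr ?exprn_ge0 //; lra.
Qed.

(** This is [- ln] of the Boettcher coordinate of the superattracting fixed
    point [0] of [f]. *)
Definition boettcher (x : R) : R := limn (fun b => - ln (iter b f x) / M ^+ b).

(** The telescoping estimate behind the existence of [boettcher]: if
    [k - ln] is multiplied by [m] under [f] up to an error [e], then it differs
    from [boettcher] by at most [e], because the errors made at later times are
    divided by higher powers of [m]. *)
Lemma boettcher_approx (k e z : R) : 0 < z <= 2^-1 ->
  (forall x, 0 < x <= z -> `|(- ln (f x) + k) - M * (- ln x + k)| <= e) ->
  forall x, 0 < x < 2^-1 -> x <= z ->
  (- ln (iter b f x) / M ^+ b @[b --> \oo] --> boettcher x) /\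
  `|(- ln x + k) - boettcher x| <= e.
Proof.
move=> hz H x hx xz.
have M2 := maj_M; have M0 : 0 < M by lra.
have := @geometric_recurrence_cvg R M e (fun b => - ln (iter b f x) + k) M2.
case=> [b|l [cl Hl]].
  rewrite iterS; apply: H; have := iter_maj_range b hx.
  have := iter_maj_le b hx; lra.
have cl' : - ln (iter b f x) / M ^+ b @[b --> \oo] --> l.
  rewrite (_ : (fun b => _) =
    (fun b => (- ln (iter b f x) + k) / M ^+ b - k * M^-1 ^+ b)); last first.
    by apply/funext => b; rewrite exprVn -mulrBl addrK.
  rewrite -[X in _ --> X]subr0 -[X in _ - X](mulr0 k).
  apply: cvgB => //; apply: cvgM; first exact: cvg_cst.
  by apply: cvg_expr; rewrite ger0_norm ?invr_ge0 ?(ltW M0) // invf_lt1 //; lra.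
have -> : boettcher x = l by apply: cvg_lim.
by split => //; have := Hl 0%N; rewrite expr0 mul1r.
Qed.

Lemma boettcher_bounded_recurrence : exists C : R, forall x, 0 < x <= 2^-1 ->
  `|(- ln (f x) + 0) - M * (- ln x + 0)| <= C.
Proof.
have [c c0 Hc] := maj_lower hf; have [C C0 HC] := maj_upper hf.
exists (`|ln c| + `|ln C|) => x hx.
have x0 : 0 < x by lra.
have xm : 0 < x ^+ m by rewrite exprn_gt0.
have h1 : ln c + M * ln x <= ln (f x).
  rewrite mulr_natl -lnXn // -lnM ?posrE // ler_ln ?posrE ?mulr_gt0 //.
    by apply: Hc; lra.
  exact: maj_gt0 hf _ hx.
have h2 : ln (f x) <= ln C + M * ln x.
  rewrite mulr_natl -lnXn // -lnM ?posrE // ler_ln ?posrE ?mulr_gt0 //.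
    by apply: HC; lra.
  exact: maj_gt0 hf _ hx.
have := ler_norm (ln C); have := ler_norm (- ln c); rewrite normrN.
have := normr_ge0 (ln C); have := normr_ge0 (ln c).
by rewrite !addr0 ler_norml => *; apply/andP; split; lra.
Qed.

Lemma boettcher_cvg (x : R) : 0 < x < 2^-1 ->
  - ln (iter b f x) / M ^+ b @[b --> \oo] --> boettcher x.
Proof.
move=> hx; have [C HC] := boettcher_bounded_recurrence.
have hh : 0 < (2^-1 : R) <= 2^-1 by lra.
by have [] := boettcher_approx hh HC hx (ltW (proj2 (andP hx))).
Qed.

Lemma boettcher_near_ln : exists C : R, forall x, 0 < x < 2^-1 ->
  `|- ln x - boettcher x| <= C.
Proof.
have [C HC] := boettcher_bounded_recurrence; exists C => x hx.
have hh : 0 < (2^-1 : R) <= 2^-1 by lra.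
by have [_] := boettcher_approx hh HC hx (ltW (proj2 (andP hx))); rewrite addr0.
Qed.

Lemma boettcherM (x : R) : 0 < x < 2^-1 -> boettcher (f x) = M * boettcher x.
Proof.
move=> hx; have hx1 := iter_maj_range 1 hx.
have M2 := maj_M.
have /(cvgM (cvg_cst M)) := boettcher_cvg hx.
rewrite -(cvg_shiftn 1) => h; have h1 := @boettcher_cvg (f x) hx1.
apply: cvg_unique h1 _ => //.
rewrite (_ : (fun b => _) = (fun n => M * (- ln (iter (n + 1)%N f x) / M ^+ (n + 1)))) //.
apply/funext => b; rewrite addn1 iterSr exprS; field.
by rewrite expf_neq0 //= gt_eqF //; lra.
Qed.

Lemma boettcher_iter (x : R) b : 0 < x < 2^-1 ->
  boettcher (iter b f x) = M ^+ b * boettcher x.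
Proof.
move=> hx; elim: b => [|b IH]; first by rewrite mul1r.
by rewrite iterS boettcherM ?IH ?mulrA ?exprS //; exact: iter_maj_range.
Qed.

Lemma boettcher_le (x y : R) : 0 < x -> x <= y -> y < 2^-1 ->
  boettcher y <= boettcher x.
Proof.
move=> x0 xy y2.
have M2 := maj_M; have M0 : 0 < M by lra.
apply: (ler_lim (cvgP _ (boettcher_cvg _)) (cvgP _ (boettcher_cvg _))); [lra|lra|].
near=> b; rewrite ler_pM2r ?invr_gt0 ?exprn_gt0 // lerN2.
have /andP[? ?] := @iter_maj_range x b ltac:(lra).
have /andP[? ?] := @iter_maj_range y b ltac:(lra).
by rewrite ler_ln ?posrE //; exact: iter_maj_mono.
Unshelve. all: by end_near. Qed.

Lemma boettcher_gt0 (x : R) : 0 < x < 2^-1 -> 0 < boettcher x.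
Proof.
move=> hx; have [C HC] := boettcher_near_ln.
have M2 := maj_M; have M0 : 0 < M by lra.
have [b Hb] := @iter_maj_cvg0 x (expR (- (C + 1))) hx (expR_gt0 _).
have hb := iter_maj_range b hx.
have := HC _ hb; rewrite boettcher_iter // ler_norml => /andP[_ h].
have : ln (iter b f x) <= - (C + 1).
  by rewrite -[leRHS]expRK ler_ln ?posrE ?expR_gt0 //; case/andP: hb.
move=> h2; have : 0 < M ^+ b * boettcher x by lra.
by rewrite pmulr_rgt0 // exprn_gt0.
Qed.

(** As [ln (f x) - m ln x] tends to [ln beta] at [0], [boettcher] is [- ln] up to
    a constant and a vanishing error. *)
Lemma boettcher_asymptotic (e : R) : 0 < e -> exists k z : R, 0 < z /\
  forall x, 0 < x < 2^-1 -> x <= z -> `|(- ln x + k) - boettcher x| <= e.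
Proof.
move=> e0; have [C C0 HC] := maj_zero_expansion hf.
have b0 := maj_beta hf; have M2 := maj_M.
pose z := Num.min 2^-1 (beta * (1 - expR (- e)) / C).
have ee : expR (- e) < 1 by rewrite expR_lt1; lra.
have z0 : 0 < z by rewrite lt_min invr_gt0 ltr0n /= !divr_gt0 ?mulr_gt0 ?subr_gt0.
have z2 : z <= 2^-1 by rewrite /z ge_min lexx.
have zC : z * C <= beta * (1 - expR (- e)).
  by rewrite -ler_pdivlMr // /z ge_min lexx orbT.
pose k := - ln beta / (M - 1).
exists k, z; split => // x hx xz.
have hz : 0 < z <= 2^-1 by rewrite z0.
apply: (proj2 (boettcher_approx hz _ hx xz)) => {hx xz}x /andP[x0 xz].
have xm : 0 < x ^+ m by rewrite exprn_gt0.
have kE : (M - 1) * k = - ln beta by rewrite /k mulrC divfK // gt_eqF //; lra.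
have := HC x ltac:(lra); rewrite ler_norml => /andP[h1 h2].
have xC : C * x <= beta * (1 - expR (- e)) by nra.
have fx : 0 < f x by apply: (maj_gt0 hf); lra.
have fb : 0 < f x / (beta * x ^+ m) by rewrite divr_gt0 // mulr_gt0.
have -> : - ln (f x) + k - M * (- ln x + k) = - ln (f x / (beta * x ^+ m)).
  rewrite ln_div ?posrE ?mulr_gt0 // lnM ?posrE // lnXn // -mulr_natl.
  by lra.
have eK : expR e * expR (- e) = 1 by rewrite expRxMexpNx_1.
have e1 : 1 <= expR e by rewrite -expR0 ler_expR; lra.
have en := expR_gt0 (- e).
rewrite normrN ler_norml; apply/andP; split.
  rewrite -[leLHS]expRK ler_ln ?posrE ?expR_gt0 // ler_pdivlMr ?mulr_gt0 //.
  rewrite exprS in h1; have : C * x * x ^+ m <= beta * (1 - expR (- e)) * x ^+ m by rewrite ler_wpM2r // ltW.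
  lra.
rewrite -[leRHS]expRK ler_ln ?posrE ?expR_gt0 // ler_pdivrMr ?mulr_gt0 //.
rewrite exprS in h2; have : C * x * x ^+ m <= beta * (1 - expR (- e)) * x ^+ m by rewrite ler_wpM2r // ltW.
have : 2 <= expR e + expR (- e).
  have : 0 <= (expR e - 1) * (1 - expR (- e)) by rewrite mulr_ge0 //; lra_from ee e1 h2.
  lra.
move=> h3 h4.
have : 2 * (beta * x ^+ m) <= (expR e + expR (- e)) * (beta * x ^+ m).
  by rewrite ler_wpM2r // mulr_ge0 ?ltW.
lra.
Qed.

(** Orbits of points at a fixed ratio keep at least that ratio, because
    [f x / x] is nondecreasing; close to [0] this becomes a fixed gap between
    the values of [boettcher], and the functional equation carries the gap back.
    The time needed to come close to [0] is bounded uniformly below [y0]. *)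
Lemma boettcher_gap (y0 r : R) : 0 < y0 < 2^-1 -> 1 < r ->
  exists2 w : R, 0 < w & forall x y, 0 < x -> r * x <= y -> y <= y0 ->
    boettcher y + w <= boettcher x.
Proof.
move=> hy0 r1; have M2 := maj_M.
have lr : 0 < ln r by rewrite ln_gt0.
have e0 : 0 < ln r / 4 by lra.
have [k [z [z0 Hz]]] := boettcher_asymptotic e0.
have [b Hb] := iter_maj_cvg0 hy0 z0.
have Mb : 0 < M ^+ b by rewrite exprn_gt0 //; lra.
exists (ln r / 2 / M ^+ b) => [|x y x0 rxy yy0]; first by rewrite !divr_gt0.
have xy : x <= y by nra.
have ratio j : r * iter j f x <= iter j f y.
  elim: j => [//|j IH]; rewrite !iterS.
  have /andP[p0 p2] := @iter_maj_range x j ltac:(lra).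
  have /andP[q0 q2] := @iter_maj_range y j ltac:(lra).
  have := @maj_scale _ _ _ _ _ hf (iter j f x / iter j f y) (iter j f y).
  rewrite divfK ?gt_eqF // => /(_ _ _) h.
  rewrite -ler_pdivlMl; last lra.
  apply: le_trans (h _ _) _; last 1 first.
  - apply: ler_wpM2r; first by apply: (maj_ge0 hf); lra.
    by rewrite ler_pdivrMr // -ler_pdivlMl // in IH *; lra.
  - by rewrite divr_ge0 ?(ltW p0) ?(ltW q0) //= ler_pdivrMr // mul1r; nra.
  - by rewrite !ltW.
have /andP[p0 p2] := @iter_maj_range x b ltac:(lra).
have /andP[q0 q2] := @iter_maj_range y b ltac:(lra).
have yb : iter b f y <= z by apply: le_trans Hb; apply: iter_maj_mono; lra.
have xb : iter b f x <= z by apply: le_trans yb; have := ratio b; nra.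
have := Hz _ (@iter_maj_range x b ltac:(lra)) xb.
have := Hz _ (@iter_maj_range y b ltac:(lra)) yb.
rewrite !boettcher_iter; [|lra|lra].
rewrite !ler_norml => /andP[h1 h2] /andP[h3 h4].
have : ln r + ln (iter b f x) <= ln (iter b f y).
  by rewrite -lnM ?posrE //; [rewrite ler_ln ?posrE ?mulr_gt0 //; lra_from hy0 r1|lra_from hy0 r1].
move=> h5; rewrite -(ler_pM2l Mb) mulrDr.
have -> : M ^+ b * (ln r / 2 / M ^+ b) = ln r / 2 by field; rewrite gt_eqF.
lra.
Qed.

(** A relative error [k] in the argument becomes a relative error at most
    [D ^ b k] after [b] iterations, and [b] is chosen so large that the bounded
    difference between [boettcher] and [- ln] is negligible after division by
    [m ^ b]. *)
Lemma boettcher_unif (tol : R) : 0 < tol -> exists2 k0 : R, 0 < k0 <= 1 / 2 &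
  forall x k, 0 < x < 2^-1 -> 0 <= k <= k0 ->
    boettcher ((1 - k) * x) <= boettcher x + tol.
Proof.
move=> t0; have M2 := maj_M; have M0 : 0 < M by lra.
have [C HC] := boettcher_near_ln; have [D D1 HD] := maj_elasticity hf.
have C0 : 0 <= C.
  by apply: le_trans (HC 4^-1 _); [exact: normr_ge0|lra].
have [b Hb] : exists b, 4 * C / tol <= M ^+ b.
  exists (Num.truncn (4 * C / tol)).+1.
  apply: (@le_trans _ _ (Num.truncn (4 * C / tol)).+1%:R).
    by apply: ltW; exact: truncnS_gt.
  by rewrite -natrX ler_nat ltnW // ltn_expl //; exact: maj_m hf.
have Mb : 0 < M ^+ b by rewrite exprn_gt0.
have Db : 0 < D ^+ b by rewrite exprn_gt0 //; lra.
have D1b : 1 <= D ^+ b by rewrite exprn_ege1.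
rewrite ler_pdivrMr // in Hb.
pose q := 1 - expR (- (tol / 2)).
have q0 : 0 < q by rewrite subr_gt0 expR_lt1; lra.
exists (Num.min (1 / 2) (q / D ^+ b)).
  by rewrite lt_min !divr_gt0 //= ge_min lexx.
move=> x k hx; rewrite le_min => /andP[k0 /andP[k2 kq]].
have kD : D ^+ b * k <= q by rewrite mulrC -ler_pdivlMr.
have kx : 0 < (1 - k) * x < 2^-1 by rewrite mulr_gt0 /=; [nra_from hx k0 k2|lra_from hx k0 k2|lra_from hx k0 k2].
have q1 : q < 1 by rewrite /q; have := expR_gt0 (- (tol / 2)); lra.
have el j : (j <= b)%N -> (1 - D ^+ j * k) * iter j f x <= iter j f ((1 - k) * x).
  elim: j => [|j IH jb]; first by rewrite mul1r.
  have Djk : 0 <= D ^+ j * k <= 1.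
    rewrite mulr_ge0 ?exprn_ge0 //=; [|lra].
    apply: (@le_trans _ _ (D ^+ b * k)); last lra.
    by apply: ler_wpM2r => //; apply: ler_weXn2l => //; exact: ltnW.
  have hj := iter_maj_range j hx; have hkj := iter_maj_range j kx.
  rewrite !iterS; apply: (@le_trans _ _ (f ((1 - D ^+ j * k) * iter j f x))).
    by rewrite exprS -mulrA; apply: HD; lra_from Djk hj.
  by apply: (maj_mono hf); [nra_from Djk hj hkj|exact: IH (ltnW jb)|lra_from Djk hj hkj].
have hb := iter_maj_range b hx; have hkb := iter_maj_range b kx.
have := HC _ hb; have := HC _ hkb.
rewrite !boettcher_iter // !ler_norml => /andP[h1 h2] /andP[h3 h4].
have h5 : - (tol / 2) + ln (iter b f x) <= ln (iter b f ((1 - k) * x)).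
  rewrite -[- (tol / 2)]expRK -lnM ?posrE ?expR_gt0 //; last by case/andP: hb.
  rewrite ler_ln ?posrE ?mulr_gt0 ?expR_gt0 //; [|by case/andP: hb|by case/andP: hkb].
  apply: le_trans (el b (leqnn _)); apply: ler_wpM2r; first lra_from hb.
  by rewrite /q in kD; lra_from kD.
rewrite -(ler_pM2l Mb) mulrDr.
have : tol <= M ^+ b * tol.
  by rewrite ler_peMl ?(ltW t0) // exprn_ege1 //; lra_from M2 h5.
have : 4 * C <= M ^+ b * tol by [].
lra_from h1 h4 h5.
Qed.

End Boettcher.

(** * Abel functions of f and its linearisation at 1/2 *)

Section Abel.
Variables (R : realType) (f : R -> R) (m : nat) (beta gamma : R).
Hypothesis hf : majority_type f m beta gamma.

Local Notation M := (m%:R : R).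
Local Notation B := (boettcher f m).

Lemma maj_lnM : 0 < ln M.
Proof. by rewrite ln_gt0 //; have := maj_M hf; lra. Qed.

#[local] Opaque boettcher.

(** [B] in the coordinate in which [f] acts as a translation by [-1]. *)
Definition abel (x : R) : R := - log M (B x).

Lemma abel_cvg (x : R) : 0 < x < 2^-1 ->
  b%:R - log M `|ln (iter b f x)| @[b --> \oo] --> abel x.
Proof.
move=> hx; have lM := maj_lnM; have M2 := maj_M hf.
have B0 := boettcher_gt0 hf hx.
rewrite (_ : (fun b : nat => _) = (fun b => - log M (- ln (iter b f x) / M ^+ b))).
  apply: cvgN; apply: cvgM; last exact: cvg_cst.
  exact: (continuous_cvg _ (continuous_ln B0) (boettcher_cvg hf hx)).
apply/funext => b.
have /andP[p0 p2] := iter_maj_range hf b hx.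
have l0 : ln (iter b f x) < 0 by rewrite ln_lt0 // p0; lra.
have Mb : 0 < M ^+ b by rewrite exprn_gt0 //; lra.
rewrite ltr0_norm // /log ln_div ?posrE //; last lra.
rewrite lnXn; last lra.
rewrite -[ln M *+ b]mulr_natl mulrBl mulfK ?gt_eqF //; lra.
Qed.

Lemma abelB1 (x : R) : 0 < x < 2^-1 -> abel (f x) = abel x - 1.
Proof.
move=> hx; have lM := maj_lnM; have M2 := maj_M hf.
have B0 := boettcher_gt0 hf hx.
rewrite /abel (boettcherM hf) // /log lnM ?posrE //; last lra.
by field; rewrite gt_eqF.
Qed.

Lemma abel_le (x y : R) : 0 < x -> x <= y -> y < 2^-1 -> abel x <= abel y.
Proof.
move=> x0 xy y2; have lM := maj_lnM.
rewrite /abel lerN2 /log ler_pM2r ?invr_gt0 //.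
rewrite ler_ln ?posrE; first exact: (boettcher_le hf).
- by apply: (boettcher_gt0 hf); lra.
- by apply: (boettcher_gt0 hf); lra.
Qed.

Lemma abel_gap (x0 y0 r : R) : 0 < x0 -> x0 < 2^-1 -> y0 < 2^-1 -> 1 < r ->
  exists2 w : R, 0 < w & forall x y, 0 < x -> r * x <= y -> x0 <= y <= y0 ->
    abel x + w <= abel y.
Proof.
move=> hx0 hx02 hy0 r1; have lM := maj_lnM.
have [yx|xy] := ltrP y0 x0.
  by exists 1 => // x y _ _ /andP[h1 h2]; have := le_trans h1 h2; lra.
have [w w0 Hw] := boettcher_gap hf (y0 := y0) (r := r) ltac:(lra) r1.
have B0 : 0 < B x0 by apply: (boettcher_gt0 hf); lra.
have wB : 0 < w / B x0 by rewrite divr_gt0.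
exists (ln (1 + w / B x0) / ln M) => [|x y xp rxy hy].
  by rewrite divr_gt0 // ln_gt0 //; lra.
have xy' : x <= y by nra.
have By : 0 < B y by apply: (boettcher_gt0 hf); lra.
have Byx : B y <= B x0 by apply: (boettcher_le hf); lra_from hx0 hy0 hy.
have gap := Hw x y xp rxy (proj2 (andP hy)).
rewrite /abel /log -mulNr -mulrDl -mulNr ler_pM2r ?invr_gt0 //.
suff : ln (B y) + ln (1 + w / B x0) <= ln (B x) by lra.
rewrite -lnM ?posrE //; last lra.
rewrite ler_ln ?posrE ?mulr_gt0 //; [|lra_from w0 wB By gap|lra_from w0 wB By gap].
apply: le_trans gap; rewrite mulrDr mulr1 lerD2l mulrCA ler_piMr ?(ltW w0) //.
by rewrite ler_pdivrMr // mul1r.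
Qed.

#[local] Opaque abel.

(** The values of [abel] seen from the repelling fixed point [1 / 2] of
    multiplier [gamma]: the map [y |-> 1 / 2 - y / gamma ^+ a] linearises [f]
    near [1 / 2] as [a] grows. *)
Definition abel_half_seq (y : R) (a : nat) : R :=
  abel (2^-1 - y / gamma ^+ a) - a%:R.

Definition abel_half (y : R) : R := limn (abel_half_seq y).

Lemma gammaX_gt0 (a : nat) : 0 < gamma ^+ a.
Proof. by have g1 := maj_gamma hf; rewrite exprn_gt0 //; lra. Qed.

Lemma gamma_small (y e : R) : 0 < y -> 0 < e -> exists a, y / gamma ^+ a <= e.
Proof.
have g1 := maj_gamma hf; have gn := gammaX_gt0.
move=> y0 e0.
have : gamma^-1 ^+ a @[a --> \oo] --> (0 : R).
  by apply: cvg_expr; rewrite ger0_norm ?invr_ge0 ?invf_lt1 //; lra.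
move=> /cvgrPdist_le /(_ (e / y) (divr_gt0 e0 y0))[a _ /(_ a (leqnn _))] /=.
rewrite sub0r normrN ger0_norm ?exprn_ge0 ?invr_ge0 //; last lra.
by exists a; rewrite mulrC -ler_pdivlMr // -exprVn.
Qed.

(** The chord inequality [f (1/2 - y) >= 1/2 - gamma y] makes the sequence
    nondecreasing; it is bounded because [1/2 - y + K y^2] is a
    supersolution of the linearised recursion when [K = C / (gamma (gamma - 1))]
    and [C y^2] bounds the remainder of [f] at [1 / 2]. *)
Lemma abel_half_small : exists K y1 : R, [/\ 0 < K, 0 < y1, y1 <= 4^-1 &
  forall y, 0 < y <= y1 -> [/\ cvgn (abel_half_seq y), K * y <= 2^-1,
    abel (2^-1 - y) <= abel_half y &
    abel_half y <= abel (2^-1 - (y - K * y ^+ 2))]].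
Proof.
have g1 := maj_gamma hf; have gn := gammaX_gt0.
have [C C0 HC] := maj_half_expansion hf.
pose K := C / (gamma * (gamma - 1)).
have gg : 0 < gamma * (gamma - 1) by rewrite mulr_gt0 //; lra.
have K0 : 0 < K by rewrite divr_gt0.
have KC : K * (gamma * (gamma - 1)) = C by rewrite /K divfK // gt_eqF.
clearbody K.
pose y1 := Num.min 4^-1 (2 * K)^-1.
have y10 : 0 < y1 by rewrite lt_min !invr_gt0 mulr_gt0 // ltr0n.
have y14 : y1 <= 4^-1 by rewrite /y1 ge_min lexx.
have y1K : y1 * (2 * K) <= 1.
  by rewrite -ler_pdivlMr ?mulr_gt0 // mul1r /y1 ge_min lexx orbT.
exists K, y1; split => // y /andP[y0 yy1].
pose rho z := z - K * z ^+ 2.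
have rho_range z : 0 < z <= y1 -> 0 < rho z <= z.
  move=> hz; have : K * z <= 2^-1 by nra.
  rewrite /rho expr2 => h; apply/andP; split; last by have := sqr_ge0 z; nra.
  by have : 0 < z * (1 - K * z) by [rewrite mulr_gt0 //; lra]; lra.
have rho_step z : 0 < z -> gamma * z <= y1 -> f (2^-1 - rho z) <= 2^-1 - rho (gamma * z).
  move=> z0 gz; have hz : 0 < z <= y1 by nra.
  have /andP[r0 rz] := rho_range z hz.
  have := HC (- rho z); rewrite normrN gtr0_norm // => /(_ ltac:(lra)).
  rewrite sqrrN ler_norml => /andP[_ h].
  have : C * rho z ^+ 2 <= C * z ^+ 2.
    by rewrite ler_pM2l // lerXn2r // ?nnegrE ltW.
  rewrite -[C * z ^+ 2]/(C * z ^+ 2) -{2}KC.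
  have -> : rho (gamma * z) = gamma * z - K * (gamma * z) ^+ 2 by [].
  have -> : rho z = z - K * z ^+ 2 by [].
  by move: h; rewrite /rho; lra.
have ga a : y / gamma ^+ a.+1 = y / gamma ^+ a / gamma by rewrite exprSr invfM mulrA.
have gya a : gamma * (y / gamma ^+ a.+1) = y / gamma ^+ a.
  by rewrite ga mulrCA divff ?mulr1 // gt_eqF //; lra.
have yga a : 0 < y / gamma ^+ a <= y1.
  rewrite divr_gt0 //=; apply: le_trans yy1.
  by rewrite ler_pdivrMr // ler_peMr ?(ltW y0) // exprn_ege1 // ltW.
have up a : abel_half_seq y a <= abel (2^-1 - rho y).
  rewrite /abel_half_seq.
  apply: (@le_trans _ _ (abel (2^-1 - rho (y / gamma ^+ a)) - a%:R)).
    rewrite lerD2r; have := rho_range _ (yga a); have := yga a => h1 h2.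
    by apply: abel_le; lra_from y14 h1 h2.
  elim: a => [|a IH]; first by rewrite expr0 divr1 subr0.
  apply: le_trans IH.
  have h1 := yga a; have h2 := yga a.+1; have h3 := rho_range _ h1; have h4 := rho_range _ h2.
  have := @abelB1 (2^-1 - rho (y / gamma ^+ a.+1)) ltac:(lra).
  have := rho_step (y / gamma ^+ a.+1); rewrite gya.
  move=> /(_ (proj1 (andP h2)) (proj2 (andP h1))) h5.
  have := @abel_le (f (2^-1 - rho (y / gamma ^+ a.+1))) (2^-1 - rho (y / gamma ^+ a)).
  move=> /(_ _ h5 _) h6 h7.
  have {}h6 := h6 (maj_gt0 hf (x := 2^-1 - rho (y / gamma ^+ a.+1)) ltac:(lra_from y14 h2 h3 h4)) ltac:(lra_from y14 h2 h3 h4).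
  move: h6; rewrite h7 -[a.+1%:R]natr1.
  by move: (abel _) (abel _) => u v {h1 h2 h3 h4 h5 h7 yga}; lra.
have inc : {homo abel_half_seq y : a b / (a <= b)%N >-> a <= b}.
  apply: homo_leq => [//|b a c|a]; first exact: le_trans.
  rewrite /abel_half_seq; have h1 := yga a; have h2 := yga a.+1.
  have := maj_tangent hf (y := y / gamma ^+ a.+1) ltac:(lra).
  rewrite gya => h5.
  have := @abelB1 (2^-1 - y / gamma ^+ a.+1) ltac:(lra).
  have := maj_lt_id hf (x := 2^-1 - y / gamma ^+ a.+1) ltac:(lra).
  have := @abel_le (2^-1 - y / gamma ^+ a) (f (2^-1 - y / gamma ^+ a.+1)) ltac:(lra) h5.
  move=> h6 h7 h8.
  have {}h6 := h6 ltac:(lra_from h7 h2 y14 yy1).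
  rewrite h8 in h6; rewrite -[a.+1%:R]natr1.
  by rewrite [_ + 1]addrC opprD addrA lerD2r.
have cv : cvgn (abel_half_seq y).
  by apply: nondecreasing_is_cvgn => //; exists (abel (2^-1 - rho y)) => _ [a _ <-].
split => //; first by nra.
- by have := nondecreasing_cvgn_le inc cv 0%N; rewrite /abel_half_seq expr0 divr1 subr0.
- by apply: limr_le => //; near=> a; exact: up.
Unshelve. all: by end_near. Qed.

Lemma abel_half_seq_shift (y l : R) (k : nat) :
  (abel_half_seq (y / gamma ^+ k) a @[a --> \oo] --> l) ->
  (abel_half_seq y a @[a --> \oo] --> l - k%:R).
Proof.
have g1 := maj_gamma hf; have gn := gammaX_gt0.
move=> h; rewrite -(cvg_shiftn k).
rewrite (_ : (fun n => _) = (fun a => abel_half_seq (y / gamma ^+ k) a - k%:R)).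
  by apply: cvgB => //; exact: cvg_cst.
apply/funext => a; rewrite /abel_half_seq.
have -> : y / gamma ^+ (a + k) = y / gamma ^+ k / gamma ^+ a.
  by rewrite addnC exprD invfM mulrA.
by rewrite natrD opprD addrA.
Qed.

Lemma abel_half_cvg (y : R) : 0 < y ->
  abel_half_seq y a @[a --> \oo] --> abel_half y.
Proof.
have g1 := maj_gamma hf; have gn := gammaX_gt0.
move=> y0; have [K [y1 [_ y10 _ H]]] := abel_half_small.
have [k Hk] := gamma_small y0 y10.
have [] := H (y / gamma ^+ k); first by rewrite Hk divr_gt0.
by move=> c _ _ _; apply: (cvgP _ (abel_half_seq_shift c)).
Qed.

Lemma abel_half_div (y : R) : 0 < y -> abel_half (y / gamma) = abel_half y + 1.
Proof.
have g1 := maj_gamma hf; have gn := gammaX_gt0.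
move=> y0; have yg : 0 < y / gamma by rewrite divr_gt0 //; lra.
have h := abel_half_cvg yg.
have := @abel_half_seq_shift y (abel_half (y / gamma)) 1.
rewrite expr1 => /(_ h) h1; have h2 := abel_half_cvg y0.
by rewrite (cvg_unique _ h2 h1) // subrK.
Qed.

Lemma abel_half_divX (y : R) k : 0 < y -> abel_half (y / gamma ^+ k) = abel_half y + k%:R.
Proof.
have g1 := maj_gamma hf; have gn := gammaX_gt0.
move=> y0; elim: k => [|k IH]; first by rewrite divr1 addr0.
rewrite exprSr invfM mulrA abel_half_div; first by rewrite IH -natr1 addrA.
by rewrite divr_gt0.
Qed.

Lemma abel_half_le (y z : R) : 0 < y -> y <= z -> abel_half z <= abel_half y.
Proof.
have g1 := maj_gamma hf; have gn := gammaX_gt0.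
move=> y0 yz; have z0 : 0 < z by lra.
apply: (ler_lim (cvgP _ (abel_half_cvg z0)) (cvgP _ (abel_half_cvg y0))).
have e4 : 0 < (4^-1 : R) by rewrite invr_gt0 ltr0n.
have [k Hk] := gamma_small z0 e4.
near=> a; rewrite /abel_half_seq lerD2r.
have zk : z / gamma ^+ a <= 4^-1.
  apply: le_trans Hk.
  rewrite ler_pM2l // lef_pV2 ?posrE //; apply: ler_weXn2l; first lra.
  by near: a; exact: nbhs_infty_ge.
have yk : y / gamma ^+ a <= z / gamma ^+ a by rewrite ler_pM2r ?invr_gt0.
have ya : 0 < y / gamma ^+ a by rewrite divr_gt0.
by apply: abel_le; lra.
Unshelve. all: by end_near. Qed.

#[local] Opaque abel_half.

(** Replacing the limit [abel_half] by its zeroth approximation costs less than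
    a rescaling of [y] by any fixed factor [> 1], with room to spare. *)
Lemma abel_half_gap (th : R) : 1 < th -> exists2 y0 : R, 0 < y0 <= 4^-1 &
  forall al : R, 0 < al -> exists2 w : R, 0 < w & forall y, al <= y <= y0 ->
    abel_half (th * y) + w <= abel (2^-1 - y) /\
    abel (2^-1 - y) + w <= abel_half (y / th).
Proof.
have g1 := maj_gamma hf; have gn := gammaX_gt0.
move=> th1; have [K [y1 [K0 y10 y14 H]]] := abel_half_small.
(* [th = t * s]: the factor [t] absorbs the difference between [abel_half] and
   its zeroth approximation, and the factor [s] produces the gap [w] *)
pose s := (1 + th) / 2.
have s1 : 1 < s by rewrite /s; lra.
have sth : s < th by rewrite /s; lra.
pose t := th / s.
have ts : t * s = th by rewrite /t divfK // gt_eqF //; lra.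
have t1 : 1 < t by rewrite /t ltr_pdivlMr //; lra.
clearbody t s.
pose y0 := Num.min (y1 / th) ((t - 1) / (K * t * th)).
have y00 : 0 < y0.
  by rewrite lt_min !divr_gt0 ?mulr_gt0 //; lra.
have y0y1 : y0 * th <= y1 by rewrite -ler_pdivlMr ?ge_min ?lexx //; lra.
have y0t : y0 * (K * t * th) <= t - 1.
  by rewrite -ler_pdivlMr ?ge_min ?lexx ?orbT // !mulr_gt0 //; lra.
have key z : 0 < z -> z <= s * y0 -> abel_half (t * z) <= abel (2^-1 - z).
  move=> z0 zs.
  have tz : t * z <= y0 * th by rewrite -ts; nra.
  have [_ Ktz _ h] := H (t * z) ltac:(nra).
  apply: le_trans h _.
  have h2 : t * (K * z * t) <= t - 1 by rewrite -ts in y0t; nra.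
  have h3 : z <= t * z - K * (t * z) ^+ 2.
    have : 0 <= z * (t - 1 - t * (K * z * t)) by rewrite mulr_ge0 //; lra.
    by lra.
  have : t * z - K * (t * z) ^+ 2 <= t * z by rewrite gerBl mulr_ge0 ?sqr_ge0 // ltW.
  move=> h4.
  by apply: abel_le; lra.
exists y0; first by rewrite y00 /=; nra.
move=> al al0.
have [ly|yl] := ltrP y0 al.
  by exists 1 => // y /andP[h1 h2]; have := le_trans h1 h2; rewrite leNgt ly.
have si : s^-1 < 1 by rewrite invf_lt1 //; lra.
have si0 : 0 < s^-1 by rewrite invr_gt0; lra.
have [w1 w10 Hw1] := @abel_gap 4^-1 (2^-1 - al) (1 + 2 * (s - 1) * al)
   ltac:(lra_from al0 si0) ltac:(lra_from al0 si0) ltac:(lra_from al0 si0) ltac:(nra).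
have [w2 w20 Hw2] := @abel_gap 4^-1 (2^-1 - al * s^-1) (1 + 2 * (1 - s^-1) * al)
   ltac:(lra_from si0 w10) ltac:(lra_from si0 w10) ltac:(nra) ltac:(nra).
exists (Num.min w1 w2) => [|y /andP[ay yy]]; first by rewrite lt_min w10.
have wm1 : Num.min w1 w2 <= w1 by rewrite ge_min lexx.
have wm2 : Num.min w1 w2 <= w2 by rewrite ge_min lexx orbT.
have y4 : s * y <= 4^-1 by nra.
have y4' : y <= 4^-1 by nra.
split.
  have h1 := key (s * y) ltac:(nra) ltac:(nra).
  rewrite mulrA ts in h1.
  have h3 : al * (1 - 2 * (s * y)) <= y.
    have : 0 <= al * (s * y) by rewrite !mulr_ge0 //; lra_from s1 al0 ay.
    by move: ay; clear -al0; move: (s * y) => u; lra.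
  have h4 : 0 <= (s - 1) * (y - al * (1 - 2 * (s * y))) by rewrite mulr_ge0 //; lra_from s1 h3.
  have h2 := Hw1 (2^-1 - s * y) (2^-1 - y) ltac:(lra_from ay y4 y4' h4) ltac:(lra_from ay y4 y4' h4) ltac:(lra_from ay y4 y4' h4).
  lra_from wm1 h1 h2.
have sy : y * s^-1 <= y by nra.
have sy0 : 0 < y * s^-1 by nra.
have ays : al * s^-1 <= y * s^-1 by nra.
have h5 : y / th <= y / s.
  by rewrite ler_pM2l; [rewrite lef_pV2 ?posrE; lra_from s1 sth sy sy0|lra_from s1 sth sy sy0].
have h6 : 0 < y / th by rewrite divr_gt0 //; lra_from th1 sy sy0.
have h3 : al * (1 - 2 * y) <= y.
  by have : 0 <= al * y by [rewrite !mulr_ge0 //; lra_from al0 ay]; lra_from al0 ay.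
have h4 : 0 <= (1 - s^-1) * (y - al * (1 - 2 * y)) by rewrite mulr_ge0 //; lra_from si h3.
have h2 := Hw2 (2^-1 - y) (2^-1 - y * s^-1) ltac:(lra_from y4' sy ays h4) ltac:(lra_from y4' sy ays h4) ltac:(lra_from y4' sy ays h4).
have [_ _ h1 _] := H (y / s) ltac:(nra).
apply: le_trans (le_trans h1 (abel_half_le h6 h5)); apply: le_trans h2.
by rewrite lerD2l.
Qed.

(** [abel_half] is nonincreasing and takes arbitrarily large and arbitrarily
    negative values, by its behaviour under division by [gamma]. *)
Lemma abel_half_threshold (q : R) : exists2 Y : R, 0 < Y &
  (forall y, 0 < y < Y -> q <= abel_half y) /\ (forall y, Y < y -> abel_half y < q).
Proof.
have g1 := maj_gamma hf; have gn := gammaX_gt0.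
pose S := [set y : R | 0 < y /\ q <= abel_half y].
have [k Hk] : exists k : nat, q - abel_half 1 <= k%:R.
  by exists (Num.truncn (q - abel_half 1)).+1; exact/ltW/truncnS_gt.
have Sk : S (1 / gamma ^+ k).
  by split; [rewrite divr_gt0|rewrite abel_half_divX //; lra].
have [l Hl] : exists l : nat, abel_half 1 - q < l%:R.
  by exists (Num.truncn (abel_half 1 - q)).+1; exact/truncnS_gt.
have Sub : ubound S (gamma ^+ l).
  move=> y [y0 hy]; rewrite leNgt; apply/negP => ly.
  have := abel_half_le (gn l) (ltW ly).
  have := abel_half_divX l (gn l).
  have -> : gamma ^+ l / gamma ^+ l = 1 by rewrite divff // gt_eqF.
  move: Hl hy => + + e1; rewrite e1 {Hk Sk ly e1}.
  by move: (abel_half y) (abel_half (gamma ^+ l)) (l%:R) => u v w; lra.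
have hS : has_sup S by split; [exists (1 / gamma ^+ k)|exists (gamma ^+ l)].
exists (sup S); [|split].
- apply: lt_le_trans (_ : 1 / gamma ^+ k <= _); first by rewrite divr_gt0.
  exact: (ub_le_sup (proj2 hS) Sk).
- move=> y /andP[y0 /(sup_gt (proj1 hS))[z [z0 hz] yz]].
  by apply: le_trans hz _; apply: abel_half_le => //; exact: ltW.
move=> y; apply: contraPP => /negP; rewrite -leNgt => hy; apply/negP; rewrite -leNgt.
have [y0|y0] := lerP y 0.
  apply: le_trans y0 _; apply: (@le_trans _ _ (1 / gamma ^+ k)); first by rewrite divr_ge0 // ltW.
  exact: (ub_le_sup (proj2 hS) Sk).
by apply: (ub_le_sup (proj2 hS)); split.
Qed.

Lemma limit_gE (x : R) :
  limit_g f m gamma x = 1 - x + abel_half (gamma `^ (- x)).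
Proof.
have g1 := maj_gamma hf; have gn := gammaX_gt0.
congr (_ + _); apply: cvg_lim => //.
have y0 : 0 < gamma `^ (- x) by rewrite powR_gt0 //; lra.
have h := abel_half_cvg y0.
apply: cvg_trans h; apply: near_eq_cvg.
have e4 : 0 < (4^-1 : R) by rewrite invr_gt0 ltr0n.
have [k Hk] := gamma_small y0 e4.
near=> a; rewrite /abel_half_seq; apply/esym.
have yE : gamma `^ (- a%:R - x) = gamma `^ (- x) / gamma ^+ a.
  rewrite addrC powRD; last by apply/implyP => _; rewrite gt_eqF //; lra.
  by rewrite powR_invn //; lra.
have zk : gamma `^ (- x) / gamma ^+ a <= 4^-1.
  apply: le_trans Hk.
  rewrite ler_pM2l // lef_pV2 ?posrE //; apply: ler_weXn2l; first lra.
  by near: a; exact: nbhs_infty_ge.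
have ya : 0 < gamma `^ (- x) / gamma ^+ a by rewrite divr_gt0.
rewrite yE; apply: cvg_lim => //.
rewrite (_ : (fun b => _) = (fun b =>
  (b%:R - log M `|ln (iter b f (2^-1 - gamma `^ (- x) / gamma ^+ a))|) - a%:R)).
  by apply: cvgB; [apply: abel_cvg; lra|exact: cvg_cst].
by apply/funext => b; rewrite addrAC.
Unshelve. all: by end_near. Qed.

End Abel.

(** * Binomial expectations and the transition operator *)

Section BinomialExpectation.
Variable R : realType.
Implicit Types (p : R) (phi psi : nat -> R).

(** The expectation of [psi] under Bin(n, p), computed by conditioning on one
    Bernoulli trial at a time: moments and comparison results become
    inductions on [n]. *)
Fixpoint binE p (n : nat) psi : R :=
  if n is n'.+1 then binE p n' (fun k => p * psi k.+1 + (1 - p) * psi k)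
  else psi 0%N.

Lemma binE_sum p n psi : binE p n psi =
  \sum_(k < n.+1) (p ^+ k * (1 - p) ^+ (n - k) *+ 'C(n, k)) * psi k.
Proof.
elim: n psi => [|n IH] psi /=.
  by rewrite big_ord1 !expr0 mulr1 bin0 mulr1n mul1r.
rewrite IH; apply/esym; rewrite big_ord_recl /= subn0 bin0 expr0 mul1r mulr1n.
under eq_bigr => i _ do rewrite /bump /= add1n subSS binS mulrnDr mulrDl.
rewrite big_split /=.
under [RHS]eq_bigr => i _ do rewrite mulrDr.
rewrite big_split /= addrA addrC; congr (_ + _).
  by apply: eq_bigr => i _; rewrite exprS -!mulrnAl -!mulrA; ring.
rewrite big_ord_recr /= bin_small // mulr0n mul0r addr0.
rewrite [RHS]big_ord_recl /= subn0 bin0 expr0 mul1r mulr1n exprSr -mulrA; congr (_ + _).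
apply: eq_bigr => i _; rewrite /bump /= add1n.
have -> : (1 - p) ^+ (n - i) = (1 - p) * (1 - p) ^+ (n - i.+1).
  by rewrite -exprS subnSK.
by rewrite -!mulrnAl; ring.
Qed.

Lemma binE_ext p n phi psi : (forall k, (k <= n)%N -> phi k = psi k) ->
  binE p n phi = binE p n psi.
Proof.
elim: n phi psi => [|n IH] phi psi H /=; first exact: H.
by apply: IH => k kn; rewrite !H // ltnW.
Qed.

Lemma binE_le p n phi psi : 0 <= p <= 1 ->
  (forall k, (k <= n)%N -> phi k <= psi k) -> binE p n phi <= binE p n psi.
Proof.
move=> hp; elim: n phi psi => [|n IH] phi psi H /=; first exact: H.
apply: IH => k kn; apply: lerD; apply: ler_wpM2l; try lra.
  exact: H.
by apply: H; exact: ltnW.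
Qed.

Lemma binE_cst p n (c : R) : binE p n (fun=> c) = c.
Proof.
elim: n => [//|n IH] /=; rewrite -[RHS]IH.
by apply: binE_ext => k _; ring.
Qed.

Lemma binE_lin p n (a b : R) phi psi :
  binE p n (fun k => a * phi k + b * psi k) = a * binE p n phi + b * binE p n psi.
Proof.
elim: n phi psi => [//|n IH] phi psi /=; rewrite -IH.
by apply: binE_ext => k _; ring.
Qed.

Lemma binE_sqr p n (c : R) :
  binE p n (fun k => (k%:R - c) ^+ 2) = (n%:R * p - c) ^+ 2 + n%:R * (p * (1 - p)).
Proof.
elim: n c => [|n IH] c /=; first by rewrite !mul0r addr0.
transitivity (binE p n (fun k => 1 * (k%:R - (c - p)) ^+ 2 + (p * (1 - p)) * 1)).
  by apply: binE_ext => k _; rewrite -natr1; ring.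
by rewrite binE_lin IH binE_cst -natr1; ring.
Qed.

Lemma binE_mean p n : binE p n (fun k => k%:R) = n%:R * p.
Proof.
elim: n => [|n IH] /=; first by rewrite mul0r.
transitivity (binE p n (fun k => 1 * k%:R + p * 1)).
  by apply: binE_ext => k _; rewrite -natr1; ring.
by rewrite binE_lin IH binE_cst -natr1; ring.
Qed.

Lemma binE_p0 n psi : binE 0 n psi = psi 0%N.
Proof.
elim: n psi => [//|n IH] psi /=; rewrite -IH.
by apply: binE_ext => k _; rewrite mul0r add0r subr0 mul1r.
Qed.

Lemma binE_compl p n psi : binE (1 - p) n psi = binE p n (fun k => psi (n - k)%N).
Proof.
elim: n psi => [//|n IH] psi /=; rewrite IH; apply: binE_ext => k kn.
by rewrite subSS subSn // opprB addrC subrKC addrC.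
Qed.

End BinomialExpectation.

Section MarkovOperator.
Variables (R : realType) (f : R -> R) (n : nat).

(** The transition operator of the fraction of vertices with opinion [X]. *)
Definition step (phi : R -> R) (x : R) : R :=
  binE (f x) n (fun k => phi (k%:R / n%:R)).

Definition unresolved (x : R) : R := if 0 < x < 1 then 1 else 0.

Hypothesis f01 : forall x, 0 <= x <= 1 -> 0 <= f x <= 1.

Lemma frac01 k : (k <= n)%N -> 0 <= (k%:R / n%:R : R) <= 1.
Proof.
move=> kn; rewrite divr_ge0 ?ler0n //=.
have [->|n0] := posnP n; first by rewrite invr0 mulr0 ler01.
by rewrite ler_pdivrMr ?ltr0n // mul1r ler_nat.
Qed.

Lemma step_le (phi psi : R -> R) (x : R) : 0 <= x <= 1 ->
  (forall y, 0 <= y <= 1 -> phi y <= psi y) -> step phi x <= step psi x.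
Proof. by move=> hx H; apply: binE_le; [exact: f01|move=> k /frac01; exact: H]. Qed.

Lemma iter_step_le j (phi psi : R -> R) (x : R) : 0 <= x <= 1 ->
  (forall y, 0 <= y <= 1 -> phi y <= psi y) ->
  iter j step phi x <= iter j step psi x.
Proof. by move=> hx H; elim: j x hx => [|j IH] x hx /=; [exact: H|exact: step_le]. Qed.

Lemma step_cst (c x : R) : step (fun=> c) x = c.
Proof. exact: binE_cst. Qed.

Lemma iter_step_cst j (c x : R) : iter j step (fun=> c) x = c.
Proof.
have E : step (fun=> c) = (fun=> c) by apply/funext => y; rewrite step_cst.
by elim: j => [//|j IH]; rewrite iterSr E.
Qed.

Lemma step_lin (a b : R) phi psi (x : R) :
  step (fun y => a * phi y + b * psi y) x = a * step phi x + b * step psi x.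
Proof. exact: binE_lin. Qed.

Lemma iter_step_lin j (a b : R) phi psi (x : R) :
  iter j step (fun y => a * phi y + b * psi y) x =
  a * iter j step phi x + b * iter j step psi x.
Proof.
elim: j phi psi => [//|j IH] phi psi; rewrite !iterSr -IH; congr (iter _ _ _ _).
by apply/funext => y; rewrite step_lin.
Qed.

Lemma step_sqr (c x : R) : (0 < n)%N ->
  step (fun y => (y - c) ^+ 2) x = (f x - c) ^+ 2 + f x * (1 - f x) / n%:R.
Proof.
move=> n0; have nR : 0 < n%:R :> R by rewrite ltr0n.
rewrite /step (@binE_ext _ _ _ _
  (fun k => n%:R ^- 2 * (k%:R - n%:R * c) ^+ 2 + 0 * 0)); last first.
  by move=> k _; field; rewrite gt_eqF.
by rewrite binE_lin binE_sqr; field; rewrite gt_eqF.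
Qed.

(** Chebyshev's inequality for one step of the chain, in the two forms used
    for lower and upper bounds. *)
Lemma step_ge_near (phi : R -> R) (x k L : R) : (0 < n)%N -> 0 <= x <= 1 ->
  0 < f x -> 0 < k -> L <= 1 -> (forall y, 0 <= y <= 1 -> 0 <= phi y) ->
  (forall y, 0 <= y <= 1 -> `|y - f x| <= k * f x -> L <= phi y) ->
  L - 1 / (k ^+ 2 * (n%:R * f x)) <= step phi x.
Proof.
move=> n0 hx fx k0 L1 phi0 H.
have nR : 0 < n%:R :> R by rewrite ltr0n.
have kf : 0 < (k * f x) ^+ 2 by rewrite exprn_gt0 // mulr_gt0.
have fx1 := f01 hx.
apply: (@le_trans _ _ (step (fun y => L * 1 + (- (k * f x) ^- 2) * (y - f x) ^+ 2) x)).
  rewrite step_lin step_cst step_sqr // subrr expr0n /= add0r mulr1 mulNr lerD2l lerN2.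
  have -> : 1 / (k ^+ 2 * (n%:R * f x)) = (k * f x) ^- 2 * (f x / n%:R).
    by field; rewrite !gt_eqF.
  rewrite ler_pM2l ?invr_gt0 // ler_pM2r ?invr_gt0 // ler_piMr ?(ltW fx) //; lra.
apply: step_le => // y hy; rewrite mulr1 mulNr.
have q0 : 0 <= (k * f x) ^- 2 * (y - f x) ^+ 2 by rewrite mulr_ge0 ?sqr_ge0 // invr_ge0 ltW.
have [yk|yk] := lerP `|y - f x| (k * f x); first by have := H y hy yk; lra.
apply: le_trans (phi0 y hy).
suff : 1 <= (k * f x) ^- 2 * (y - f x) ^+ 2 by lra.
rewrite mulrC ler_pdivlMr // mul1r -[leRHS](real_normK (num_real _)).
by rewrite lerXn2r // ?nnegrE ?ltW // mulr_gt0.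
Qed.

Lemma step_le_near (phi : R -> R) (x k L : R) : (0 < n)%N -> 0 <= x <= 1 ->
  0 < f x -> 0 < k -> 0 <= L -> (forall y, 0 <= y <= 1 -> phi y <= 1) ->
  (forall y, 0 <= y <= 1 -> `|y - f x| <= k * f x -> phi y <= L) ->
  step phi x <= L + 1 / (k ^+ 2 * (n%:R * f x)).
Proof.
move=> n0 hx fx k0 L0 phi1 H.
have := @step_ge_near (fun y => 1 * 1 + (-1) * phi y) x k (1 - L) n0 hx fx k0.
rewrite step_lin step_cst => h.
suff : 1 - L - 1 / (k ^+ 2 * (n%:R * f x)) <= 1 * 1 + -1 * step phi x by lra.
apply: h; first lra.
- by move=> y hy; have := phi1 y hy; lra.
- by move=> y hy yk; have := H y hy yk; lra.
Qed.

Lemma unresolved_ge0 x : 0 <= unresolved x.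
Proof. by rewrite /unresolved; case: ifP. Qed.

Lemma unresolved_le1 x : unresolved x <= 1.
Proof. by rewrite /unresolved; case: ifP. Qed.

Lemma iter_unresolved_ge0 j x : 0 <= x <= 1 -> 0 <= iter j step unresolved x.
Proof.
move=> hx; rewrite -(iter_step_cst j 0 x).
by apply: iter_step_le => // y _; exact: unresolved_ge0.
Qed.

Lemma iter_unresolved_le1 j x : 0 <= x <= 1 -> iter j step unresolved x <= 1.
Proof.
move=> hx; rewrite -[leRHS](iter_step_cst j 1 x).
by apply: iter_step_le => // y _; exact: unresolved_le1.
Qed.

Hypothesis f0 : f 0 = 0.
Hypothesis fsym : forall x, 0 <= x <= 1 -> f (1 - x) = 1 - f x.

Lemma step_compl (phi : R -> R) x : 0 <= x <= 1 -> (0 < n)%N ->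
  (forall y, 0 <= y <= 1 -> phi (1 - y) = phi y) ->
  step phi (1 - x) = step phi x.
Proof.
move=> hx n0 H; rewrite /step fsym // binE_compl; apply: binE_ext => k kn.
rewrite -H; last by apply: frac01; exact: leq_subr.
congr phi; rewrite natrB //; field.
by rewrite pnatr_eq0 -lt0n.
Qed.

Lemma unresolved_compl y : unresolved (1 - y) = unresolved y.
Proof. by rewrite /unresolved subr_gt0 gtrBl andbC. Qed.

Lemma iter_unresolved_compl j x : 0 <= x <= 1 -> (0 < n)%N ->
  iter j step unresolved (1 - x) = iter j step unresolved x.
Proof.
move=> hx n0; elim: j x hx => [|j IH] x hx; first exact: unresolved_compl.
by rewrite !iterS; exact: step_compl.
Qed.

(** Consensus is absorbing. *)
Lemma step_unresolved_le x : 0 <= x <= 1 -> (0 < n)%N ->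
  step unresolved x <= unresolved x.
Proof.
move=> hx n0.
have s0 : step unresolved 0 = 0.
  by rewrite /step f0 binE_p0 mul0r /unresolved ltxx.
have [x0|x0] := lerP x 0.
  have -> : x = 0 by lra.
  by rewrite s0 unresolved_ge0.
have [x1|x1] := lerP 1 x; last first.
  rewrite {2}/unresolved x0 x1.
  exact: (@iter_unresolved_le1 1).
have -> : x = 1 - 0 by lra.
rewrite step_compl // ?s0 ?unresolved_ge0 //; first lra.
by move=> y _; exact: unresolved_compl.
Qed.

Lemma iter_unresolved_noninc i j x : 0 <= x <= 1 -> (0 < n)%N -> (i <= j)%N ->
  iter j step unresolved x <= iter i step unresolved x.
Proof.
move=> hx n0 /subnK <-; rewrite addnC; elim: (j - i)%N => [|k IH]; first by rewrite addn0.
rewrite addnS iterSr; apply: le_trans _ IH.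
by apply: iter_step_le => // y hy; exact: step_unresolved_le.
Qed.

(** Markov's inequality: the next state is unresolved only if at least one vertex
    holds opinion [X]. *)
Lemma step_unresolved_mean x : 0 <= x <= 1 -> (0 < n)%N ->
  step unresolved x <= n%:R * f x.
Proof.
move=> hx n0; rewrite -binE_mean; apply: binE_le; first exact: f01.
move=> [|k] _; first by rewrite mul0r /unresolved ltxx.
by apply: le_trans (unresolved_le1 _) _; rewrite ler1n.
Qed.

End MarkovOperator.

Arguments unresolved {R} x.

(** * The chain away from 1/2 *)

Lemma linear_expR_small (R : realType) (c e : R) : 0 < c -> 0 < e ->
  exists T : R, forall t, T <= t -> (1 + t) * expR (- (c * t)) <= e.
Proof.
move=> c0 e0; exists (Num.max 1 (4 / (c ^+ 2 * e))) => t.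
rewrite ge_max => /andP[t1 te].
have ct : 0 <= c * t by rewrite mulr_ge0 //; lra.
have h := expR_ge1Dxn 1 ct.
rewrite expRN ler_pdivrMr ?expR_gt0 //.
have c2 : 0 < c ^+ 2 by rewrite exprn_gt0.
rewrite ler_pdivrMr ?mulr_gt0 // in te.
have h2 : e * (1 + (c * t) ^+ 2 / 2) <= e * expR (c * t) by rewrite ler_pM2l.
apply: le_trans h2.
have : 2 * t <= t * (t * (c ^+ 2 * e)) / 2 by nra.
rewrite exprMn; nra.
Qed.

Section Tracking.
Variables (R : realType) (f : R -> R) (m : nat) (beta gamma : R).
Hypothesis hf : majority_type f m beta gamma.

#[local] Opaque boettcher.

Local Notation M := (m%:R : R).
Local Notation B := (boettcher f m).
Local Notation A n := (step f n).
Local Notation f01 := (maj_f_range hf).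

(** As [B (f x) = m B x], this is the uniform continuity of [B] with respect to
    relative errors; [k] is also so small that [y] stays away from [1 / 2]. *)
Lemma boettcher_step (al tol : R) : 0 < al < 2^-1 -> 0 < tol ->
  exists2 k : R, 0 < k & forall x y, 0 < x <= 2^-1 - al ->
    `|y - f x| <= k * f x -> 0 < y <= 2^-1 - al /\ `|B y - M * B x| <= tol.
Proof.
move=> hal t0; have [k0 hk0 Hk] := boettcher_unif hf t0.
pose a := 2^-1 - al.
have fa0 : 0 < f a by apply: (maj_gt0 hf); rewrite /a; lra.
have faa : f a < a by apply: (maj_lt_id hf); rewrite /a; lra.
pose k := Num.min k0 (a / f a - 1).
have kk : 0 < k.
  rewrite lt_min; apply/andP; split; first lra.
  by rewrite subr_gt0 ltr_pdivlMr // mul1r.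
have kk0 : k <= k0 by rewrite /k ge_min lexx.
have kf : (1 + k) * f a <= a.
  by rewrite -ler_pdivlMr // -lerBrDl /k ge_min lexx orbT.
exists k => // x y hx; rewrite -/a => hy.
have hx2 : 0 < x < 2^-1 by lra.
have fx0 : 0 < f x by apply: (maj_gt0 hf); lra.
have fxa : f x <= f a by apply: (maj_mono hf); rewrite /a; lra.
have fx2 : 0 < f x < 2^-1 by rewrite /a in kf faa; lra.
move: hy; rewrite ler_norml => /andP[y1 y2].
have ya : y <= a by apply: le_trans kf; nra.
have y0 : 0 < y by nra.
have y22 : 0 < y < 2^-1 by rewrite /a in ya; lra.
split; first by rewrite y0.
rewrite -(boettcherM hf hx2).
have [yf|fy] := lerP y (f x).
  have b1 : B (f x) <= B y by apply: (boettcher_le hf); lra_from fx2 y22 yf.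
  have := Hk (f x) (1 - y / f x) fx2; rewrite subKr divfK ?gt_eqF // => h.
  rewrite ger0_norm ?subr_ge0 // lerBlDl; apply: h.
  rewrite subr_ge0 ler_pdivrMr // mul1r yf /= lerBlDl -lerBlDr ler_pdivlMr //.
  nra.
have b1 : B y <= B (f x) by apply: (boettcher_le hf); lra_from fx2 y22 fy.
have := Hk y (1 - f x / y) y22; rewrite subKr divfK ?gt_eqF // => h.
rewrite ler0_norm ?subr_le0 // opprB lerBlDl; apply: h.
rewrite subr_ge0 ler_pdivrMr // mul1r (ltW fy) /= lerBlDl -lerBlDr ler_pdivlMr //.
have : y <= f x * (1 + k0) by nra.
nra.
Qed.

Section FixedAccuracy.
Variables (al tol k C : R).
Hypothesis hal : 0 < al < 2^-1.
Hypothesis t0 : 0 < tol.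
Hypothesis k0 : 0 < k.
Hypothesis hk : forall x y, 0 < x <= 2^-1 - al ->
  `|y - f x| <= k * f x -> 0 < y <= 2^-1 - al /\ `|B y - M * B x| <= tol.
Hypothesis hC : forall x, 0 < x < 2^-1 -> `|- ln x - B x| <= C.

Lemma boettcher_lower_exp x : 0 < x < 2^-1 -> expR (- (C + B x)) <= x.
Proof.
move=> hx; have x0 : x \is Num.pos by rewrite posrE; lra.
rewrite -[leRHS](lnK x0) ler_expR.
by have := hC hx; rewrite ler_norml => /andP[_]; lra.
Qed.

Lemma boettcher_upper_exp x : 0 < x < 2^-1 -> x <= expR (C - B x).
Proof.
move=> hx; have x0 : x \is Num.pos by rewrite posrE; lra.
rewrite -[leLHS](lnK x0) ler_expR.
by have := hC hx; rewrite ler_norml => /andP[+ _]; lra.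
Qed.

(** While [m ^ j * B x] stays below [L], the fraction of vertices in the minority
    stays above [exp (- (C + L))], and Chebyshev's inequality bounds the
    probability that one of the [j] steps has a relative error above [k]. *)
Lemma chain_survives (n : nat) (L : R) (j : nat) (x : R) : (0 < n)%N -> 0 < x <= 2^-1 - al ->
  M ^+ j * (B x + tol) - tol <= L ->
  1 - j%:R * (expR (C + L) / (k ^+ 2 * n%:R)) <= iter j (A n) unresolved x.
Proof.
move: (hal) (t0) (k0) => hal' t0' k0'.
move=> n0; have nR : 0 < n%:R :> R by rewrite ltr0n.
have M2 := maj_M hf.
set q := expR (C + L) / (k ^+ 2 * n%:R).
have q0 : 0 < q by rewrite divr_gt0 ?expR_gt0 // mulr_gt0 // exprn_gt0.
elim: j x => [|j IH] x hx HL.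
  have x01 : 0 < x < 1 by lra.
  by rewrite mul0r subr0 /= /unresolved x01.
have hx2 : 0 < x < 2^-1 by lra.
have fx2 := iter_maj_range hf 1 hx2; rewrite /= in fx2.
have Bx := boettcher_gt0 hf hx2.
have Mj : 1 <= M ^+ j by rewrite exprn_ege1 //; lra.
have BfL : B (f x) <= L.
  rewrite (boettcherM hf hx2); apply: le_trans HL; rewrite exprS.
  have : M * B x <= M ^+ j * (M * B x) by rewrite ler_peMl // mulr_ge0 ?ltW //; lra.
  have : tol <= M * M ^+ j * tol by rewrite ler_peMl ?(ltW t0) //; nra.
  lra.
have fxL : expR (- (C + L)) <= f x.
  by apply: le_trans (boettcher_lower_exp fx2); rewrite ler_expR; lra.
rewrite iterS.
have step1 : 1 - j%:R * q - 1 / (k ^+ 2 * (n%:R * f x)) <= step f n (iter j (A n) unresolved) x.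
  apply: step_ge_near => //; [exact: f01|lra_from hx HL hx2 fx2 fxL|lra_from hx HL hx2 fx2 fxL| | |].
  - by rewrite gerBl mulr_ge0 // ltW.
  - by move=> y hy; apply: iter_unresolved_ge0 => //; exact: f01.
  move=> y hy yk; have [ya yB] := hk hx yk.
  apply: IH => //; apply: le_trans HL.
  rewrite lerD2r exprSr -mulrA ler_pM2l; last lra.
  by move: yB; rewrite ler_norml => /andP[_]; nra.
apply: le_trans step1; rewrite -natr1 mulrDl mul1r opprD addrA lerD2l lerN2.
have fx0 : 0 < f x by lra.
have k2 : 0 < k ^+ 2 by rewrite exprn_gt0.
rewrite ler_pdivrMr ?mulr_gt0 //.
have -> : q * (k ^+ 2 * (n%:R * f x)) = expR (C + L) * f x.
  by rewrite /q; field; rewrite !gt_eqF.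
by rewrite -ler_pdivrMl ?expR_gt0 // mulr1 -expRN.
Qed.

(** When [m ^ j * B x] exceeds [L], the minority has less than [n exp (C - L)]
    vertices on average. As long as the mean [n f x] is at least [th] the steps
    are accurate; when it first drops below [th], two more steps suffice because
    [f y <= D y ^ 2]. *)
Lemma chain_dies (n : nat) (L th D : R) (j : nat) (x : R) : (0 < n)%N -> 0 < th -> 0 < D ->
  (forall y, 0 <= y <= 1 -> f y <= D * y ^+ 2) ->
  0 < x <= 2^-1 - al -> L <= M ^+ j.+1 * (B x - tol) + tol ->
  iter j.+1 (A n) unresolved x <= n%:R * expR (C - L) + j%:R * (1 / (k ^+ 2 * th))
    + D * (th ^+ 2 / n%:R + th / n%:R).
Proof.
move: (hal) (t0) (k0) => hal' t0' k0'.
move=> n0 th0 D0 HD; have nR : 0 < n%:R :> R by rewrite ltr0n.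
have M2 := maj_M hf.
have e0 : 0 <= n%:R * expR (C - L) by rewrite mulr_ge0 ?expR_ge0 // ltW.
have q0 : 0 < 1 / (k ^+ 2 * th) by rewrite divr_gt0 // mulr_gt0 // exprn_gt0.
have d0 : 0 <= D * (th ^+ 2 / n%:R + th / n%:R).
  by rewrite mulr_ge0 ?(ltW D0) // addr_ge0 // divr_ge0 ?sqr_ge0 // ltW.
elim: j x => [|j IH] x hx HL.
  have hx2 : 0 < x < 2^-1 by lra.
  have fx2 := iter_maj_range hf 1 hx2; rewrite /= in fx2.
  rewrite mul0r addr0 iterS /=.
  apply: le_trans (step_unresolved_mean f01 _ n0) _; first lra.
  suff : n%:R * f x <= n%:R * expR (C - L) by lra.
  rewrite ler_pM2l //; apply: le_trans (boettcher_upper_exp fx2) _.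
  have Mt : tol <= M * tol by rewrite ler_peMl ?(ltW t0) //; lra.
  rewrite expr1 mulrBr in HL; rewrite ler_expR (boettcherM hf hx2) lerD2l lerN2.
  by move: HL Mt; clear e0 q0 d0; lra.
have hx2 : 0 < x < 2^-1 by lra.
have fx2 := iter_maj_range hf 1 hx2; rewrite /= in fx2.
have x01 : 0 <= x <= 1 by lra.
have [big|small] := lerP th (n%:R * f x).
  rewrite iterS; set E := n%:R * expR (C - L) in IH e0 *.
  set Q := 1 / (k ^+ 2 * th) in IH q0 *; set S := D * _ in IH d0 *.
  have jQ : 0 <= j%:R * Q by rewrite mulr_ge0 // ltW.
  apply: (@le_trans _ _ ((E + j%:R * Q + S) + 1 / (k ^+ 2 * (n%:R * f x)))).
    apply: step_le_near => //; [exact: f01|lra_from fx2 e0 d0 jQ|lra_from fx2 e0 d0 jQ| |].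
    - by move=> y hy; apply: iter_unresolved_le1 => //; exact: f01.
    move=> y hy yk; have [ya yB] := hk hx yk.
    apply: IH => //; apply: le_trans HL _.
    rewrite lerD2r exprSr -mulrA ler_pM2l; last by rewrite exprn_gt0 //; lra.
    by move: yB; rewrite ler_norml => /andP[+ _]; nra.
  have : 1 / (k ^+ 2 * (n%:R * f x)) <= Q.
    have k2 : 0 < k ^+ 2 by rewrite exprn_gt0.
    by rewrite /Q !div1r lef_pV2 ?posrE ?mulr_gt0 ?ler_pM2l //; lra_from M2 hx HL hx2 fx2 x01.
  by rewrite -natr1 mulrDl; lra.
have s2 : iter j.+2 (A n) unresolved x <= D * (th ^+ 2 / n%:R + th / n%:R).
  apply: le_trans (@iter_unresolved_noninc _ _ _ f01 (maj0 hf) (maj_symE hf) 2 j.+2 x x01 n0 _) _ => //=.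
  apply: (@le_trans _ _ (step f n (fun y => n%:R * D * (y - 0) ^+ 2 + 0 * 0) x)).
    apply: step_le => // [|y hy]; [exact: f01|].
    rewrite mulr0 addr0 subr0 -mulrA.
    apply: le_trans (step_unresolved_mean f01 hy n0) _.
    by rewrite ler_pM2l //; exact: HD.
  rewrite step_lin step_sqr // mul0r addr0 subr0.
  have -> : n%:R * D * (f x ^+ 2 + f x * (1 - f x) / n%:R) =
    D * ((n%:R * f x) ^+ 2 / n%:R + (n%:R * f x) * (1 - f x) / n%:R).
    by field; rewrite gt_eqF.
  have nf0 : 0 <= n%:R * f x by rewrite mulr_ge0 ?ltW //; lra.
  rewrite ler_pM2l //; apply: lerD; rewrite ler_pM2r ?invr_gt0 //.
    by rewrite lerXn2r // ?nnegrE ltW.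
  by nra.
have jq : 0 <= j.+1%:R * (1 / (k ^+ 2 * th)) by rewrite mulr_ge0 // ltW.
lra.
Qed.

End FixedAccuracy.

(** The additive conditions on [abel] that occur in the theorem are
    multiplicative conditions on [boettcher], with [tol] turned into the factor
    [m ^ tol]. *)
Lemma abel_le_log (x s t : R) (k : nat) : 0 < x < 2^-1 -> 0 < t ->
  (k%:R + s <= abel f m x + log M t) = (M ^+ k * expR (s * ln M) * B x <= t) /\
  (abel f m x + log M t + s <= k%:R) = (t * expR (s * ln M) <= M ^+ k * B x).
Proof.
move=> hx tp; have lM := maj_lnM hf; have M2 := maj_M hf.
have Bx := boettcher_gt0 hf hx.
have Mk : 0 < M ^+ k by rewrite exprn_gt0 //; lra.
have lk : ln (M ^+ k) = k%:R * ln M by rewrite lnXn ?mulr_natl //; lra.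
have e0 := expR_gt0 (s * ln M).
have -> : abel f m x + log M t = (ln t - ln (B x)) / ln M.
  by rewrite /abel /log mulrBl addrC.
split.
  rewrite -[RHS]ler_ln ?posrE ?mulr_gt0 // !lnM ?posrE ?mulr_gt0 //.
  rewrite lk expRK ler_pdivlMr // mulrDl; apply/idP/idP; lra.
rewrite -[RHS]ler_ln ?posrE ?mulr_gt0 // !lnM ?posrE ?mulr_gt0 //.
rewrite lk expRK -lerBrDr ler_pdivrMr // mulrBl; apply/idP/idP; lra.
Qed.

#[local] Opaque abel.

(** From a macroscopic distance to [1 / 2] on, the time to consensus is
    [abel x + log_m (ln n)] rounded up, unless this number is within [tol] of an
    integer. The two bounds above are used with [L = (ln n) / s] and
    [L = s * ln n] for some [s > 1] and with [th = n ^ (1 / 4)]; all errors are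
    then at most of order [(1 + ln n) n ^ (- c)] with [c > 0]. *)
Theorem chain_tracking (al tol eta : R) : 0 < al < 2^-1 -> 0 < tol -> 0 < eta ->
  exists N : nat, forall (n k : nat) (x : R), (N <= n)%N -> al <= x <= 2^-1 - al ->
    (k%:R + tol <= abel f m x + log M (ln n%:R) ->
       1 - eta <= iter k (A n) unresolved x) /\
    (abel f m x + log M (ln n%:R) + tol <= k%:R ->
       iter k (A n) unresolved x <= eta).
Proof.
move=> hal t0 eta0.
have lM := maj_lnM hf; have M2 := maj_M hf.
have [tau tauE] : exists tau, tau = expR (tol * ln M) by eexists.
have tau1 : 1 < tau by rewrite tauE expR_gt1 mulr_gt0.
(* [tau = rho^-1 * s]: the factor [rho] covers the error [tl] that the steps
   accumulate, the factor [s] separates [L] from [ln n] *)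
pose s := (1 + tau) / 2; pose rho := s / tau.
have s1 : 1 < s by rewrite /s; lra.
have stau : s < tau by rewrite /s; lra.
have rho0 : 0 < rho by rewrite divr_gt0 //; lra.
have rhos : rho * tau = s by rewrite /rho divfK // gt_eqF //; lra.
have rhoE : tau * s^-1 = rho^-1 by rewrite /rho [RHS]invfM invrK mulrC.
have rho1 : rho < 1 by rewrite /rho ltr_pdivrMr //; lra.
clearbody rho; clearbody s.
have si0 : 0 < s^-1 by rewrite invr_gt0; lra.
have si1 : s^-1 < 1 by rewrite invf_lt1 //; lra.
have ssi : s * s^-1 = 1 by rewrite divff // gt_eqF //; lra.
pose c := Num.min (1 - s^-1) 4^-1.
have c0 : 0 < c by rewrite lt_min invr_gt0 ltr0n andbT; lra.
have c1 : c <= 1 - s^-1 by rewrite /c ge_min lexx.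
have c4 : c <= 4^-1 by rewrite /c ge_min lexx orbT.
have cs : c <= s - 1 by nra.
clearbody c.
have [Bm BmE] : exists Bm, Bm = B (2^-1 - al) by eexists.
have Bm0 : 0 < Bm by rewrite BmE; apply: (boettcher_gt0 hf); lra.
have [tl tlE] : exists tl, tl = Bm * (1 - rho) by eexists.
have tl0 : 0 < tl by rewrite tlE mulr_gt0 //; lra.
have [k k0 hk] := boettcher_step hal tl0.
have [C hC] := boettcher_near_ln hf.
have [D D0 HD] := maj_sq_bound hf.
have k2 : 0 < k ^+ 2 by rewrite exprn_gt0.
have eC := expR_gt0 C.
have [K1 K1E] : exists K1, K1 = expR C / (Bm * k ^+ 2) by eexists.
have K10 : 0 < K1 by rewrite K1E divr_gt0 // mulr_gt0.
have [K2 K2E] : exists K2, K2 = expR C + (tau / Bm + 1) / k ^+ 2 + 2 * D by eexists.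
have tB : 0 < tau / Bm by rewrite divr_gt0 //; lra.
have tBk : 0 < (tau / Bm + 1) / k ^+ 2 by rewrite divr_gt0 //; lra.
have K20 : 0 < K2 by rewrite K2E; lra.
have [T HT] := linear_expR_small c0 (divr_gt0 eta0 (addr_gt0 K10 K20)).
pose T' := Num.max (Num.max T 1) (B al).
exists (Num.truncn (expR T')).+1 => n j x Nn hx.
have nT : expR T' < n%:R.
  by apply: lt_le_trans (truncnS_gt _) _; rewrite ler_nat.
have nR : 0 < n%:R :> R by apply: lt_trans nT; exact: expR_gt0.
have n0 : (0 < n)%N by rewrite -(ltr_nat R).
set t := ln n%:R.
have ne : n%:R = expR t by rewrite /t lnK.
have tT : T' < t by rewrite -ltr_expR -ne.
have tT1 : T <= t by apply: le_trans (ltW tT); rewrite /T' !le_max lexx.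
have t1 : 1 <= t by apply: le_trans (ltW tT); rewrite /T' !le_max lexx orbT.
have tB' : B al < t by apply: le_lt_trans tT; rewrite /T' !le_max lexx orbT.
have {}HT := HT t tT1.
rewrite ler_pdivlMr ?addr_gt0 // in HT.
clear Nn nT tT tT1; clearbody t; clear T' T.
have [u uE] : exists u, u = (1 + t) * expR (- (c * t)) by eexists.
rewrite -uE in HT.
have u0 : 0 < u by rewrite uE mulr_gt0 ?expR_gt0 //; lra_from ne t1.
have ub y a : 0 <= y <= 1 + t -> c <= a -> y * expR (- (a * t)) <= u.
  move=> hy ca; rewrite uE; apply: ler_pM; rewrite ?expR_ge0 //; [by case/andP: hy|by case/andP: hy|].
  by rewrite ler_expR lerN2 ler_pM2r //; lra_from ne t1.
have K1u : K1 * u <= eta.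
  by apply: le_trans HT; rewrite mulrC ler_pM2l // lerDl ltW.
have K2u : K2 * u <= eta.
  by apply: le_trans HT; rewrite mulrC ler_pM2l // lerDr ltW.
clear HT uE.
have hx2 : 0 < x < 2^-1 by lra_from hal hx.
have hxa : 0 < x <= 2^-1 - al by lra_from hx hx2.
have t00 : 0 < t by lra_from ne t1.
have Bx : Bm <= B x by rewrite BmE; apply: (boettcher_le hf); lra_from hal hxa.
have Bxa : B x <= B al by apply: (boettcher_le hf); lra_from hal hx.
clear BmE.
have Mj : 0 < M ^+ j by rewrite exprn_gt0 //; lra_from eta0 M2.
have jM i : i%:R <= M ^+ i.
  by rewrite -natrX ler_nat ltnW // ltn_expl //; exact: maj_m hf.
have [-> ->] := abel_le_log tol j hx2 t00; rewrite -tauE {tauE}.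
split => h.
  have h1 : M ^+ j * (B x + tl) - tl <= t * s^-1.
    suff : M ^+ j * (B x + tl) <= t * s^-1 by lra_from tl0.
    have h2 : B x + tl <= B x * rho^-1.
      have h3 : 2 - rho <= rho^-1.
        have : 0 <= (1 - rho) ^+ 2 by exact: sqr_ge0.
        by rewrite -[rho^-1]mul1r ler_pdivlMr // expr2; lra_from h.
      apply: (@le_trans _ _ (B x * (2 - rho))); first by rewrite tlE; nra_from Bm0 tlE tl0 Bx.
      by rewrite ler_pM2l //; lra_from Bm0 Bx.
    apply: (@le_trans _ _ (M ^+ j * (B x * rho^-1))); first by rewrite ler_pM2l.
    by rewrite -rhoE !mulrA ler_pM2r // -mulrA [B x * tau]mulrC mulrA.
  apply: le_trans (chain_survives hal tl0 k0 hk hC n0 hxa h1).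
  rewrite lerD2l lerN2.
  have jB : j%:R * Bm <= t.
    apply: le_trans h; apply: ler_pM => //; [exact: ltW|].
    by apply: le_trans (jM j) _; rewrite ler_peMr ?(ltW Mj) // ltW.
  apply: le_trans K1u.
  have -> : j%:R * (expR (C + t * s^-1) / (k ^+ 2 * n%:R)) =
     K1 * (j%:R * Bm * expR (- ((1 - s^-1) * t))).
    rewrite K1E ne expRD mulrBl mul1r opprB [s^-1 * t]mulrC expRB.
    by field; rewrite ?gt_eqF ?expR_gt0.
  rewrite ler_pM2l //; apply: ub => //; rewrite mulr_ge0 ?ler0n ?(ltW Bm0) //; lra_from jB.
(* cap the number of steps: after [K] steps the chain has already died *)
pose K := (Num.truncn (tau / Bm * t)).+1.
have tBt : 0 <= tau / Bm * t by rewrite mulr_ge0 // ltW.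
have KK : tau / Bm * t <= K%:R by apply/ltW/truncnS_gt.
have K1' : K%:R <= tau / Bm * t + 1.
  by rewrite /K -natr1 lerD2r truncn_le.
have hK : t * tau <= M ^+ K * B x.
  apply: (@le_trans _ _ (K%:R * Bm)).
    by rewrite -ler_pdivrMr // mulrC mulrA mulrAC [_ * tau]mulrC -mulrA [Bm^-1 * t]mulrC mulrA mulrAC.
  by apply: ler_pM => //; rewrite ?ler0n ?(ltW Bm0).
pose i := minn j K.
have hi : t * tau <= M ^+ i * B x by rewrite /i /minn; case: ifP.
have iK : i%:R <= K%:R :> R by rewrite ler_nat /i geq_minr.
have i0 : (0 < i)%N.
  rewrite lt0n; apply/eqP => i0; move: hi; rewrite i0 expr0 mul1r leNgt => /negP; apply.
  by apply: le_lt_trans Bxa (lt_trans tB' _); rewrite ltr_pMr.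
have x01 : 0 <= x <= 1 by lra_from hx2 hxa.
apply: le_trans (@iter_unresolved_noninc _ _ _ f01 (maj0 hf) (maj_symE hf) i j x x01 n0 (geq_minl _ _)) _.
have iS : i.-1.+1 = i by rewrite prednK.
have h1 : t * s <= M ^+ i.-1.+1 * (B x - tl) + tl.
  rewrite iS; suff : t * s <= M ^+ i * (B x - tl) by lra_from tl0.
  have h2 : B x * rho <= B x - tl by rewrite tlE; nra_from Bm0 tlE tl0 Bx.
  apply: (@le_trans _ _ (M ^+ i * (B x * rho))).
    by rewrite -rhos mulrCA mulrC [leRHS]mulrA ler_pM2r // mulrC.
  by rewrite ler_pM2l // exprn_gt0 //; lra_from M2 si1.
have th0 : 0 < expR (t / 4) := expR_gt0 _.
have := chain_dies hal tl0 k0 hk hC n0 th0 D0 HD hxa h1.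
rewrite iS => /le_trans; apply; apply: le_trans K2u.
have b1 : n%:R * expR (C - t * s) <= expR C * u.
  have -> : n%:R * expR (C - t * s) = expR C * (1 * expR (- ((s - 1) * t))).
    by rewrite ne mul1r -!expRD; congr expR; ring.
  by rewrite ler_pM2l //; apply: ub => //; lra_from hxa t00.
have b2 : i.-1%:R * (1 / (k ^+ 2 * expR (t / 4))) <= (tau / Bm + 1) / k ^+ 2 * u.
  have i1 : i.-1%:R <= (tau / Bm + 1) * (1 + t).
    apply: (@le_trans _ _ K%:R); first by rewrite ler_nat; apply: leq_trans (leq_pred _) _; rewrite geq_minr.
    apply: le_trans K1' _.
    by lra_from hf tB t00.
  have -> : (tau / Bm + 1) / k ^+ 2 * u = (tau / Bm + 1) * u / k ^+ 2 by ring.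
  have -> : i.-1%:R * (1 / (k ^+ 2 * expR (t / 4))) = i.-1%:R * expR (- (4^-1 * t)) / k ^+ 2.
    by rewrite expRN [4^-1 * t]mulrC; field; rewrite ?gt_eqF ?expR_gt0.
  rewrite ler_pM2r ?invr_gt0 //.
  apply: le_trans (ler_wpM2r (expR_ge0 _) i1) _.
  rewrite -mulrA ler_pM2l; last lra_from tB tBk.
  by apply: ub => //; lra_from hxa t00.
have b3 : expR (t / 4) ^+ 2 / n%:R + expR (t / 4) / n%:R <= 2 * u.
  have -> : expR (t / 4) ^+ 2 / n%:R = 1 * expR (- (2^-1 * t)).
    by rewrite ne expr2 -expRD -expRB mul1r; congr expR; lra_from b2.
  have -> : expR (t / 4) / n%:R = 1 * expR (- (3 / 4 * t)).
    by rewrite ne -expRB mul1r; congr expR; lra_from b2.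
  have h01 : 0 <= (1 : R) <= 1 + t by rewrite ler01 lerDl ltW.
  have u1 := ub 1 2^-1 h01 ltac:(lra_from hf c4).
  have u2 := ub 1 (3 / 4) h01 ltac:(lra_from hf c4).
  by lra_from hf u1 u2.
have : D * (expR (t / 4) ^+ 2 / n%:R + expR (t / 4) / n%:R) <= D * (2 * u).
  by rewrite ler_pM2l.
rewrite K2E; lra.
Qed.

End Tracking.

(** * Gaussian distribution functions *)

(** One step of Taylor's estimate: a bound on the derivative gives a bound of one
    order more on the function. *)
Lemma mvt_bound (R : realType) (g dg : R -> R) (C k : R) (j : nat) :
  (forall s : R, is_derive s 1 g (dg s)) -> g 0 = 0 ->
  (forall s, `|dg s| <= C * `|s| ^+ j) -> `|g k| <= C * `|k| ^+ j.+1.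
Proof.
move=> dgs g0 H.
have C0 : 0 <= C.
  have := H 1; rewrite normr1 expr1n mulr1; apply: le_trans; exact: normr_ge0.
have cont : continuous g.
  move=> x; apply: differentiable_continuous; apply/derivable1_diffP.
  by case: (dgs x).
have key (c : R) : `|c| <= `|k| -> `|dg c * k| <= C * `|k| ^+ j.+1.
  move=> ck; rewrite normrM exprSr mulrA ler_wpM2r //.
  apply: le_trans (H c) _; rewrite ler_wpM2l // lerXn2r // ?nnegrE //.
have [k0|k0|<-] := ltrgtP 0 k; last first.
- by rewrite g0 !normr0 expr0n mulr0.
- have [c] := @MVT _ g dg k 0 k0 (fun x _ => dgs x) (continuous_subspaceT cont).
  rewrite in_itv /= => /andP[c1 c2]; rewrite g0 !sub0r mulrN => /oppr_inj ->.
  by apply: key; rewrite !ltr0_norm ?lerN2 ?ltW.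
have [c] := @MVT _ g dg 0 k k0 (fun x _ => dgs x) (continuous_subspaceT cont).
rewrite in_itv /= => /andP[c1 c2]; rewrite g0 !subr0 => ->.
by apply: key; rewrite !gtr0_norm ?ltW.
Qed.

Section StandardNormal.
Variables (R : realType) (d sigma : R).
Hypothesis sigma0 : 0 < sigma.

(** The standard normal distribution function, obtained by normalising that of
    the Gaussian law with mean [d] and standard deviation [sigma]. *)
Definition gauss_cdf (y : R) : R := fine (normal_prob d sigma `]-oo, (d + sigma * y)]).

Definition gauss_pdf (y : R) : R := sigma * normal_peak sigma * expR (- (y ^+ 2) / 2).

Local Notation Phi := gauss_cdf.
Local Notation phi := gauss_pdf.

Lemma normal_prob_fin_num (A : set R) : measurable A -> normal_prob d sigma A \is a fin_num.
Proof. by move=> mA; apply: fin_num_measure. Qed.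

Lemma Phi_ge0 y : 0 <= Phi y.
Proof. by rewrite fine_ge0. Qed.

Lemma Phi_le1 y : Phi y <= 1.
Proof.
rewrite -lee_fin fineK ?normal_prob_fin_num //.
exact: (@probability_le1 _ _ _ (normal_prob d sigma)).
Qed.

Lemma Phi_le x y : x <= y -> Phi x <= Phi y.
Proof.
move=> xy; rewrite -lee_fin !fineK ?normal_prob_fin_num //.
apply: le_measure; rewrite ?inE //.
by apply: subitvPr; rewrite bnd_simp lerD2l ler_pM2l.
Qed.

Lemma phi_gt0 y : 0 < phi y.
Proof. by rewrite !mulr_gt0 ?expR_gt0 // normal_peak_gt0 // gt_eqF. Qed.

Lemma is_derive_affine (a b y : R) : is_derive y 1 (fun y => a + b * y) b.
Proof.
have h := is_deriveD (is_derive_cst a y 1) (is_deriveZ b (is_derive_id y (1 : R))).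
apply: (is_derive_eq h); first by rewrite add0r /GRing.scale /= mulr1.
Qed.

Lemma is_derive_scaled (g : R -> R) (a b s z : R) : is_derive (z + b * s) 1 g a ->
  is_derive s 1 (fun s => g (z + b * s)) (a * b).
Proof. by move=> h; exact: (@is_derive1_comp _ g (fun s => z + b * s) s a b h (is_derive_affine z b s)). Qed.

Lemma is_derive_shift (g : R -> R) (a s z : R) : is_derive (z + s) 1 g a ->
  is_derive s 1 (fun s => g (z + s)) a.
Proof.
move=> h; have := @is_derive_scaled g a 1 s z; rewrite mul1r mulr1 => /(_ h).
by under eq_fun do rewrite mul1r.
Qed.

Lemma is_derive_Phi (y : R) : is_derive y 1 Phi (phi y).
Proof.
have s0 : sigma != 0 by rewrite gt_eqF.
pose F (y : R) : R := fine (normal_prob d sigma `]-oo, y]).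
have dF (z : R) : is_derive z 1 F (normal_pdf d sigma z).
  have := @continuous_FTC1 R (normal_pdf d sigma) -oo%O z (z + 1).
  rewrite ltrDl => /(_ ltr01).
  have int : lebesgue_measure.-integrable `]-oo, (z + 1)%R] (EFin \o normal_pdf d sigma).
    by apply: (integrableS measurableT) => //; exact: integrable_normal_pdf.
  move=> /(_ int (ltNyr _) (@continuous_normal_pdf _ d _ s0 z)) [h1 h2].
  by apply: DeriveDef; [exact: h1|rewrite -derive1E; exact: h2].
have -> : Phi = F \o (fun y => d + sigma * y) by [].
have -> : phi y = normal_pdf d sigma (d + sigma * y) * sigma.
  rewrite /phi normal_pdfE // /normal_fun.
  have -> : - (d + sigma * y - d) ^+ 2 / (sigma ^+ 2 *+ 2) = - y ^+ 2 / 2.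
    by rewrite -mulr_natr; field.
  by ring.
exact: (is_derive1_comp (dF _) (is_derive_affine _ _ _)).
Qed.

Lemma is_derive_phi (y : R) : is_derive y 1 phi (- (y * phi y)).
Proof.
have h : is_derive y 1 (fun y : R => - (y ^+ 2) / 2) (- y).
  have h1 := is_deriveZ (- 2^-1) (is_deriveX 2 (is_derive_id y (1 : R))).
  have -> : (fun y : R => - (y ^+ 2) / 2) = - 2^-1 *: (@id R ^+ 2).
    by apply/funext => z; transitivity (- 2^-1 * (z * z)); [ring|].
  by apply: (is_derive_eq h1); rewrite /GRing.scale /= expr1 mulr1; lra.
have h2 := @is_derive1_comp _ expR (fun y : R => - (y ^+ 2) / 2) y _ _ (is_derive_expR _) h.
apply: (is_derive_eq (is_deriveZ (sigma * normal_peak sigma) h2)).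
by rewrite /phi /GRing.scale /=; ring.
Qed.

(** [exp (z ^ 2 / 2) >= 1 + z ^ 4 / 8], so all the polynomials of degree at most
    [4] that occur below are bounded when multiplied by [phi]. *)
Lemma phi_decay : exists2 K : R, 1 <= K & forall z, (1 + z ^+ 4) * phi z <= K.
Proof.
pose c := sigma * normal_peak sigma.
have c0 : 0 < c by rewrite mulr_gt0 // normal_peak_gt0 // gt_eqF.
exists (1 + 8 * c) => [|z]; first lra.
have z2 : 0 <= z ^+ 2 / 2 by rewrite divr_ge0 ?sqr_ge0.
have h := expR_ge1Dxn 1 z2.
suff : (1 + z ^+ 4) * expR (- (z ^+ 2) / 2) <= 8.
  move=> h2; have -> : (1 + z ^+ 4) * phi z = c * ((1 + z ^+ 4) * expR (- (z ^+ 2) / 2)).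
    by rewrite /phi -/c; ring.
  have : c * ((1 + z ^+ 4) * expR (- (z ^+ 2) / 2)) <= c * 8 by rewrite ler_pM2l.
  lra.
rewrite mulNr expRN ler_pdivrMr ?expR_gt0 //.
have z4 : 0 <= z ^+ 4 by rewrite exprn_even_ge0.
have : (z ^+ 2 / 2) ^+ 2 = z ^+ 4 / 4 by field.
move: h; rewrite (_ : 2`!%:R = 2 :> R) // => + E; rewrite E; lra.
Qed.

Lemma Phi_taylor3 : exists2 K : R, 0 < K & forall z k,
  `|Phi (z + k) - Phi z - k * phi z + k ^+ 2 / 2 * (z * phi z)| <= K * `|k| ^+ 3.
Proof.
have [K K1 HK] := phi_decay; exists K => [|z k]; first lra.
have d2 (s : R) : is_derive s 1 (fun s => z * phi z - (z + s) * phi (z + s))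
    (((z + s) ^+ 2 - 1) * phi (z + s)).
  have h1 := is_derive_shift (is_derive_phi (z + s)).
  have h2 := is_derive_shift (g := id) (is_derive_id (z + s) (1 : R)).
  apply: (is_derive_eq (is_deriveB (is_derive_cst (z * phi z) s 1) (is_deriveM h2 h1))).
  by rewrite /GRing.scale /=; ring.
have d1 (s : R) : is_derive s 1 (fun s => phi (z + s) - phi z + s * (z * phi z))
    (z * phi z - (z + s) * phi (z + s)).
  have h1 := is_derive_shift (is_derive_phi (z + s)).
  have h2 := is_deriveM (is_derive_id s (1 : R)) (is_derive_cst (z * phi z) s 1).
  apply: (is_derive_eq (is_deriveD (is_deriveB h1 (is_derive_cst (phi z) s 1)) h2)).
  by rewrite /GRing.scale /=; ring.
have d0 (s : R) : is_derive s 1 (fun s => Phi (z + s) - Phi z - s * phi z + z * phi z / 2 * s ^+ 2)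
    (phi (z + s) - phi z + s * (z * phi z)).
  have h1 := is_derive_shift (is_derive_Phi (z + s)).
  have h2 := is_deriveM (is_derive_id s (1 : R)) (is_derive_cst (phi z) s 1).
  have h3 := is_deriveZ (z * phi z / 2) (is_deriveX 2 (is_derive_id s (1 : R))).
  apply: (is_derive_eq (is_deriveD (is_deriveB (is_deriveB h1 (is_derive_cst (Phi z) s 1)) h2) h3)).
  by rewrite /GRing.scale /=; field.
have b2 (s : R) : `|((z + s) ^+ 2 - 1) * phi (z + s)| <= K * `|s| ^+ 0.
  rewrite expr0 mulr1; apply: le_trans (HK (z + s)); have p0 := phi_gt0 (z + s).
  rewrite normrM (gtr0_norm p0) ler_pM2r // ler_norml.
  have -> : (z + s) ^+ 4 = ((z + s) ^+ 2) ^+ 2 by rewrite -exprM.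
  have := sqr_ge0 ((z + s) ^+ 2); have := sqr_ge0 (z + s).
  have := sqr_ge0 ((z + s) ^+ 2 - 1); set a := (z + s) ^+ 2.
  by rewrite !expr2; nra.
have b1 (s : R) : `|z * phi z - (z + s) * phi (z + s)| <= K * `|s| ^+ 1.
  by apply: (@mvt_bound _ _ _ K s 0 d2 _ b2); rewrite addr0 subrr.
have b0 (s : R) : `|phi (z + s) - phi z + s * (z * phi z)| <= K * `|s| ^+ 2.
  by apply: (@mvt_bound _ _ _ K s 1 d1 _ b1); rewrite addr0 subrr mul0r addr0.
have -> : k ^+ 2 / 2 * (z * phi z) = z * phi z / 2 * k ^+ 2 by ring.
by apply: (@mvt_bound _ _ _ K k 2 d0 _ b0); rewrite addr0 subrr mul0r expr0n /= !mulr0 subr0 addr0.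
Qed.

Lemma Phi_lip : exists2 K : R, 0 < K & forall x y, `|Phi y - Phi x| <= K * `|y - x|.
Proof.
have [K K1 HK] := phi_decay; exists K => [|x y]; first lra.
have d0 (s : R) : is_derive s 1 (fun s => Phi (x + s) - Phi x) (phi (x + s)).
  have h1 := is_derive_shift (is_derive_Phi (x + s)).
  apply: (is_derive_eq (is_deriveB h1 (is_derive_cst (Phi x) s 1))).
  by rewrite /GRing.scale /=; ring.
have := @mvt_bound _ _ _ K (y - x) 0 d0; rewrite addr0 subrr expr1 subrKC.
apply=> // s; rewrite expr0 mulr1 gtr0_norm ?phi_gt0 //.
apply: le_trans (HK (x + s)); apply: ler_peMl; first by rewrite ltW ?phi_gt0.
by rewrite lerDl exprn_even_ge0.
Qed.

(** The remainder keeps its factor [phi] at an intermediate point: for large [z]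
    the increment [k] is proportional to [z], and only the decay of [phi] makes
    the remainder bounded. *)
Lemma Phi_taylor2 (z k : R) : exists2 u : R, 0 <= u <= 1 &
  `|Phi (z + k) - Phi z - k * phi z| <= k ^+ 2 * `|(z + k * u) * phi (z + k * u)|.
Proof.
have d0 (s : R) : is_derive s 1 (fun s => Phi (z + k * s) - s * (k * phi z))
    (k * (phi (z + k * s) - phi z)).
  have h1 := is_derive_scaled (is_derive_Phi (z + k * s)).
  have h2 := is_deriveM (is_derive_id s (1 : R)) (is_derive_cst (k * phi z) s 1).
  apply: (is_derive_eq (is_deriveB h1 h2)).
  by rewrite /GRing.scale /=; ring.
have d1 (s : R) : is_derive s 1 (fun s => phi (z + k * s))
    (- ((z + k * s) * phi (z + k * s)) * k).
  exact: is_derive_scaled (is_derive_phi (z + k * s)).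
have cont (g : R -> R) (dg : R -> R) : (forall s : R, is_derive s 1 g (dg s)) -> continuous g.
  move=> dgs x; apply: differentiable_continuous; apply/derivable1_diffP.
  by case: (dgs x).
have [u1] := @MVT _ _ _ 0 1 ltr01 (fun x _ => d0 x) (continuous_subspaceT (cont _ _ d0)).
rewrite in_itv /= => /andP[u10 u11]; rewrite subr0 mulr1 mulr0 addr0 mulr1 mul1r mul0r subr0 => E1.
have [u2] := @MVT _ _ _ 0 u1 u10 (fun x _ => d1 x) (continuous_subspaceT (cont _ _ d1)).
rewrite in_itv /= => /andP[u20 u21]; rewrite mulr0 addr0 subr0 => E2.
exists u2; first lra.
have -> : Phi (z + k) - Phi z - k * phi z = Phi (z + k) - k * phi z - Phi z by ring.
set w := (z + k * u2) * phi (z + k * u2) in E2 *.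
have kk : `|k| * `|k| = k ^+ 2 by rewrite -expr2 real_normK ?num_real.
have -> : `|Phi (z + k) - k * phi z - Phi z| = k ^+ 2 * `|w| * u1.
  rewrite E1 E2; clearbody w; rewrite !normrM normrN (gtr0_norm u10) -kk; ring.
by apply: ler_piMr; [rewrite mulr_ge0 ?sqr_ge0|exact: ltW].
Qed.

(** The heat equation for [v |-> Phi (x / sqrt v)]: to first order, a variance [t]
    acts as the second order term of [Phi_taylor3] with [k ^ 2 = t]. *)
Lemma Phi_time : exists2 K : R, 0 < K & forall z t, 0 <= t <= 1 ->
  `|Phi (z / Num.sqrt (1 + t)) - Phi z + t / 2 * (z * phi z)| <= K * t ^+ 2.
Proof.
have [K K1 HK] := phi_decay; exists (3 * K) => [|z t ht]; first lra.
set q := Num.sqrt (1 + t).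
have qq : q ^+ 2 = 1 + t by rewrite sqr_sqrtr //; lra.
have q1 : 1 <= q by rewrite -[1]sqrtr1 ler_sqrt; lra.
have q0 : 0 < q by lra.
clearbody q.
pose r := q^-1.
have rq : r * q = 1 by rewrite /r mulVf // gt_eqF.
have r0 : 0 < r by rewrite invr_gt0.
have r1 : r <= 1 by rewrite invf_le1.
have r2 : r ^+ 2 * (1 + t) = 1 by rewrite -qq -exprMn rq expr1n.
have -> : z / q = z + (- ((1 - r) * z)) by rewrite /r; ring.
clearbody r.
have r2' : 2^-1 <= r ^+ 2 by nra.
have rt : 1 - r <= t * r ^+ 2 by rewrite expr2 in r2 *; nra.
set k := - ((1 - r) * z).
have [u hu Hxi] := Phi_taylor2 z k.
set xi := z + k * u in Hxi.
have xiz : r ^+ 2 * z ^+ 2 <= xi ^+ 2.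
  have -> : xi = z * (1 - u * (1 - r)) by rewrite /xi /k; ring.
  rewrite exprMn mulrC; apply: ler_wpM2l; first exact: sqr_ge0.
  by rewrite lerXn2r // ?nnegrE; nra_from r2 r2' rt hu.
have pxi := phi_gt0 xi; have pz := phi_gt0 z.
have Kxi := HK xi; have Kz := HK z.
have e1 : k ^+ 2 * `|xi * phi xi| <= t ^+ 2 * K.
  have k2 : k ^+ 2 <= t ^+ 2 * xi ^+ 2.
    rewrite /k sqrrN exprMn.
    apply: (@le_trans _ _ ((t * r ^+ 2) ^+ 2 * z ^+ 2)).
      by apply: ler_wpM2r; [exact: sqr_ge0|rewrite lerXn2r // ?nnegrE; nra_from r2 rt].
    rewrite exprMn -mulrA ler_wpM2l ?sqr_ge0 //; apply: le_trans xiz.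
    rewrite expr2 -mulrA; apply: ler_piMl; first by rewrite mulr_ge0 ?sqr_ge0.
    by rewrite expr2; nra_from r2 rt.
  rewrite normrM (gtr0_norm pxi).
  apply: (@le_trans _ _ (t ^+ 2 * xi ^+ 2 * (`|xi| * phi xi))).
    by apply: ler_wpM2r => //; rewrite mulr_ge0 // ltW.
  rewrite -mulrA; apply: ler_wpM2l; first exact: sqr_ge0.
  apply: le_trans Kxi; rewrite mulrA; apply: ler_wpM2r; first exact: ltW.
  rewrite -(real_normK (num_real xi)).
  have -> : xi ^+ 4 = `|xi| ^+ 4 by rewrite -normrX ger0_norm // exprn_even_ge0.
  have a0 := normr_ge0 xi; set a := `|xi| in a0 *.
  have -> : a ^+ 4 = (a ^+ 2) ^+ 2 by rewrite -exprM.
  have : 0 <= (a ^+ 2 - a) ^+ 2 by exact: sqr_ge0.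
  have : 0 <= (a - 1) ^+ 2 by exact: sqr_ge0.
  have : 0 <= (a ^+ 2 - 1) ^+ 2 by exact: sqr_ge0.
  by rewrite !expr2; (clear; nra).
have zK : `|z * phi z| <= K.
  rewrite normrM (gtr0_norm pz); apply: le_trans Kz; apply: ler_wpM2r; first exact: ltW.
  have -> : z ^+ 4 = `|z| ^+ 4 by rewrite -normrX ger0_norm // exprn_even_ge0.
  have a0 := normr_ge0 z; set a := `|z| in a0 *.
  have -> : a ^+ 4 = (a ^+ 2) ^+ 2 by rewrite -exprM.
  have : 0 <= (a ^+ 2 - 1) ^+ 2 by exact: sqr_ge0.
  have : 0 <= (a - 1) ^+ 2 by exact: sqr_ge0.
  by rewrite !expr2; (clear; nra).
have rt1 : 0 <= t / 2 - (1 - r) <= t ^+ 2.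
  have E : (1 - r) * (1 + r) = t * r ^+ 2 by rewrite expr2 in r2 *; lra_from r2.
  apply/andP; split.
    have : (1 - r) * (1 + r) <= t / 2 * (1 + r) by rewrite E; nra_from qq q1 rq r1.
    by rewrite ler_pM2r; lra_from r0.
  have : (t / 2 - t ^+ 2) * (1 + r) <= (1 - r) * (1 + r).
    have : 1 - t <= r ^+ 2 by nra_from E.
    rewrite E expr2; nra_from ht r0 r1.
  by rewrite ler_pM2r; lra_from r0.
have -> : Phi (z + k) - Phi z + t / 2 * (z * phi z) =
   (Phi (z + k) - Phi z - k * phi z) + (t / 2 - (1 - r)) * (z * phi z).
  by rewrite /k; ring.
apply: le_trans (ler_normD _ _) _; rewrite normrM (ger0_norm (proj1 (andP rt1))).
have : (t / 2 - (1 - r)) * `|z * phi z| <= t ^+ 2 * K.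
  by apply: ler_pM => //; case/andP: rt1.
have : 0 <= t ^+ 2 * K by rewrite mulr_ge0 ?sqr_ge0 //; lra_from K1.
by move: e1 Hxi; clear; lra.
Qed.

End StandardNormal.

(** * Gaussian smoothing and the binomial law *)

Section Heat.
Variables (R : realType) (d sigma : R).
Hypothesis sigma0' : 0 < sigma.

Local Notation Phi := (gauss_cdf d sigma).
Local Notation phi := (gauss_pdf sigma).

Local Notation P := (normal_prob d sigma).

Lemma Phi_tails (e : R) : 0 < e -> exists2 A : R, 0 < A & forall y, A <= y ->
  Phi (- y) <= e /\ 1 - e <= Phi y.
Proof.
move=> e0.
have up : P `]-oo, n%:R] @[n --> \oo] --> P setT.
  have <- : \bigcup_n `]-oo, (n%:R : R)]%classic = setT.
    rewrite -subTset => x _; exists (Num.truncn x).+1 => //=.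
    by rewrite in_itv /= ltW // truncnS_gt.
  apply: nondecreasing_cvg_mu => //; first exact: bigcup_measurable.
  by move=> a b ab; apply/subsetPset/subitvPr; rewrite bnd_simp ler_nat.
have dn : P `]-oo, (- n%:R)] @[n --> \oo] --> P set0.
  have <- : \bigcap_n `]-oo, (- n%:R : R)]%classic = set0.
    rewrite -subset0 => x /(_ (Num.truncn (- x)).+1 I) /=.
    rewrite in_itv /= => h; have := truncnS_gt (- x); lra.
  apply: nonincreasing_cvg_mu => //.
  - by rewrite -ge0_fin_numE // fin_num_measure.
  - exact: bigcap_measurable.
  by move=> a b ab; apply/subsetPset/subitvPr; rewrite bnd_simp lerN2 ler_nat.
have /fine_cvgP[_ /cvgrPdist_le /(_ e e0)[a _ Ha]] : P `]-oo, n%:R] @[n --> \oo] --> (1%:E : \bar R).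
  by rewrite -(@probability_setT _ _ _ P).
have /fine_cvgP[_ /cvgrPdist_le /(_ e e0)[b _ Hb]] : P `]-oo, (- n%:R)] @[n --> \oo] --> (0%:E : \bar R).
  by move: dn; rewrite measure0.
pose A := (`|d| + (maxn a b)%:R + 1) / sigma.
have ab0 : 0 <= (maxn a b)%:R :> R by rewrite ler0n.
have A0 : 0 < A by rewrite divr_gt0 //; have := normr_ge0 d; lra.
exists A => // y Ay.
have hy : `|d| + (maxn a b)%:R + 1 <= sigma * y by rewrite mulrC -ler_pdivrMr.
have := Ha a (leqnn _); have := Hb b (leqnn _).
rewrite /= sub0r normrN ger0_norm ?fine_ge0 // => h1; rewrite ler_norml => /andP[_ h2].
have mono u v : u <= v -> fine (P `]-oo, u]) <= fine (P `]-oo, v]).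
  move=> uv; rewrite -lee_fin !fineK ?fin_num_measure //.
  by apply: le_measure; rewrite ?inE //; apply: subitvPr; rewrite bnd_simp.
have amax : a%:R <= (maxn a b)%:R :> R by rewrite ler_nat leq_maxl.
have bmax : b%:R <= (maxn a b)%:R :> R by rewrite ler_nat leq_maxr.
have d1 := ler_norm d; have d2 := ler_norm (- d); rewrite normrN in d2.
split.
  by apply: le_trans h1; apply: mono; rewrite mulrN; lra.
suff : fine (P `]-oo, a%:R]) <= Phi y by lra.
by apply: mono; lra.
Qed.

#[local] Opaque gauss_cdf gauss_pdf.

(** [heat v] is the half-line indicator smoothed by a Gaussian of variance [v];
    it solves the heat equation, so that a Gaussian increment merely increases
    [v], and a centred Bernoulli increment does so up to a third order error. *)
Definition heat (v x : R) : R := Phi (x / Num.sqrt v).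

Lemma heatE v x : heat v x = Phi (x / Num.sqrt v). Proof. by []. Qed.

Lemma heat_sigma2 x : heat (sigma ^+ 2) x = Phi (x / sigma).
Proof. by have s0 := sigma0'; rewrite heatE sqrtr_sqr gtr0_norm. Qed.

Lemma heat_le v x y : x <= y -> heat v x <= heat v y.
Proof.
move=> xy; rewrite !heatE; apply: (Phi_le d sigma0').
by rewrite ler_wpM2r // invr_ge0 sqrtr_ge0.
Qed.

(** The first order terms cancel because the increment is centred, and its second
    order term is that of an increase of [v] by [p (1 - p) h ^ 2]. *)
Lemma heat_bernoulli : exists2 K : R, 0 < K & forall v0 v h p x,
  0 < v0 -> v0 <= v -> 0 <= p <= 1 -> h ^+ 2 <= v0 ->
  `|p * heat v (x - h * (1 - p)) + (1 - p) * heat v (x + h * p)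
     - heat (v + p * (1 - p) * h ^+ 2) x| <= K * (`|h| / Num.sqrt v0) ^+ 3.
Proof.
have [K3 K30 H3] := Phi_taylor3 d sigma0'; have [Kt Kt0 Ht] := Phi_time d sigma0'.
exists (K3 + Kt) => [|v0 v h p x v00 v0v hp hv0]; first lra.
have vp : 0 < v by lra.
have sv0 : 0 < Num.sqrt v0 by rewrite sqrtr_gt0.
have sv : 0 < Num.sqrt v by rewrite sqrtr_gt0.
have svv : Num.sqrt v0 <= Num.sqrt v by rewrite ler_sqrt // ltW.
have sq : Num.sqrt v ^+ 2 = v by rewrite sqr_sqrtr // ltW.
pose z := x / Num.sqrt v; pose a := h / Num.sqrt v.
have a2 : a ^+ 2 = h ^+ 2 / v by rewrite expr_div_n sq.
have a21 : a ^+ 2 <= 1 by rewrite a2 ler_pdivrMr // mul1r; lra.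
have a20 := sqr_ge0 a.
have na : `|a| <= `|h| / Num.sqrt v0.
  rewrite normrM normfV (gtr0_norm sv) ler_wpM2l // lef_pV2 // posrE.
have na0 := normr_ge0 a.
have na2 : `|a| ^+ 2 = a ^+ 2 by rewrite real_normK ?num_real.
have na1 : `|a| <= 1 by rewrite -(@expr_le1 _ 2) // na2.
have pp : 0 <= p * (1 - p) <= 1 by nra.
pose t := p * (1 - p) * a ^+ 2.
have ht : 0 <= t <= 1 by rewrite /t; nra.
have E1 : heat v (x - h * (1 - p)) = Phi (z + - ((1 - p) * a)).
  by rewrite /heat /z /a; congr Phi; ring.
have E2 : heat v (x + h * p) = Phi (z + p * a).
  by rewrite /heat /z /a; congr Phi; ring.
have E3 : heat (v + p * (1 - p) * h ^+ 2) x = Phi (z / Num.sqrt (1 + t)).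
  rewrite /heat /z; congr Phi.
  have -> : v + p * (1 - p) * h ^+ 2 = v * (1 + t).
    by rewrite /t a2; field; rewrite gt_eqF.
  by rewrite sqrtrM ?ltW // invfM mulrA.
rewrite E1 E2 E3 {E1 E2 E3}.
have T1 := H3 z (- ((1 - p) * a)); have T2 := H3 z (p * a); have T3 := Ht z t ht.
set F1 := Phi (z + - _) in T1 *; set F2 := Phi (z + _) in T2 *; set F3 := Phi (z / _) in T3 *.
have n1 : `|- ((1 - p) * a)| ^+ 3 <= `|a| ^+ 3.
  rewrite normrN normrM ger0_norm; last lra_from hp.
  by rewrite lerXn2r // ?nnegrE ?mulr_ge0 //; [lra_from hp na0|nra_from hp na0].
have n2 : `|p * a| ^+ 3 <= `|a| ^+ 3.
  rewrite normrM ger0_norm; last lra_from hp.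
  by rewrite lerXn2r // ?nnegrE ?mulr_ge0 //; [lra_from hp na0|nra_from hp na0].
have n3 : t ^+ 2 <= `|a| ^+ 3.
  have -> : `|a| ^+ 3 = `|a| * a ^+ 2 by rewrite exprS na2.
  have ta : t <= a ^+ 2 by rewrite /t; (clear; nra).
  have ta' : a ^+ 2 <= `|a| by rewrite -na2 expr2; nra_from na0 na1.
  by rewrite expr2; nra_from ht ta ta'.
have bigE : p * F1 + (1 - p) * F2 - F3 =
  p * (F1 - Phi z - - ((1 - p) * a) * phi z + (- ((1 - p) * a)) ^+ 2 / 2 * (z * phi z))
  + (1 - p) * (F2 - Phi z - p * a * phi z + (p * a) ^+ 2 / 2 * (z * phi z))
  - (F3 - Phi z + t / 2 * (z * phi z)).
  by rewrite /t; field.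
rewrite bigE.
set G1 := F1 - _ - _ + _ in T1 *; set G2 := F2 - _ - _ + _ in T2 *; set G3 := F3 - _ + _ in T3 *.
have c3 : `|a| ^+ 3 <= (`|h| / Num.sqrt v0) ^+ 3.
  by rewrite lerXn2r // ?nnegrE // divr_ge0 // ltW.
apply: (@le_trans _ _ ((K3 + Kt) * `|a| ^+ 3)); last by rewrite ler_pM2l //; lra_from K30 Kt0.
apply: le_trans (ler_normB _ _) _; rewrite [leRHS]mulrDl; apply: lerD; last first.
  by apply: le_trans T3 _; rewrite ler_pM2l.
apply: le_trans (ler_normD _ _) _.
have -> : `|p * G1| = p * `|G1| by rewrite normrM ger0_norm; lra_from hp.
have -> : `|(1 - p) * G2| = (1 - p) * `|G2| by rewrite normrM ger0_norm; lra_from hp.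
have b1 : `|G1| <= K3 * `|a| ^+ 3 by apply: le_trans T1 _; rewrite ler_pM2l.
have b2 : `|G2| <= K3 * `|a| ^+ 3 by apply: le_trans T2 _; rewrite ler_pM2l.
clear -hp b1 b2; set Q := K3 * _ in b1 b2 *; clearbody Q G1 G2.
have : p * `|G1| <= p * Q by rewrite ler_wpM2l //; lra.
have : (1 - p) * `|G2| <= (1 - p) * Q by rewrite ler_wpM2l //; lra.
lra.
Qed.

Lemma binE_dist (p e : R) n (f1 f2 : nat -> R) : 0 <= p <= 1 ->
  (forall k, (k <= n)%N -> `|f1 k - f2 k| <= e) -> `|binE p n f1 - binE p n f2| <= e.
Proof.
move=> hp H; rewrite ler_norml; apply/andP; split.
  have -> : binE p n f1 - binE p n f2 = 1 * binE p n f1 + (-1) * binE p n f2 by ring.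
  rewrite -binE_lin -[leLHS](binE_cst p n); apply: binE_le => // k kn.
  by have := H k kn; rewrite ler_norml => /andP[+ _]; lra.
have -> : binE p n f1 - binE p n f2 = 1 * binE p n f1 + (-1) * binE p n f2 by ring.
rewrite -binE_lin -[leRHS](binE_cst p n); apply: binE_le => // k kn.
by have := H k kn; rewrite ler_norml => /andP[_]; lra.
Qed.

(** Lindeberg's argument: the Bernoulli trials are replaced one after the other. *)
Lemma heat_binomial : exists2 K : R, 0 < K & forall v0 h p, 
  0 < v0 -> 0 <= p <= 1 -> h ^+ 2 <= v0 -> forall n v x, v0 <= v ->
  `|binE p n (fun k => heat v (x - h * (k%:R - n%:R * p)))
     - heat (v + n%:R * (p * (1 - p) * h ^+ 2)) x| <=
  n%:R * (K * (`|h| / Num.sqrt v0) ^+ 3).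
Proof.
have [K K0 HK] := heat_bernoulli; exists K => // v0 h p v00 hp hv0.
set E := K * _; have pp : 0 <= p * (1 - p) by rewrite mulr_ge0; lra.
have ph : 0 <= p * (1 - p) * h ^+ 2 by rewrite mulr_ge0 ?sqr_ge0.
elim=> [|n IH] v x v0v.
  by rewrite /= !mul0r subr0 addr0 mulr0 subr0 subrr normr0.
have [q qE] : exists q, q = p * (1 - p) * h ^+ 2 by eexists.
rewrite -qE in ph IH *.
have -> : heat (v + n.+1%:R * q) x = heat (v + q + n%:R * q) x.
  by rewrite -natr1 mulrDl mul1r [_ * q + q]addrC addrA.
set a := binE _ _ _.
have -> : a - heat (v + q + n%:R * q) x =
   (a - binE p n (fun k => heat (v + q) (x - h * (k%:R - n%:R * p)))) +
   (binE p n (fun k => heat (v + q) (x - h * (k%:R - n%:R * p))) - heat (v + q + n%:R * q) x).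
  by ring.
apply: le_trans (ler_normD _ _) _; rewrite -natr1 mulrDl mul1r addrC.
apply: lerD; first by apply: IH; lra.
rewrite /a /=; apply: binE_dist => // k kn.
have := HK v0 v h p (x - h * (k%:R - n%:R * p)) v00 v0v hp hv0.
set y := x - h * (k%:R - n%:R * p).
have -> : x - h * (k.+1%:R - n.+1%:R * p) = y - h * (1 - p) by rewrite /y -!natr1; ring.
have -> : x - h * (k%:R - n.+1%:R * p) = y + h * p by rewrite /y -!natr1; ring.
by rewrite -qE.
Qed.

Lemma heat_lip : exists2 K : R, 0 < K & forall v x y, 0 < v ->
  `|heat v y - heat v x| <= K * (`|y - x| / Num.sqrt v).
Proof.
have [K K0 HK] := Phi_lip d sigma0'; exists K; first exact: K0.
move=> v x y v0.
apply: le_trans (HK _ _) _; rewrite ler_pM2l // -mulrBl normrM normfV.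
by rewrite (@gtr0_norm _ (Num.sqrt v)) // sqrtr_gt0.
Qed.

Lemma heat_time_lip : exists2 K : R, 0 < K & forall v e x, 0 < v -> 0 <= e ->
  `|heat (v + e) x - heat v x| <= K * (e / v).
Proof.
have [Kt Kt0 Ht] := Phi_time d sigma0'; have [K1 K11 H1] := phi_decay sigma0'.
exists (Kt + K1 + 1) => [|v e x v0 e0]; first lra.
pose t := e / v; have t0 : 0 <= t by rewrite divr_ge0 // ltW.
rewrite -/t; have [t1|t1] := lerP t 1; last first.
  have hb : 0 <= heat (v + e) x <= 1 by rewrite /heat Phi_ge0 Phi_le1.
  have ha : 0 <= heat v x <= 1 by rewrite /heat Phi_ge0 Phi_le1.
  apply: (@le_trans _ _ (1 * 1)).
    rewrite mulr1 ler_norml; clear - ha hb.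
    by move: (heat _ _) (heat _ _) ha hb => a b ha hb; apply/andP; split; lra.
  by apply: ler_pM; rewrite ?ler01 ?(ltW t1) //; lra_from Kt0 K11.
pose z := x / Num.sqrt v.
have -> : heat (v + e) x = Phi (z / Num.sqrt (1 + t)).
  rewrite /heat /z; congr Phi.
  have -> : v + e = v * (1 + t) by rewrite /t; field; rewrite gt_eqF.
  by rewrite sqrtrM ?ltW // invfM mulrA.
have := Ht z t ltac:(lra).
have zK : `|z * phi z| <= K1.
  have pz := phi_gt0 sigma0' z.
  rewrite normrM (gtr0_norm pz); apply: le_trans (H1 z); apply: ler_wpM2r; first exact: ltW.
  have -> : z ^+ 4 = `|z| ^+ 4 by rewrite -normrX ger0_norm // exprn_even_ge0.
  have a0 := normr_ge0 z; set a := `|z| in a0 *.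
  have -> : a ^+ 4 = (a ^+ 2) ^+ 2 by rewrite -exprM.
  have : 0 <= (a ^+ 2 - 1) ^+ 2 by exact: sqr_ge0.
  have : 0 <= (a - 1) ^+ 2 by exact: sqr_ge0.
  by rewrite !expr2; nra.
rewrite /heat -/z; move: zK; rewrite !ler_norml => /andP[z1 z2] /andP[h1 h2].
set D := Phi _ in h1 h2 *; set w := z * phi z in z1 z2 h1 h2 *; clearbody D w.
have tt : t ^+ 2 <= t by rewrite expr2; nra.
have Ktt : Kt * t ^+ 2 <= Kt * t by rewrite ler_pM2l.
have tw1 : t * w <= t * K1 by rewrite ler_wpM2l.
have tw2 : - (t * K1) <= t * w by rewrite -mulrN ler_wpM2l.
have tK : 0 <= t * K1 by rewrite mulr_ge0 //; lra.
apply/andP; split; lra.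
Qed.

End Heat.

(** * Lindeberg replacement along the chain *)

Lemma ler_dist3 (R : realDomainType) (a b c d e1 e2 e3 : R) :
  `|a - b| <= e1 -> `|b - c| <= e2 -> `|c - d| <= e3 -> `|a - d| <= e1 + e2 + e3.
Proof.
move=> h1 h2 h3; apply: le_trans (ler_distD c _ _) _; rewrite lerD //.
by apply: le_trans (ler_distD b _ _) _; rewrite lerD.
Qed.

#[local] Opaque gauss_cdf gauss_pdf heat.

Section CentralLimit.
Variables (R : realType) (f : R -> R) (m : nat) (beta gamma : R).
Hypothesis hf : majority_type f m beta gamma.
Variables (d sigma : R).
Hypothesis sigma0' : 0 < sigma.

Local Notation heat := (heat d sigma).
Local Notation f01 := (maj_f_range hf).

Lemma step_dist n (u1 u2 u3 : R -> R) x : 0 <= x <= 1 ->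
  (forall y, 0 <= y <= 1 -> `|u1 y - u2 y| <= u3 y) ->
  `|step f n u1 x - step f n u2 x| <= step f n u3 x.
Proof.
move=> hx H; rewrite ler_norml; apply/andP; split.
  have -> : step f n u1 x - step f n u2 x = 1 * step f n u1 x + (-1) * step f n u2 x by ring.
  have -> : - step f n u3 x = 0 * step f n u3 x + (-1) * step f n u3 x by ring.
  rewrite -!step_lin; apply: step_le => // [|y hy]; [exact: f01|].
  by have := H y hy; rewrite ler_norml => /andP[+ _]; lra.
have -> : step f n u1 x - step f n u2 x = 1 * step f n u1 x + (-1) * step f n u2 x by ring.
rewrite -step_lin; apply: step_le => // [|y hy]; [exact: f01|].
by have := H y hy; rewrite ler_norml => /andP[_]; lra.
Qed.

(** One round acts on smoothed indicators of the rescaled deviation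
    [sqrt n (x - 1 / 2)] as multiplication by [gamma] followed by the addition of
    a Gaussian of variance [1 / 4]. *)
Lemma step_heat v0 : 0 < v0 -> exists2 C : R, 0 < C & forall n l v c x,
  (0 < n)%N -> v0^-1 <= n%:R -> 0 <= l <= 1 -> v0 <= v -> 0 <= x <= 1 ->
  `|step f n (fun y => heat v (c - l * (Num.sqrt n%:R * (y - 2^-1)))) x
    - heat (v + l ^+ 2 / 4) (c - l * gamma * (Num.sqrt n%:R * (x - 2^-1)))|
  <= C * (l / Num.sqrt n%:R) * (1 + n%:R * (x - 2^-1) ^+ 2).
Proof.
move=> v00.
have [Kb Kb0 Hb] := heat_binomial d sigma0'.
have [Kl Kl0 Hl] := heat_lip d sigma0'.
have [Kt Kt0 Ht] := heat_time_lip d sigma0'.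
have [Cf Cf0 HC] := maj_half_expansion hf.
have g1 := maj_gamma hf.
have sv0 : 0 < Num.sqrt v0 by rewrite sqrtr_gt0.
exists (Kb / Num.sqrt v0 ^+ 3 + Kt * gamma ^+ 2 / v0 + Kl * Cf / Num.sqrt v0).
  by rewrite !addr_gt0 // ?divr_gt0 ?mulr_gt0 ?exprn_gt0 //; lra.
move=> n l v c x n0 nv hl v0v hx.
have nR : 1 <= n%:R :> R by rewrite ler1n.
have s0 : 0 < Num.sqrt n%:R :> R by rewrite sqrtr_gt0; lra.
have ss : Num.sqrt n%:R ^+ 2 = n%:R :> R by rewrite sqr_sqrtr //; lra.
have [s sE] : exists s : R, s = Num.sqrt n%:R by eexists.
rewrite -!sE in s0 ss *.
have s1 : 1 <= s by rewrite -(@expr_ge1 _ 2) ?ss // ltW.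
have [p pE] : exists p, p = f x by eexists.
have hp : 0 <= p <= 1 by rewrite pE; exact: f01.
have h2 : (l / s) ^+ 2 <= v0.
  rewrite expr_div_n ss ler_pdivrMr; last lra.
  have : 1 <= v0 * n%:R by rewrite -ler_pdivrMl // mulr1.
  by move=> h; apply: le_trans h; rewrite expr_le1 //; lra_from nv hl v0v.
have nx2 : 0 <= (x - 2^-1) ^+ 2 by exact: sqr_ge0.
have nx : 0 <= n%:R * (x - 2^-1) ^+ 2 by rewrite mulr_ge0 //; lra.
have ls : 0 <= l / s by rewrite divr_ge0 //; lra_from hl s1 pE.
have xh : `|x - 2^-1| <= 2^-1 by rewrite ler_norml; apply/andP; split; lra_from hx nR ls.
have q0 : 0 <= p * (1 - p) by nra.
have pw : (p - 2^-1) ^+ 2 <= gamma ^+ 2 * (x - 2^-1) ^+ 2.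
  have := maj_half_lip hf xh; rewrite subrKC -pE => h.
  rewrite -(real_normK (num_real (p - 2^-1))) -(real_normK (num_real (x - 2^-1))) -exprMn.
  by rewrite lerXn2r // ?nnegrE ?mulr_ge0 //; lra_from g1 sv0 n0 hx.
rewrite !mulrDl.
apply: (@ler_dist3 R _ (heat (v + n%:R * (p * (1 - p) * (l / s) ^+ 2)) (c - l * (s * (p - 2^-1))))
  (heat (v + l ^+ 2 / 4) (c - l * (s * (p - 2^-1))))).
- rewrite /step -pE (@binE_ext _ p n _
    (fun k => heat v (c - l * (s * (p - 2^-1)) - l / s * (k%:R - n%:R * p)))); last first.
    by move=> k _; congr heat; rewrite -ss; field; rewrite gt_eqF.
  apply: le_trans (Hb v0 (l / s) p v00 hp h2 n v _ v0v) _.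
  rewrite (ger0_norm ls).
  have -> : n%:R * (Kb * (l / s / Num.sqrt v0) ^+ 3) = Kb / Num.sqrt v0 ^+ 3 * (l / s) * l ^+ 2.
    by rewrite -ss; field; rewrite !gt_eqF.
  apply: ler_pM; rewrite ?sqr_ge0 //.
    by rewrite mulr_ge0 // divr_ge0 ?exprn_ge0 // ltW.
  by rewrite (@le_trans _ _ 1) //; [rewrite expr_le1 //; lra_from hl v0v nx|lra_from hl v0v nx].
- rewrite distrC.
  have e0 : 0 <= l ^+ 2 * (p - 2^-1) ^+ 2 by rewrite mulr_ge0 ?sqr_ge0.
  have -> : v + l ^+ 2 / 4 = v + n%:R * (p * (1 - p) * (l / s) ^+ 2) + l ^+ 2 * (p - 2^-1) ^+ 2.
    by rewrite -ss; field; rewrite gt_eqF.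
  have r0 : 0 <= n%:R * (p * (1 - p) * (l / s) ^+ 2).
    by rewrite mulr_ge0 // mulr_ge0 ?sqr_ge0.
  apply: le_trans (Ht _ _ _ _ e0) _; first lra_from v00 v0v r0.
  set V := v + _.
  have -> : Kt * gamma ^+ 2 / v0 * (l / s) * (1 + n%:R * (x - 2^-1) ^+ 2) =
    Kt * (gamma ^+ 2 * (l / s * (1 + n%:R * (x - 2^-1) ^+ 2)) / v0) by ring.
  rewrite ler_pM2l //; apply: ler_pM; rewrite ?invr_ge0 //; first by rewrite /V; lra_from v00 v0v r0.
    apply: (@le_trans _ _ (l ^+ 2 * (gamma ^+ 2 * (x - 2^-1) ^+ 2))).
      by apply: ler_wpM2l; rewrite ?sqr_ge0.
    rewrite mulrCA; apply: ler_wpM2l; first exact: sqr_ge0.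
    have -> : l / s * (1 + n%:R * (x - 2^-1) ^+ 2) = l / s + l * s * (x - 2^-1) ^+ 2.
      by rewrite -ss; field; rewrite gt_eqF.
    have : l ^+ 2 * (x - 2^-1) ^+ 2 <= l * s * (x - 2^-1) ^+ 2 by apply: ler_wpM2r => //; nra.
    lra_from nx ls xh.
  by rewrite lef_pV2 ?posrE /V; lra_from v00 v0v r0.
apply: le_trans (Hl _ _ _ _) _; first by have := sqr_ge0 l; lra_from v00 v0v hx.
have -> : Kl * Cf / Num.sqrt v0 * (l / s) * (1 + n%:R * (x - 2^-1) ^+ 2) =
    Kl * (Cf * (l / s * (1 + n%:R * (x - 2^-1) ^+ 2)) / Num.sqrt v0) by ring.
rewrite ler_pM2l //; apply: ler_pM; rewrite ?invr_ge0 ?sqrtr_ge0 //.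
  have -> : c - l * (s * (p - 2^-1)) - (c - l * gamma * (s * (x - 2^-1))) =
    - (l * s * (p - (2^-1 + gamma * (x - 2^-1)))) by ring.
  rewrite normrN normrM ger0_norm; last by rewrite mulr_ge0 //; lra_from hl v0v s0.
  have := HC _ xh; rewrite subrKC -pE => h.
  apply: (@le_trans _ _ (l * s * (Cf * (x - 2^-1) ^+ 2))).
    by apply: ler_wpM2l => //; rewrite mulr_ge0 //; lra_from hl v0v s0.
  have -> : l / s * (1 + n%:R * (x - 2^-1) ^+ 2) = l / s + l * s * (x - 2^-1) ^+ 2.
    by rewrite -ss; field; rewrite gt_eqF.
  have : 0 <= Cf * (l / s) by rewrite mulr_ge0 // ltW.
  lra_from h.
rewrite lef_pV2 ?posrE ?sqrtr_gt0 //; last by have := sqr_ge0 l; lra_from v00 v0v hx.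
by rewrite ler_sqrt; have := sqr_ge0 l; lra_from v00 v0v hx.
Qed.

(** The weight [om + n (x - 1/2)^2] with [om = 1 + 1 / (4 (gamma ^ 2 - 1))] is
    multiplied by at most [gamma ^ 2] in one round: the summand [om] is so large
    that [(gamma ^ 2 - 1) om] pays for the variance [1 / 4] of the noise. So the
    errors of the rounds form a geometric sum, and for [l = gamma ^ (- t)] their
    total is of order [gamma ^ t / sqrt n]. *)
Lemma iter_step_heat v0 : 0 < v0 -> exists2 C : R, 0 < C & forall n t l v c x,
  (0 < n)%N -> v0^-1 <= n%:R -> 0 <= l -> l * gamma ^+ t <= 1 -> v0 <= v -> 0 <= x <= 1 ->
  `|iter t (step f n) (fun y => heat v (c - l * (Num.sqrt n%:R * (y - 2^-1)))) x
    - heat (v + l ^+ 2 / 4 * (((gamma ^+ t) ^+ 2 - 1) / (gamma ^+ 2 - 1)))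
           (c - l * gamma ^+ t * (Num.sqrt n%:R * (x - 2^-1)))|
  <= C * (l * ((gamma ^+ t) ^+ 2 - gamma ^+ t) / Num.sqrt n%:R)
       * (1 + (4 * (gamma ^+ 2 - 1))^-1 + n%:R * (x - 2^-1) ^+ 2).
Proof.
move=> v00; have [C1 C10 H1] := step_heat v00.
have g1 := maj_gamma hf.
have gg : 0 < gamma ^+ 2 - gamma by rewrite expr2; nra.
have gg1 : 0 < gamma ^+ 2 - 1 by rewrite expr2; nra.
have [om omE] : exists om, om = 1 + (4 * (gamma ^+ 2 - 1))^-1 by eexists.
have omg : 4^-1 + om <= gamma ^+ 2 * om.
  have : (gamma ^+ 2 - 1) * (4 * (gamma ^+ 2 - 1))^-1 = 4^-1 by field; rewrite gt_eqF.
  rewrite omE; lra.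
have om1 : 1 <= om by rewrite omE lerDl invr_ge0 mulr_ge0 // ltW.
rewrite -omE.
have [C CE] : exists C, C = C1 / (gamma ^+ 2 - gamma) by eexists.
have C0 : 0 < C by rewrite CE divr_gt0.
have CC : C * (gamma ^+ 2 - gamma) = C1 by rewrite CE divfK // gt_eqF.
exists C => // n t l v c x n0 nv l0 + v0v.
have s0 : 0 < Num.sqrt n%:R :> R by rewrite sqrtr_gt0 ltr0n.
have nR : 0 < n%:R :> R by rewrite ltr0n.
elim: t x => [|t IH] x lg hx.
  rewrite /= expr0 expr1n subrr mul0r mulr0 addr0 mulr1 subrr normr0.
  by rewrite mulr0 !mul0r mulr0 mul0r.
have [g gE] : exists g, g = gamma ^+ t by eexists.
have g_1 : 1 <= g by rewrite gE exprn_ege1 // ltW.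
rewrite exprS -gE in lg *; rewrite -gE in IH.
have lg' : 0 <= l * g <= 1 by rewrite mulr_ge0 //=; nra.
have e0 : 0 <= C * (l * (g ^+ 2 - g) / Num.sqrt n%:R).
  rewrite mulr_ge0 ?(ltW C0) // divr_ge0 ?(ltW s0) // mulr_ge0 // expr2; nra.
have hv : v0 <= v + l ^+ 2 / 4 * ((g ^+ 2 - 1) / (gamma ^+ 2 - 1)).
  have : 0 <= l ^+ 2 / 4 * ((g ^+ 2 - 1) / (gamma ^+ 2 - 1)); last lra_from l0 v0v.
  rewrite mulr_ge0 // ?divr_ge0 ?sqr_ge0 ?(ltW gg1) // expr2; nra.
have S := H1 n (l * g) _ c x n0 nv lg' hv hx.
have D := @step_dist n _ _ (fun y => C * (l * (g ^+ 2 - g) / Num.sqrt n%:R) *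
   (om + n%:R * (y - 2^-1) ^+ 2)) x hx (fun y hy => IH y (proj2 (andP lg')) hy).
rewrite iterS.
have E1 : v + l ^+ 2 / 4 * (((gamma * g) ^+ 2 - 1) / (gamma ^+ 2 - 1)) =
  v + l ^+ 2 / 4 * ((g ^+ 2 - 1) / (gamma ^+ 2 - 1)) + (l * g) ^+ 2 / 4.
  by field; rewrite gt_eqF.
have E2 : l * (gamma * g) = l * g * gamma by ring.
rewrite E1 E2.
have W : step f n (fun y => C * (l * (g ^+ 2 - g) / Num.sqrt n%:R) *
   (om + n%:R * (y - 2^-1) ^+ 2)) x <=
   C * (l * (g ^+ 2 - g) / Num.sqrt n%:R) * (gamma ^+ 2 * (om + n%:R * (x - 2^-1) ^+ 2)).
  set e := C * _ in e0 *.
  rewrite (_ : (fun y => _) = (fun y => (e * om) * 1 + (e * n%:R) * (y - 2^-1) ^+ 2)); last first.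
    by apply/funext => y; ring.
  rewrite step_lin step_cst step_sqr //.
  have -> : e * om * 1 + e * n%:R * ((f x - 2^-1) ^+ 2 + f x * (1 - f x) / n%:R) =
    e * (om + n%:R * (f x - 2^-1) ^+ 2 + f x * (1 - f x)) by field; rewrite gt_eqF.
  apply: ler_wpM2l => //; rewrite [leRHS]mulrDr.
  have xh : `|x - 2^-1| <= 2^-1 by rewrite ler_norml; apply/andP; split; lra_from hx e0.
  have pw : (f x - 2^-1) ^+ 2 <= gamma ^+ 2 * (x - 2^-1) ^+ 2.
    have := maj_half_lip hf xh; rewrite subrKC => h.
    rewrite -(real_normK (num_real (f x - 2^-1))) -(real_normK (num_real (x - 2^-1))) -exprMn.
    by rewrite lerXn2r // ?nnegrE ?mulr_ge0 //; lra_from v00 C10 g1 gg.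
  have : n%:R * (f x - 2^-1) ^+ 2 <= n%:R * (gamma ^+ 2 * (x - 2^-1) ^+ 2) by rewrite ler_pM2l.
  have : f x * (1 - f x) <= 4^-1.
    have : 0 <= (f x - 2^-1) ^+ 2 by exact: sqr_ge0.
    by rewrite expr2; lra_from e0.
  have -> : gamma ^+ 2 * (n%:R * (x - 2^-1) ^+ 2) = n%:R * (gamma ^+ 2 * (x - 2^-1) ^+ 2) by ring.
  lra_from omg om1.
move: S D; set a := step f n (iter t _ _) x; set b := step f n _ x; set c1 := heat _ _.
move=> S D; clearbody a b c1.
have -> : a - c1 = (a - b) + (b - c1) by ring.
apply: le_trans (ler_normD _ _) _.
apply: le_trans (lerD D S) _; apply: le_trans (lerD W (lexx _)) _.
have q1 : 1 + n%:R * (x - 2^-1) ^+ 2 <= om + n%:R * (x - 2^-1) ^+ 2 by lra_from om1 CE.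
have lgs : 0 <= C1 * (l * g / Num.sqrt n%:R).
  by rewrite mulr_ge0 ?(ltW C10) // divr_ge0 ?(ltW s0) //; lra_from gE lg lg'.
apply: le_trans (lerD (lexx _) (ler_wpM2l lgs q1)) _.
rewrite -CC le_eqVlt; apply/orP; left; apply/eqP; field.
by rewrite gt_eqF.
Qed.

End CentralLimit.

(** * Central limit theorem near 1/2 *)

Section CentralLimitTheorem.
Variables (R : realType) (f : R -> R) (m : nat) (beta gamma : R).
Hypothesis hf : majority_type f m beta gamma.
Variables (d sigma : R).
Hypothesis sigma0' : 0 < sigma.
Hypothesis sigmaE' : sigma ^+ 2 = (4 * (gamma ^+ 2 - 1))^-1.

Local Notation heat := (heat d sigma).
Local Notation Phi := (gauss_cdf d sigma).
Local Notation f01 := (maj_f_range hf).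

Definition deviation n (x : R) : R := Num.sqrt n%:R * (x - 2^-1).

(** The mass that the limit law [N(d, sigma ^ 2)] gives to [-z, z]. *)
Definition gauss_window (z : R) : R := Phi ((z - d) / sigma) - Phi ((- z - d) / sigma).

(** The indicator is sandwiched between differences of Gaussian smoothings of
    small variance [v], to which [iter_step_heat] applies with
    [l = gamma ^ (- t)]. The accumulated error is of order [gamma ^ t / sqrt n],
    which explains why [gamma ^ t] has to stop at a small multiple of [sqrt n];
    on the other hand [gamma ^ t] must be large for the variance to be close to
    its limit. *)
Theorem clt_indicator (eta : R) : 0 < eta ->
  exists e0 rho : R, [/\ 0 < e0, 0 < rho & forall e, 0 < e <= e0 ->
  exists N : nat, forall n t x z, (N <= n)%N ->
    gamma ^+ t <= e * Num.sqrt n%:R -> e * Num.sqrt n%:R <= gamma ^+ t.+1 ->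
    0 <= x <= 1 -> `|deviation n x - d| <= rho -> 0 <= z ->
    `|iter t (step f n)
        (fun y => if `|deviation n y| / gamma ^+ t <= z then 1 else 0) x
      - gauss_window z| <= eta].
Proof.
move=> eta0; have s0 := sigma0'; have sE := sigmaE'.
have g1 := maj_gamma hf.
have [e' e'E] : exists e', e' = eta / 10 by eexists.
have e'0 : 0 < e' by rewrite e'E divr_gt0.
have [Kl Kl0 Hl] := heat_lip d sigma0'.
have [Kt Kt0 Ht] := heat_time_lip d sigma0'.
have [A A0 HA] := Phi_tails d sigma0' e'0.
have [del delE] : exists del, del = e' * sigma / Kl by eexists.
have del0 : 0 < del by rewrite delE divr_gt0 // mulr_gt0.
have Kld : Kl * (del / sigma) <= e'.
  by rewrite delE le_eqVlt; apply/orP; left; apply/eqP; field; rewrite !gt_eqF.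
have sq : Num.sqrt (sigma ^+ 2) = sigma by rewrite sqrtr_sqr gtr0_norm.
have s20 : 0 < sigma ^+ 2 by rewrite exprn_gt0.
pose v := Num.min ((del / A) ^+ 2) (e' * sigma ^+ 2 / Kt).
have v0 : 0 < v by rewrite lt_min exprn_gt0 ?divr_gt0 ?mulr_gt0.
have vdel : v <= (del / A) ^+ 2 by rewrite /v ge_min lexx.
have vKt : Kt * (v / sigma ^+ 2) <= e'.
  by rewrite mulrA ler_pdivrMr // -ler_pdivlMl // mulrC /v ge_min lexx orbT.
clearbody v.
have dA : A <= del / Num.sqrt v.
  rewrite ler_pdivlMr ?sqrtr_gt0 // mulrC -ler_pdivlMr //.
  by rewrite -[leRHS](@gtr0_norm _ (del / A)) ?divr_gt0 // -sqrtr_sqr ler_wsqrtr.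
have tail1 y : y <= - del -> heat v y <= e'.
  move=> hy; apply: le_trans (heat_le d sigma0' v hy) _; rewrite heatE mulNr.
  by case: (HA _ dA).
have tail2 y : del <= y -> 1 - e' <= heat v y.
  move=> hy; apply: le_trans _ (heat_le d sigma0' v hy); rewrite heatE.
  by case: (HA _ dA).
have h0 y : 0 <= heat v y by rewrite heatE; exact: Phi_ge0.
have h1 y : heat v y <= 1 by rewrite heatE; exact: Phi_le1.
have [C C0 HC] := iter_step_heat hf d sigma0' v0.
have [W W_E] : exists W, W = 1 + (4 * (gamma ^+ 2 - 1))^-1 + (`|d| + 1) ^+ 2 by eexists.
have WE : W = 1 + sigma ^+ 2 + (`|d| + 1) ^+ 2 by rewrite W_E sE.
have W0 : 0 < W by rewrite WE; have := sqr_ge0 (`|d| + 1); lra.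
exists (e' / (C * W)), (Num.min 1 del); split.
- by rewrite divr_gt0 // mulr_gt0.
- by rewrite lt_min ltr01.
move=> e /andP[e_0 ee0].
have CWe : C * W * e <= e' by rewrite mulrC -ler_pdivlMr // mulr_gt0.
pose u0 := Num.min 2^-1 (e' / (2 * Kt)).
have u00 : 0 < u0 by rewrite lt_min invr_gt0 ltr0n divr_gt0 // mulr_gt0.
have u02 : u0 <= 2^-1 by rewrite /u0 ge_min lexx.
have u0K : u0 * (2 * Kt) <= e' by rewrite -ler_pdivlMr ?mulr_gt0 // /u0 ge_min lexx orbT.
clearbody u0.
exists (Num.truncn (Num.max v^-1 ((gamma / (e * u0)) ^+ 2))).+1 => n t x z Nn gt1 gt2 hx.
rewrite le_min => /andP[dx1 dxd] z0.
have nN : Num.max v^-1 ((gamma / (e * u0)) ^+ 2) < n%:R.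
  by apply: lt_le_trans (truncnS_gt _) _; rewrite ler_nat.
move: nN; rewrite gt_max => /andP[nv nu].
have nR : 0 < n%:R :> R by apply: lt_trans nv; rewrite invr_gt0.
have n0 : (0 < n)%N by rewrite -(ltr_nat R).
have [g gE] : exists g, g = gamma ^+ t by eexists.
have gp : 0 < g by rewrite gE exprn_gt0 //; lra_from g1 e'0 Kl0 Kt0.
rewrite exprS -gE in gt1 gt2 *.
have sn0 : 0 < Num.sqrt n%:R :> R by rewrite sqrtr_gt0.
have gu : g^-1 <= u0.
  rewrite -[u0]invrK lef_pV2 ?posrE ?invr_gt0 //.
  have : gamma / (e * u0) <= Num.sqrt n%:R.
    rewrite -[leLHS]gtr0_norm ?divr_gt0 ?mulr_gt0 //; last lra_from g1 Kl0 Kt0 sn0.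
    by rewrite -sqrtr_sqr ler_wsqrtr // ltW.
  rewrite ler_pdivrMr ?mulr_gt0 // => h.
  have h' : gamma <= gamma * (g * u0).
    apply: le_trans h _; have : e * Num.sqrt n%:R * u0 <= gamma * g * u0 by rewrite ler_pM2r.
    by lra_from gt1 gt2 sn0.
  rewrite -[u0^-1]mul1r ler_pdivrMr //.
  by rewrite -(ler_pM2l (_ : 0 < gamma)) ?mulr1 // (lt_trans ltr01).
have gi0 : 0 < g^-1 by rewrite invr_gt0.
have [l lE] : exists l, l = g^-1 by eexists.
rewrite -lE in gu gi0.
have lg : l * g = 1 by rewrite lE mulVf // gt_eqF.
pose V := v + sigma ^+ 2 * (1 - l ^+ 2).
have l1 : l <= 1 by lra_from u00 u02 lE gu gi0.
have l2 : l ^+ 2 <= u0 by rewrite expr2; apply: le_trans gu; apply: ler_piMl (ltW gi0) l1.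
have sl2 : 0 <= sigma ^+ 2 * l ^+ 2 <= sigma ^+ 2 * u0.
  by rewrite mulr_ge0 ?sqr_ge0 //= ler_pM2l.
have VE : v + l ^+ 2 / 4 * ((g ^+ 2 - 1) / (gamma ^+ 2 - 1)) = V.
  rewrite /V sE; have -> : 1 - l ^+ 2 = l ^+ 2 * (g ^+ 2 - 1).
    by rewrite mulrBr -exprMn lg expr1n mulr1.
  have gg : 0 < gamma ^+ 2 - 1 by rewrite subr_gt0 exprn_egt1.
  by field; rewrite gt_eqF.
have V1 : sigma ^+ 2 - V <= sigma ^+ 2 * u0 by rewrite /V mulrBr; lra_from s20 v0 l2 sl2.
have V2 : V - sigma ^+ 2 <= v by rewrite /V mulrBr; lra_from sl2 VE.
have su : sigma ^+ 2 * u0 <= sigma ^+ 2 / 2 by rewrite ler_pM2l.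
have V3 : sigma ^+ 2 / 2 <= V by lra_from V1 V2 su.
have V0 : 0 < V by lra_from s20 dA V3.
clearbody V.
have Vs y : `|heat V y - heat (sigma ^+ 2) y| <= e'.
  have [sV|Vs] := lerP (sigma ^+ 2) V.
    have e0 : 0 <= V - sigma ^+ 2 by lra_from V1 V2 V0 sV.
    have := Ht (sigma ^+ 2) (V - sigma ^+ 2) y s20 e0; rewrite subrKC => /le_trans; apply.
    by apply: le_trans vKt; rewrite ler_pM2l // ler_pM2r ?invr_gt0.
  have e0 : 0 <= sigma ^+ 2 - V by lra_from V1 V2 V0 Vs.
  rewrite distrC; have := Ht V (sigma ^+ 2 - V) y V0 e0; rewrite subrKC => /le_trans; apply.
  apply: le_trans u0K; have -> : u0 * (2 * Kt) = Kt * (2 * u0) by ring.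
  rewrite ler_pM2l // ler_pdivrMr //; apply: le_trans V1 _.
  have : 2 * u0 * (sigma ^+ 2 / 2) <= 2 * u0 * V by rewrite ler_pM2l // mulr_gt0.
  lra_from VE.
have key c : `|iter t (step f n) (fun y => heat v (c - l * deviation n y)) x
    - Phi ((c - d) / sigma)| <= 3 * e'.
  have := HC n t l v c x n0 (ltW nv) (ltW gi0) _ (lexx v) hx.
  rewrite -gE lg VE lexx mul1r => /(_ isT) h.
  have {}h : `|iter t (step f n) (fun y => heat v (c - l * deviation n y)) x
      - heat V (c - deviation n x)| <= e'.
    apply: le_trans h _; apply: le_trans CWe; rewrite -mulrA -[leRHS]mulrA ler_pM2l //.
    rewrite mulrC; apply: ler_pM.
    - rewrite -sE; have : 0 <= n%:R * (x - 2^-1) ^+ 2 by rewrite mulr_ge0 ?sqr_ge0 // ltW.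
      by lra_from sl2 V2 su.
    - rewrite divr_ge0 ?(ltW sn0) // mulr_ge0 ?(ltW gi0) // expr2.
      by rewrite subr_ge0 ler_peMr ?(ltW gp) // gE exprn_ege1 // ltW.
    - rewrite W_E lerD2l; have -> : n%:R * (x - 2^-1) ^+ 2 = `|deviation n x| ^+ 2.
        by rewrite real_normK ?num_real // /deviation exprMn sqr_sqrtr // ltW.
      rewrite lerXn2r // ?nnegrE ?addr_ge0 //.
      have -> : deviation n x = d + (deviation n x - d) by ring.
      by apply: le_trans (ler_normD _ _) _; rewrite lerD2l.
    - rewrite ler_pdivrMr //; apply: le_trans gt1.
      have -> : l * (g ^+ 2 - g) = (l * g) * g - l * g by ring.
      by rewrite lg mul1r; lra_from V2 su V0.
  have h2 := Vs (c - deviation n x).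
  have h3 : `|heat (sigma ^+ 2) (c - deviation n x) - heat (sigma ^+ 2) (c - d)| <= e'.
    apply: le_trans (Hl _ _ _ s20) _; apply: le_trans Kld.
    rewrite sq ler_pM2l // ler_pM2r ?invr_gt0 //.
    have -> : c - deviation n x - (c - d) = - (deviation n x - d) by ring.
    by rewrite normrN.
  rewrite !(heat_sigma2 d sigma0') in h3; rewrite (heat_sigma2 d sigma0') in h2.
  have -> : 3 * e' = e' + e' + e' by ring.
  exact: ler_dist3 h h2 h3.
have shift c c' : `|c - c'| <= del -> `|Phi (c / sigma) - Phi (c' / sigma)| <= e'.
  move=> cc; rewrite -!(heat_sigma2 d sigma0'); apply: le_trans (Hl _ _ _ s20) _; apply: le_trans Kld.
  by rewrite sq ler_pM2l // ler_pM2r ?invr_gt0.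
clear HC Hl Ht HA dA Kld vdel vKt su V1 V2 V3 V0 VE sl2 l2 l1 gt1 gt2 nu nv Vs.
set ind := (fun y => if _ then 1 else 0).
have indE y : ind y = if `|l * deviation n y| <= z then 1 else 0.
  by rewrite /ind [`|l * _|]normrM (gtr0_norm gi0) mulrC lE.
have up : iter t (step f n) ind x <= gauss_window z + eta.
  apply: (@le_trans _ _ (iter t (step f n) (fun y => 1 * heat v (z + del - l * deviation n y) +
     1 * (-1 * heat v (- z - del - l * deviation n y) + 2 * e' * 1)) x)).
    apply: iter_step_le => // [|y hy]; [exact: f01|].
    rewrite indE; set w := l * _; case: ifP => [wz|_].
      move: wz; rewrite ler_norml => /andP[w1 w2].
      have t2 := tail2 (z + del - w) ltac:(lra_from hf sigma0' sigmaE' w2).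
      have t1 := tail1 (- z - del - w) ltac:(lra_from hf sigma0' sigmaE' w1).
      by lra_from hf sigma0' sigmaE' t1 t2.
    by have := @heat_le _ d _ sigma0' v (- z - del - w) (z + del - w) ltac:(lra_from e'0 del0 z0); lra_from e'0 del0 z0.
  rewrite !iter_step_lin iter_step_cst.
  have := key (z + del); have := key (- z - del).
  have := shift (z + del - d) (z - d); have := shift (- z - del - d) (- z - d).
  have -> : z + del - d - (z - d) = del by ring.
  have -> : - z - del - d - (- z - d) = - del by ring.
  rewrite normrN (gtr0_norm del0) lexx => /(_ isT) + /(_ isT).
  rewrite /gauss_window; set a1 := Phi _; set a2 := Phi _; set a3 := Phi _; set a4 := Phi _.
  set b1 := iter _ _ _ _; set b2 := iter _ _ _ _.
  clearbody a1 a2 a3 a4 b1 b2.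
  clear - hf sigma0' sigmaE' e'E; rewrite !ler_norml => /andP[? ?] /andP[? ?] /andP[? ?] /andP[? ?]; lra.
have lo : gauss_window z - eta <= iter t (step f n) ind x.
  apply: (@le_trans _ _ (iter t (step f n) (fun y => 1 * heat v (z - del - l * deviation n y) +
     1 * (-1 * heat v (- z + del - l * deviation n y) + - (2 * e') * 1)) x)); last first.
    apply: iter_step_le => // [|y hy]; [exact: f01|].
    rewrite indE; set w := l * _; case: ifP => [wz|/negbT].
      by have := h0 (- z + del - w); have := h1 (z - del - w); lra_from e'0.
    rewrite -ltNge => wz; have [w0|w0] := lerP 0 w.
      rewrite ger0_norm // in wz.
      by have := tail1 (z - del - w) ltac:(lra_from e'0 wz); have := h0 (- z + del - w); lra_from e'0 wz.
    rewrite ltr0_norm // in wz.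
    by have := tail2 (- z + del - w) ltac:(lra_from e'0 wz); have := h1 (z - del - w); lra_from e'0 wz.
  rewrite !iter_step_lin iter_step_cst.
  have := key (z - del); have := key (- z + del).
  have := shift (z - del - d) (z - d); have := shift (- z + del - d) (- z - d).
  have -> : z - del - d - (z - d) = - del by ring.
  have -> : - z + del - d - (- z - d) = del by ring.
  rewrite normrN (gtr0_norm del0) lexx => /(_ isT) + /(_ isT).
  rewrite /gauss_window; set a1 := Phi _; set a2 := Phi _; set a3 := Phi _; set a4 := Phi _.
  set b1 := iter _ _ _ _; set b2 := iter _ _ _ _.
  clearbody a1 a2 a3 a4 b1 b2.
  clear - hf sigma0' sigmaE' e'E; rewrite !ler_norml => /andP[? ?] /andP[? ?] /andP[? ?] /andP[? ?]; lra.
by rewrite ler_norml; apply/andP; split; lra_from up lo.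
Qed.

End CentralLimitTheorem.

(** * The law of the chain in terms of the transition operator *)

Section ChainLaw.
Variables (R : realType) (f : R -> R) (n : nat) (x0 : R).
Variables (disp : measure_display) (T : measurableType disp) (P : probability T R).
Variable X : nat -> {RV P >-> R}.
Hypothesis hX : binomial_chain f n x0 X.
Hypothesis f01 : forall x : R, 0 <= x <= 1 -> 0 <= f x <= 1.
Hypothesis f0 : f 0 = 0.
Hypothesis fsym : forall x : R, 0 <= x <= 1 -> f (1 - x) = 1 - f x.
Hypothesis n0 : (0 < n)%N.

Let consensus (y : R) := y = n%:R \/ n%:R - y = n%:R.

Definition past (t : nat) (x : nat -> R) : set T :=
  [set w | forall i, (i <= t)%N -> X i w = x i].

Definition open_until (s t : nat) : set T :=
  [set w | forall i, (s <= i <= t)%N -> ~ consensus (X i w)].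

Lemma measurable_state i (A : set R) : measurable A -> measurable [set w | A (X i w)].
Proof. by move=> mA; exact: (measurable_funPTI (X i) mA). Qed.

Lemma measurable_past t x : measurable (past t x).
Proof.
rewrite (_ : past t x = \bigcap_(i in [set i | (i <= t)%N]) [set w | [set x i] (X i w)]) //.
apply: bigcap_measurable; first by exists 0%N.
by move=> i _; exact: measurable_state.
Qed.

Lemma measurable_open_until s t : measurable (open_until s t).
Proof.
rewrite (_ : open_until s t =
   \bigcap_i [set w | (~` [set y | (s <= i <= t)%N /\ consensus y]) (X i w)]).
  apply: bigcapT_measurable => i; apply: measurable_state; apply: measurableC.
  have [st|st] := boolP (s <= i <= t)%N; last first.
    by rewrite (_ : [set y | _] = set0) // -subset0 => y [].
  rewrite (_ : [set y | _] = [set n%:R] `|` [set 0]); first exact: measurableU.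
  apply/seteqP; split => y /=.
    by move=> [_ [|h]]; [left|right; lra].
  by move=> [|] ->; split => //; [left|right; rewrite subr0].
apply/seteqP; split => w /= H.
  by move=> i _ /= [/H].
by move=> i st c; apply: (H i I).
Qed.

Let p (A : set T) : R := fine (P A).

Let pE A : measurable A -> (p A)%:E = P A.
Proof. by move=> mA; rewrite fineK // fin_num_measure. Qed.

Let p_ge0 A : 0 <= p A.
Proof. by rewrite fine_ge0. Qed.

Let p_split A B : measurable A -> measurable B -> p A = p (A `&` B) + p (A `\` B).
Proof.
move=> mA mB; apply/EFin_inj.
have mI := measurableI _ _ mA mB; have mD := measurableD mA mB.
by rewrite EFinD !pE // (measureDI P mA mB) addeC.
Qed.

Let p_le A B : measurable A -> measurable B -> A `<=` B -> p A <= p B.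
Proof. by move=> mA mB AB; rewrite -lee_fin !pE // le_measure ?inE. Qed.

Let before i (N : nat) : set T := [set w | exists2 k, (k < N)%N & X i w = k%:R].

Let measurable_before i N : measurable (before i N).
Proof.
rewrite (_ : before i N = [set w | (\bigcup_(k in [set k | (k < N)%N]) [set k%:R]) (X i w)]) //.
by apply: measurable_state; apply: bigcup_measurable => k _.
Qed.

(** The law of total probability for the first [N] possible values of [X i]. *)
Let total_probability i N A : measurable A ->
  p A = \sum_(k < N) p (A `&` [set w | X i w = k%:R]) + p (A `\` before i N).
Proof.
move=> mA; elim: N => [|N IH].
  rewrite big_ord0 add0r; congr p; apply/seteqP; split => w //=; last by case.
  by move=> Aw; split => // -[].
rewrite big_ord_recr /= -addrA IH; congr (_ + _).
have mk : measurable [set w | [set N%:R] (X i w)] by exact: measurable_state.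
have mb := measurable_before i N.
rewrite (p_split (measurableD mA mb) mk); congr (p _ + p _).
  apply/seteqP; split => w /= [].
    by move=> [Aw _] ->.
  move=> Aw XN; split => //; split => // -[k kN]; rewrite XN => /eqP.
  by rewrite eqr_nat => /eqP E; rewrite E ltnn in kN.
apply/seteqP; split => w /= [].
  move=> [Aw nb] XN; split => // -[k]; rewrite ltnS leq_eqVlt => /orP[/eqP ->//|kN XK].
  by apply: nb; exists k.
move=> Aw nb; split.
  by split => // -[k kN XK]; apply: nb; exists k => //; exact: ltnW.
by move=> XN; apply: nb; exists N.
Qed.

Lemma binomial_probE q k : 0 <= q <= 1 ->
  binomial_prob n q [set k] = (q ^+ k * (1 - q) ^+ (n - k) *+ 'C(n, k))%:E :> \bar R.
Proof.
move=> hq; rewrite /binomial_prob hq esum_set1 //.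
case/andP: hq => q0 q1.
by rewrite lee_fin mulrn_wge0 // mulr_ge0 // exprn_ge0 // subr_ge0.
Qed.

Let past_step t x k : 0 <= x t / n%:R <= 1 ->
  p (past t x `&` [set w | X t.+1 w = k%:R]) =
  p (past t x) * ((f (x t / n%:R)) ^+ k * (1 - f (x t / n%:R)) ^+ (n - k) *+ 'C(n, k)).
Proof.
move=> hx; have [_ /(_ t x k)] := hX.
rewrite binomial_probE; last exact: f01.
move=> h; apply/EFin_inj; rewrite pE; last first.
  apply: measurableI; first exact: measurable_past.
  exact: (@measurable_state t.+1 [set k%:R]).
by rewrite EFinM pE; [exact: h|exact: measurable_past].
Qed.

(** The chain never leaves [{0, .., n}] after its first step. *)
Let past_rest t x : 0 <= x t / n%:R <= 1 ->
  p (past t x `\` before t.+1 n.+1) = 0.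
Proof.
move=> hx; have := @total_probability t.+1 n.+1 (past t x) (measurable_past t x).
under eq_bigr => k _ do rewrite past_step //.
rewrite -mulr_sumr.
have -> : \sum_(k < n.+1) (f (x t / n%:R) ^+ k * (1 - f (x t / n%:R)) ^+ (n - k) *+ 'C(n, k)) = 1.
  rewrite -[RHS](binE_cst (f (x t / n%:R)) n 1) binE_sum.
  by apply: eq_bigr => k _; rewrite mulr1.
by lra.
Qed.

Let consensusE x : 0 <= x / n%:R <= 1 -> unresolved (x / n%:R) = if `[< consensus x >] then 0 else 1.
Proof.
have nR : 0 < n%:R :> R by rewrite ltr0n.
move=> /andP[xge x1]; rewrite /unresolved; case: asboolP => c.
  case: c => c; first by rewrite c divff ?gt_eqF // ltxx andbF.
  have -> : x = 0 by lra.
  by rewrite mul0r ltxx.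
have -> : 0 < x / n%:R.
  rewrite lt_neqAle xge andbT eq_sym mulf_eq0 invr_eq0 (gt_eqF nR) orbF.
  by apply/eqP => xz; apply: c; right; rewrite xz subr0.
have -> // : x / n%:R < 1.
rewrite lt_neqAle x1 andbT; apply/eqP => xz; apply: c; left.
by rewrite -[x](@divfK _ n%:R) ?gt_eqF // xz mul1r.
Qed.

(** The Markov property: the conditional probability that no consensus is
    reached during the next [j] rounds is an iterate of the transition operator. *)
Lemma open_until_past j t x : 0 <= x t / n%:R <= 1 ->
  p (past t x `&` open_until t (t + j)) =
  p (past t x) * iter j (step f n) unresolved (x t / n%:R).
Proof.
elim: j t x => [|j IH] t x hx.
  rewrite addn0 /= consensusE //; case: asboolP => c.
    rewrite (_ : _ `&` _ = set0) ?mulr0 /p ?measure0 // -subset0 => w [/= Ew Uw].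
    by apply: (Uw t); rewrite ?leqnn // (Ew t).
  rewrite mulr1; congr p; apply/seteqP; split => w; first by case.
  move=> Ew; split => // i; rewrite -eqn_leq => /eqP <-.
  by rewrite (Ew t).
have mE := measurable_past t x.
have [c|c] := pselect (consensus (x t)).
  have -> : iter j.+1 (step f n) unresolved (x t / n%:R) = 0.
    apply/eqP; rewrite eq_le iter_unresolved_ge0 // andbT.
    apply: le_trans (iter_unresolved_noninc f01 f0 fsym hx n0 (leq0n _)) _.
    by rewrite /= consensusE //; case: asboolP.
  rewrite (_ : _ `&` _ = set0) ?mulr0 /p ?measure0 // -subset0 => w [/= Ew Uw].
  by apply: (Uw t); rewrite ?leqnn ?leq_addr // (Ew t).
have mI s1 t1 : measurable (past t x `&` open_until s1 t1).
  by apply: measurableI => //; exact: measurable_open_until.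
rewrite (@total_probability t.+1 n.+1) //.
have -> : p ((past t x `&` open_until t (t + j.+1)) `\` before t.+1 n.+1) = 0.
  apply/eqP; rewrite eq_le p_ge0 andbT -(past_rest hx); apply: p_le.
  - exact: measurableD.
  - exact: measurableD.
  - by move=> w [[]].
rewrite addr0 iterS /step binE_sum mulr_sumr; apply: eq_bigr => k _.
pose x' i := if i == t.+1 then k%:R else x i.
have kn : (k <= n)%N by rewrite -ltnS.
have hx' : 0 <= x' t.+1 / n%:R <= 1 by rewrite /x' eqxx; exact: frac01.
have pastE : past t x `&` [set w | X t.+1 w = k%:R] = past t.+1 x'.
  apply/seteqP; split => w /=.
    move=> [Ew Xk] i; rewrite leq_eqVlt => /orP[/eqP ->|it]; first by rewrite /x' eqxx.
    by rewrite /x' ltn_eqF // Ew.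
  move=> Ew; split; last by rewrite (Ew t.+1) // /x' eqxx.
  by move=> i it; rewrite (Ew i) ?(leqW it) // /x' ltn_eqF.
have -> : (past t x `&` open_until t (t + j.+1)) `&` [set w | X t.+1 w = k%:R] =
    past t.+1 x' `&` open_until t.+1 (t.+1 + j).
  rewrite -pastE setIAC; apply/seteqP; split => w [Ew Uw]; split => // i.
    by move=> /andP[ti ij]; apply: Uw; rewrite (ltnW ti) addnS.
  rewrite leq_eqVlt => /andP[/orP[/eqP <- _|ti ij]]; first by case: Ew => /(_ t (leqnn _)) ->.
  by apply: Uw; rewrite ti addSnnS.
rewrite IH // -pastE past_step // -mulrA; congr (_ * (_ * _)).
by rewrite /x' eqxx.
Qed.

Lemma open_until_prob j : 0 <= x0 <= n%:R ->
  P (open_until 0 j) = (iter j (step f n) unresolved (x0 / n%:R))%:E.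
Proof.
move=> hx0; have nR : 0 < n%:R :> R by rewrite ltr0n.
have hx : 0 <= x0 / n%:R <= 1.
  by rewrite divr_ge0 ?(ltW nR) ?ler_pdivrMr ?mul1r; case/andP: hx0.
have := @open_until_past j 0 (fun=> x0) hx.
have -> : past 0 (fun=> x0) = setT.
  rewrite -subTset => w _ i; rewrite leqn0 => /eqP ->.
  by case: hX.
rewrite setTI /p probability_setT mul1r => <-; rewrite fineK //.
by apply: fin_num_measure; exact: measurable_open_until.
Qed.

Lemma runtime_gtE (j : nat) :
  [set w | ((j.+1%:R : R)%:E <= runtime n (fun i => X i : T -> R) w)%E] = open_until 0 j.
Proof.
apply/seteqP; split => w /=.
  move=> h i /andP[_ ij] c.
  have : (runtime n (fun i => X i : T -> R) w <= (i%:R : R)%:E)%E.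
    by apply: ereal_inf_lbound; exists i.
  by move=> /(le_trans h); rewrite lee_fin ler_nat ltnNge ij.
move=> H; apply: le_ereal_inf_tmp => _ [i c <-].
rewrite lee_fin ler_nat ltnNge; apply/negP => ij.
by apply: (H i).
Qed.

Lemma runtime_ge0E (s : int) : s <= 0 ->
  [set w | ((s%:~R : R)%:E <= runtime n (fun i => X i : T -> R) w)%E] = setT.
Proof.
move=> s0; rewrite -subTset => w _ /=; apply: le_ereal_inf_tmp => _ [i c <-].
rewrite lee_fin; apply: (@le_trans _ _ 0); last by rewrite ler0n.
by rewrite lerz0.
Qed.

End ChainLaw.

(** * Combining the two phases *)

#[local] Opaque abel abel_half.

Section GaussWindow.
Variables (R : realType) (d sigma : R).
Hypothesis sigma0' : 0 < sigma.

Local Notation window := (gauss_window d sigma).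
Local Notation Phi := (gauss_cdf d sigma).

Lemma window_le z z' : z <= z' -> window z <= window z'.
Proof.
move=> zz; have s0 := sigma0'.
have si : 0 <= sigma^-1 by rewrite invr_ge0 ltW.
by apply: lerB; apply: (Phi_le d sigma0'); apply: ler_wpM2r => //; lra.
Qed.

Lemma window_le1 z : window z <= 1.
Proof.
have := Phi_le1 d sigma ((z - d) / sigma); have := Phi_ge0 d sigma ((- z - d) / sigma).
by rewrite /gauss_window; lra.
Qed.

Lemma window_lip : exists2 K : R, 0 < K & forall z z', z <= z' ->
  window z' <= window z + K * (z' - z).
Proof.
have [K K0 HK] := Phi_lip d sigma0'; have s0 := sigma0'.
exists (2 * (K / sigma)) => [|z z' zz]; first by rewrite mulr_gt0 // divr_gt0.
have h1 := HK ((z - d) / sigma) ((z' - d) / sigma).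
have h2 := HK ((- z' - d) / sigma) ((- z - d) / sigma).
have E1 : `|(z' - d) / sigma - (z - d) / sigma| = (z' - z) / sigma.
  rewrite -mulrBl normrM normfV (gtr0_norm s0); congr (_ / _).
  by rewrite ger0_norm; lra_from zz.
have E2 : `|(- z - d) / sigma - (- z' - d) / sigma| = (z' - z) / sigma.
  rewrite -mulrBl normrM normfV (gtr0_norm s0); congr (_ / _).
  by rewrite ger0_norm; lra_from zz.
rewrite E1 in h1; rewrite E2 in h2.
move: h1 h2; rewrite /gauss_window !ler_norml => /andP[_ h1] /andP[_ h2].
by have -> : 2 * (K / sigma) * (z' - z) = K * ((z' - z) / sigma) + K * ((z' - z) / sigma); [ring|lra].
Qed.

Lemma window_tails (e : R) : 0 < e -> exists2 M : R, 0 < M &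
  1 - e <= window M /\ window M^-1 <= e.
Proof.
move=> e0; have e2 : 0 < e / 2 by rewrite divr_gt0.
have s0 := sigma0'.
have [A A0 HA] := Phi_tails d sigma0' e2; have [K K0 HK] := window_lip.
pose M := sigma * A + `|d| + K / e.
have Ke : 0 < K / e by rewrite divr_gt0.
have sA : 0 < sigma * A by rewrite mulr_gt0.
have d0 := normr_ge0 d.
have M0 : 0 < M by rewrite /M; lra.
have MK : K * M^-1 <= e.
  rewrite ler_pdivrMr //; apply: (@le_trans _ _ (e * (K / e))).
    by rewrite mulrCA divff ?mulr1 // gt_eqF.
  by rewrite ler_pM2l // /M; lra.
exists M => //; split; last first.
  have w0 : window 0 = 0 by rewrite /gauss_window oppr0 subrr.
  have Mi : 0 <= M^-1 by rewrite invr_ge0 ltW.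
  by have := HK 0 M^-1 Mi; rewrite w0 add0r subr0 => /le_trans; apply.
have h1 : A <= (M - d) / sigma.
  by rewrite ler_pdivlMr // mulrC /M; have := ler_norm d; lra.
have h2 : (- M - d) / sigma <= - A.
  rewrite ler_pdivrMr // mulNr mulrC /M; have := ler_norm (- d); rewrite normrN; lra.
have [_ p1] := HA _ h1; have [p2 _] := HA _ (lexx A).
have := Phi_le d sigma0' h2; rewrite /gauss_window; lra_from p1 p2.
Qed.

Lemma window_scale (e : R) : 0 < e -> exists2 th : R, 1 < th &
  forall z, 0 < z -> window (th * z) <= window z + e.
Proof.
move=> e0; have [M M0 [HM _]] := window_tails e0; have [K K0 HK] := window_lip.
have KM : 0 < K * M by rewrite mulr_gt0.
exists (1 + e / (K * M)) => [|z z0]; first by rewrite ltrDl divr_gt0.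
have [Mz|zM] := lerP M z.
  by have := window_le Mz; have := window_le1 ((1 + e / (K * M)) * z); lra.
have ee : 0 < e / (K * M) by rewrite divr_gt0.
apply: le_trans (HK z _ _) _; first by rewrite ler_peMl ?(ltW z0) //; lra.
have -> : (1 + e / (K * M)) * z - z = e / (K * M) * z by ring.
have -> : K * (e / (K * M) * z) = e * (z / M) by field; rewrite !gt_eqF.
by rewrite lerD2l ler_piMr ?(ltW e0) // ler_pdivrMr // mul1r ltW.
Qed.

End GaussWindow.

#[local] Opaque gauss_window.

(** The place where a nonincreasing function [H] passes the level [q]. The value
    at [Y] is left open: for the limit law this is a null event. *)
Definition is_threshold (R : realType) (H : R -> R) (q Y : R) : Prop :=
  [/\ 0 < Y, forall y, 0 < y < Y -> q <= H y & forall y, Y < y -> H y < q].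

Lemma threshold_le (R : realType) (H : R -> R) (q q' Y Y' : R) :
  is_threshold H q Y -> is_threshold H q' Y' -> q <= q' -> Y' <= Y.
Proof.
move=> [Y0 _ h2] [Y0' h1' _] qq; rewrite leNgt; apply/negP => YY.
have := h1' ((Y + Y') / 2) ltac:(lra); have := h2 ((Y + Y') / 2) ltac:(lra).
by move=> h3 h4; have := lt_le_trans h3 (le_trans qq h4); rewrite ltxx.
Qed.

Lemma threshold_shift (R : realType) (H : R -> R) (g t q Y : R) : 0 < g ->
  (forall y, 0 < y -> H (y / g) = H y + t) ->
  is_threshold H q Y -> is_threshold H (q - t) (g * Y).
Proof.
move=> g0 HE [Y0 thr1 thr2]; split; first by rewrite mulr_gt0.
  move=> y /andP[yp yY]; rewrite lerBlDr -HE //; apply: thr1.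
  by rewrite divr_gt0 //= ltr_pdivrMr // mulrC.
move=> y yY; have yp : 0 < y by apply: lt_trans yY; rewrite mulr_gt0.
by rewrite ltrBrDr -HE //; apply: thr2; rewrite ltr_pdivlMr // mulrC.
Qed.

Section Assembly.
Variables (R : realType) (f : R -> R) (m : nat) (beta gamma : R).
Hypothesis hf : majority_type f m beta gamma.
Variables (d sigma : R).
Hypothesis sigma0' : 0 < sigma.
Hypothesis sigmaE' : sigma ^+ 2 = (4 * (gamma ^+ 2 - 1))^-1.

Local Notation M := (m%:R : R).
Local Notation A n := (step f n).
Local Notation F := (abel f m).
Local Notation H := (abel_half f m gamma).
Local Notation window := (gauss_window d sigma).
Local Notation f01 := (maj_f_range hf).

Definition window_ind n (g z y : R) : R := if `|deviation n y| / g <= z then 1 else 0.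

(** The last [k] rounds, started at distance [g |zeta| / sqrt n] from [1 / 2]:
    whether they end in consensus is decided by comparing [|zeta|] with the
    threshold [z], up to a factor [th ^ 2] and up to the extreme values of
    [|zeta|]. *)
Lemma end_game n k (th g y0 w al Mx eta z : R) :
  (0 < n)%N -> 1 < th -> 0 < g -> 0 < y0 <= 4^-1 -> 0 < al <= 4^-1 -> 0 < Mx ->
  0 < eta -> 0 < z ->
  g * Mx <= y0 * Num.sqrt n%:R -> al * Num.sqrt n%:R <= g / Mx ->
  (forall y, al <= y <= y0 -> H (th * y) + w <= F (2^-1 - y) /\ F (2^-1 - y) + w <= H (y / th)) ->
  (forall x, al <= x <= 2^-1 - al ->
    (k%:R + w <= F x + log M (ln n%:R) -> 1 - eta <= iter k (A n) unresolved x) /\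
    (F x + log M (ln n%:R) + w <= k%:R -> iter k (A n) unresolved x <= eta)) ->
  is_threshold H (k%:R - log M (ln n%:R)) (g / Num.sqrt n%:R * z) ->
  forall x, 0 <= x <= 1 ->
    window_ind n g (z / th ^+ 2) x - eta - window_ind n g Mx^-1 x
      - (1 - window_ind n g Mx x) <= iter k (A n) unresolved x /\
    iter k (A n) unresolved x <= window_ind n g (th ^+ 2 * z) x + eta
      + window_ind n g Mx^-1 x + (1 - window_ind n g Mx x).
Proof.
move=> n0 th1 g0 hy0 hal Mx0 eta0 z0 gM aM gap track [_ thr1 thr2] x hx.
have it0 := iter_unresolved_ge0 n f01 k hx; have it1 := iter_unresolved_le1 n f01 k hx.
have sn : 0 < Num.sqrt n%:R :> R by rewrite sqrtr_gt0 ltr0n.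
have [s sE] : exists s : R, s = Num.sqrt n%:R by eexists.
rewrite -!sE in sn gM aM thr1 thr2.
have [zeta zE] : exists zeta, zeta = `|deviation n x| / g by eexists.
rewrite /window_ind -zE.
have ze0 : 0 <= zeta by rewrite zE divr_ge0 // ltW.
have ind01 (b : bool) : exists v : R, [/\ (if b then 1 else 0) = v, 0 <= v <= 1,
    b -> v = 1 & ~~ b -> v = 0].
  by exists (if b then 1 else 0); case: b; split=> //; rewrite lexx ler01.
have [v1 [-> i1 v1T v1F]] := ind01 (zeta <= z / th ^+ 2).
have [v2 [-> i2 v2T _]] := ind01 (zeta <= Mx^-1).
have [v3 [-> i3 _ v3F]] := ind01 (zeta <= Mx).
have [v4 [-> i4 v4T v4F]] := ind01 (zeta <= th ^+ 2 * z).
have [zlo|zlo] := lerP zeta Mx^-1.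
  by rewrite (v2T zlo); clear - hf sigma0' sigmaE' i1 i3 i4 it0 it1 eta0; split; lra.
have [zhi|zhi] := lerP zeta Mx; last first.
  rewrite v3F -?ltNge //; clear - hf sigma0' sigmaE' i1 i2 i4 it0 it1 eta0; split; lra.
clear ind01.
have [y yE] : exists y, y = g * zeta / s by eexists.
have dev : `|x - 2^-1| = y.
  rewrite yE zE mulrCA divff ?gt_eqF // mulr1 /deviation -sE normrM (gtr0_norm sn).
  by rewrite mulrC mulKf // gt_eqF.
have Mi0 : 0 < Mx^-1 by rewrite invr_gt0.
have zp : 0 < zeta by apply: lt_trans zlo.
have gz : 0 < g * zeta by rewrite mulr_gt0.
have y0' : 0 < y by rewrite yE divr_gt0.
have yhi : y <= y0 by rewrite yE ler_pdivrMr //; apply: le_trans gM; rewrite ler_pM2l.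
have ylo : al <= y.
  by rewrite yE ler_pdivlMr //; apply: le_trans aM _; rewrite ler_pM2l // ltW.
have [gap1 gap2] := gap y ltac:(by rewrite ylo).
have hx' : al <= 2^-1 - y <= 2^-1 - al by clear - hf sigma0' sigmaE' ylo yhi hy0 hal; lra.
have itE : iter k (A n) unresolved x = iter k (A n) unresolved (2^-1 - y).
  have [xh|xh] := lerP 0 (x - 2^-1).
    rewrite -(iter_unresolved_compl (maj_symE hf) k hx n0); congr (iter _ _ _ _).
    by rewrite -dev ger0_norm //; clear - hf sigma0' sigmaE'; lra.
  by congr (iter _ _ _ _); rewrite -dev ltr0_norm //; clear - hf sigma0' sigmaE'; lra.
have [t1 t2] := track _ hx'.
rewrite itE in it0 it1 *.
have th0 : 0 < th by clear - hf sigma0' sigmaE' th1; lra.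
have th20 : 0 < th ^+ 2 by rewrite exprn_gt0.
have ezs u : 0 < u -> g / s * (u * zeta) = u * y.
  by move=> _; rewrite yE; ring.
have lo : zeta <= z / th ^+ 2 -> 1 - eta <= iter k (A n) unresolved (2^-1 - y).
  rewrite ler_pdivlMr // => zz; apply: t1.
  have hz : th * y < g / s * z.
    rewrite -(ezs _ th0) ltr_pM2l ?divr_gt0 //.
    by apply: lt_le_trans zz; rewrite mulrC expr2 mulrA ltr_pMr // mulr_gt0.
  have := thr1 (th * y) ltac:(by rewrite hz mulr_gt0).
  by clear - hf sigma0' sigmaE' gap1; lra.
have hi : th ^+ 2 * z < zeta -> iter k (A n) unresolved (2^-1 - y) <= eta.
  move=> zz; apply: t2.
  have hz : g / s * z < y / th.
    rewrite [y / th]mulrC -ezs ?invr_gt0 // ltr_pM2l ?divr_gt0 //.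
    rewrite [_ * zeta]mulrC ltr_pdivlMr //; apply: le_lt_trans zz.
    by rewrite mulrC expr2 -mulrA ler_peMl // ?mulr_ge0 ?ltW.
  have := thr2 _ hz.
  by clear - hf sigma0' sigmaE' gap2; lra.
split.
  have [b1T|b1F] := boolP (zeta <= z / th ^+ 2).
    by have := lo b1T; clear - hf sigma0' sigmaE' i1 i2 i3; lra.
  by rewrite v1F //; clear - hf sigma0' sigmaE' i2 i3 it0 eta0; lra.
have [b4T|b4F] := lerP zeta (th ^+ 2 * z).
  by rewrite v4T //; clear - hf sigma0' sigmaE' i2 i3 it1 eta0; lra.
by have := hi b4F; clear - hf sigma0' sigmaE' i2 i3 i4; lra.
Qed.

Lemma gamma_scale (r : R) : 1 <= r -> exists t : nat, gamma ^+ t <= r /\ r <= gamma ^+ t.+1.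
Proof.
move=> r1; have g1 := maj_gamma hf; have r0 : 0 < r by lra.
have [a Ha] := @gamma_small _ _ _ _ _ hf r 2^-1 r0 ltac:(lra).
have ga : r < gamma ^+ a.
  have g0 := gammaX_gt0 hf a.
  by move: Ha; rewrite ler_pdivrMr // => Ha; lra.
have ex : exists a, r < gamma ^+ a by exists a.
case: (ex_minnP ex) => [[|t]] h hmin; first by rewrite expr0 in h; lra.
exists t; split; last exact: ltW.
by rewrite leNgt; apply/negP => /hmin; rewrite ltnn.
Qed.


Lemma large_log (c e : R) : 0 < e -> exists N : nat, forall n : nat, (N <= n)%N ->
  [/\ (0 < n)%N, 1 <= e * Num.sqrt n%:R & c <= log M (ln n%:R)].
Proof.
move=> e0; have lM := maj_lnM hf.
pose B := e^-1 ^+ 2 + expR (expR (c * ln M)).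
have B0 : 0 < B by rewrite ltr_wpDl ?expR_gt0 // sqr_ge0.
exists (Num.truncn B).+1 => n nN.
have nB : B <= n%:R.
  apply: ltW; apply: lt_le_trans (truncnS_gt B) _; by rewrite ler_nat.
have n0 : (0 : R) < n%:R by apply: lt_le_trans nB.
have E0 := expR_gt0 (expR (c * ln M)).
have S0 : 0 <= e^-1 ^+ 2 :> R by exact: sqr_ge0.
split; first by rewrite -(ltr0n R).
  rewrite mulrC -ler_pdivrMr // mul1r.
  rewrite -(ger0_norm (_ : 0 <= e^-1)) ?invr_ge0 ?(ltW e0) // -sqrtr_sqr ler_wsqrtr //.
  by apply: le_trans nB; rewrite /B lerDl ltW.
rewrite /log ler_pdivlMr // -ler_expR lnK ?posrE.
  by rewrite -ler_expR [leRHS]lnK ?posrE //; apply: le_trans nB; rewrite /B lerDr.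
have h : expR (expR (c * ln M)) <= n%:R by apply: le_trans nB; rewrite /B lerDr.
apply: ln_gt0; apply: lt_le_trans h.
by rewrite expR_gt1 expR_gt0.
Qed.

Lemma iter_step_error n j (s c : R) phi psi chi x :
  iter j (A n) (fun y => phi y + s * (c + psi y + (1 - chi y))) x =
  iter j (A n) phi x + s * (c + iter j (A n) psi x + (1 - iter j (A n) chi x)).
Proof.
have -> : (fun y => phi y + s * (c + psi y + (1 - chi y))) =
    (fun y => 1 * phi y + s * (1 * (c + 1) + 1 * (1 * psi y + (-1) * chi y))).
  by apply/funext => y; ring.
by rewrite !iter_step_lin iter_step_cst; ring.
Qed.

(** The first [t] rounds, with [gamma ^ t] about [e sqrt n], are described by the
    central limit theorem and the remaining ones by [end_game]. For [T < t] the
    threshold exceeds that of time [t], whose Gaussian mass is already close to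
    [1], and the probability of being unresolved is nonincreasing in time. *)
Theorem unresolved_asymptotic (eta : R) : 0 < eta ->
  exists2 rho : R, 0 < rho & exists N : nat, forall n (T : nat) (x Y : R), (N <= n)%N ->
    0 <= x <= 1 -> `|deviation n x - d| <= rho ->
    is_threshold H (T%:R - log M (ln n%:R)) Y ->
    `|iter T (A n) unresolved x - window (Num.sqrt n%:R * Y)| <= eta.
Proof.
move=> eta0; have g1 := maj_gamma hf.
have [eta1 eta1E] : exists eta1, eta1 = eta / 10 by eexists.
have eta10 : 0 < eta1 by rewrite eta1E divr_gt0.
have [Mx Mx0 [Mhi Mlo]] := window_tails d sigma0' eta10.
have [th th1 Hth] := window_scale d sigma0' eta10.
have [y0 hy0 Hgap] := abel_half_gap hf th1.
have [e0 [rho [e00 rho0 Hclt]]] := clt_indicator hf d sigma0' sigmaE' eta10.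
have yM : 0 < y0 / Mx by rewrite divr_gt0 //; case/andP: hy0.
have [e [ep ee0 eyM]] : exists e, [/\ 0 < e, e <= e0 & e <= y0 / Mx].
  by exists (Num.min e0 (y0 / Mx)); rewrite lt_min e00 yM !ge_min !lexx orbT.
have gM0 : 0 < gamma * Mx by rewrite mulr_gt0 //; lra.
have egM : 0 < e / (gamma * Mx) by rewrite divr_gt0.
have [al [al0 ale al4]] : exists al, [/\ 0 < al, al <= e / (gamma * Mx) & al <= 4^-1].
  exists (Num.min (e / (gamma * Mx)) 4^-1); rewrite lt_min egM !ge_min !lexx orbT.
  by rewrite invr_gt0 ltr0n.
have [w w0 gap] := Hgap _ al0.
have al2 : 0 < al < 2^-1 by rewrite al0 (le_lt_trans al4) //; lra.
have [N1 track] := chain_tracking hf al2 w0 eta10.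
have [N2 clt] := Hclt e ltac:(by rewrite ep).
have [N3 large] := large_log (- H y0) ep.
exists rho => //; exists (maxn N1 (maxn N2 N3)) => n T x Y.
rewrite !geq_max => /andP[n1 /andP[n2 n3]] hx dx thrY.
have [n0 es ell] := large n n3.
have sn : 0 < Num.sqrt n%:R :> R by rewrite sqrtr_gt0 ltr0n.
have [t [t1 t2]] := gamma_scale es.
have g0 := gammaX_gt0 hf t.
have th0 : 0 < th by lra_from Mlo th1 rho0.
have th20 : 0 < th ^+ 2 by rewrite exprn_gt0.
have {}clt z : 0 <= z ->
    `|iter t (A n) (window_ind n (gamma ^+ t) z) x - window z| <= eta1.
  exact: clt n t x z n2 t1 t2 hx dx.
have gM : gamma ^+ t * Mx <= y0 * Num.sqrt n%:R.
  apply: (@le_trans _ _ (e * Num.sqrt n%:R * Mx)); first by rewrite ler_pM2r.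
  by rewrite mulrAC ler_pM2r // -ler_pdivlMr.
have aM : al * Num.sqrt n%:R <= gamma ^+ t / Mx.
  apply: (@le_trans _ _ (e / (gamma * Mx) * Num.sqrt n%:R)); first by rewrite ler_pM2r.
  have -> : gamma ^+ t / Mx = gamma ^+ t.+1 / (gamma * Mx).
    by rewrite exprS -mulf_div divff ?mul1r // gt_eqF // (lt_trans ltr01).
  by rewrite mulrAC ler_pM2r ?invr_gt0.
have late T' Y' : (t <= T')%N -> is_threshold H (T'%:R - log M (ln n%:R)) Y' ->
    `|iter T' (A n) unresolved x - window (Num.sqrt n%:R * Y')| <= 8 * eta1.
  move=> tT thrY'; have Y0 : 0 < Y' by case: thrY'.
  have [z zE] : exists z, z = Num.sqrt n%:R * Y' by eexists.
  have z0 : 0 < z by rewrite zE mulr_gt0.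
  have thr : is_threshold H ((T' - t)%:R - log M (ln n%:R))
      (gamma ^+ t / Num.sqrt n%:R * z).
    have -> : gamma ^+ t / Num.sqrt n%:R * z = gamma ^+ t * Y'.
      by rewrite zE mulrA divfK // gt_eqF.
    have -> : (T' - t)%:R - log M (ln n%:R) = T'%:R - log M (ln n%:R) - t%:R.
      by rewrite natrB // addrAC.
    by apply: (threshold_shift g0 _ thrY') => y yp; exact: (abel_half_divX hf t yp).
  have track' : forall u, al <= u <= 2^-1 - al ->
      ((T' - t)%:R + w <= F u + log M (ln n%:R) ->
         1 - eta1 <= iter (T' - t) (A n) unresolved u) /\
      (F u + log M (ln n%:R) + w <= (T' - t)%:R -> iter (T' - t) (A n) unresolved u <= eta1).
    by move=> u hu; exact: track.
  have al40 : 0 < al <= 4^-1 by rewrite al0.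
  have ends := end_game n0 th1 g0 hy0 al40 Mx0 eta10 z0 gM aM gap track' thr.
  rewrite -zE -{1}(subnKC tT) iterD.
  have lo : iter t (A n) (fun y => window_ind n (gamma ^+ t) (z / th ^+ 2) y +
      (-1) * (eta1 + window_ind n (gamma ^+ t) Mx^-1 y + (1 - window_ind n (gamma ^+ t) Mx y))) x
      <= iter t (A n) (iter (T' - t) (A n) unresolved) x.
    apply: iter_step_le => // [|y hy]; first exact: f01.
    have [h _] := ends y hy; apply: le_trans h; rewrite le_eqVlt; apply/orP; left; apply/eqP; ring.
  have hi : iter t (A n) (iter (T' - t) (A n) unresolved) x <=
      iter t (A n) (fun y => window_ind n (gamma ^+ t) (th ^+ 2 * z) y +
      1 * (eta1 + window_ind n (gamma ^+ t) Mx^-1 y + (1 - window_ind n (gamma ^+ t) Mx y))) x.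
    apply: iter_step_le => // [|y hy]; first exact: f01.
    have [_ h] := ends y hy; apply: le_trans h _; rewrite le_eqVlt; apply/orP; left; apply/eqP; ring.
  rewrite !iter_step_error in lo hi.
  have c1 := clt (z / th ^+ 2) (divr_ge0 (ltW z0) (ltW th20)).
  have c2 := clt (th ^+ 2 * z) (mulr_ge0 (ltW th20) (ltW z0)).
  have c3 := clt Mx ltac:(exact: ltW).
  have c4 := clt Mx^-1 ltac:(rewrite invr_ge0; exact: ltW).
  have s1 := Hth (z / th ^+ 2) ltac:(by rewrite divr_gt0).
  have s2 := Hth (th * (z / th ^+ 2)) ltac:(by rewrite mulr_gt0 ?divr_gt0).
  have E2 : th * (th * (z / th ^+ 2)) = z by field; rewrite gt_eqF.
  rewrite E2 in s2.
  have s3 := Hth z z0.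
  have s4 := Hth (th * z) ltac:(by rewrite mulr_gt0).
  have E4 : th * (th * z) = th ^+ 2 * z by ring.
  rewrite E4 in s4.
  move: lo hi c1 c2 c3 c4 s1 s2 s3 s4 Mhi Mlo.
  clear - hf sigma0' sigmaE' eta10.
  move: (iter t _ _ x) (iter t _ _ x) (iter t _ _ x) (iter t _ _ x)
    (iter t _ (iter _ _ _) x) => i1 i2 i3 i4 it.
  move: (window _) (window _) (window _) (window _) (window _) (window _) (window _).
  move=> w1 w2 w3 w4 w5 w6 w7 lo hi; rewrite !ler_norml => c1 c2 c3 c4 s1 s2 s3 s4 h1 h2.
  by apply/andP; split; lra.
(* deadlines after and before the end of the first phase *)
have [tT|Tt] := leqP t T.
  by apply: le_trans (late _ _ tT thrY) _; rewrite eta1E; lra_from eta1E eta10 Mlo.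
have [Y' Y0' [thr1' thr2']] := abel_half_threshold hf (t%:R - log M (ln n%:R)).
have thrY' : is_threshold H (t%:R - log M (ln n%:R)) Y' by split.
have YY : Y' <= Y.
  apply: (threshold_le thrY thrY'); rewrite lerD2r ler_nat; exact: ltnW.
have := late t Y' (leqnn t) thrY'; rewrite ler_norml => /andP[hlo _].
have MY : Mx <= Num.sqrt n%:R * Y'.
  rewrite leNgt; apply/negP; rewrite mulrC -ltr_pdivlMr // => /thr2'.
  have u0 : 0 < gamma ^+ t * (Mx / Num.sqrt n%:R) by rewrite mulr_gt0 // divr_gt0.
  have := abel_half_divX hf t u0; rewrite mulrAC divff ?gt_eqF // mul1r => ->.
  have : H y0 <= H (gamma ^+ t * (Mx / Num.sqrt n%:R)).
    by apply: (abel_half_le hf u0); rewrite mulrA ler_pdivrMr.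
  move: ell; clear - hf sigma0' sigmaE'.
  by move: (H y0) (H _) (log _ _) (t%:R) => a b c u; lra.
have m1 := iter_unresolved_noninc f01 (maj0 hf) (maj_symE hf) hx n0 (ltnW Tt).
have m2 := iter_unresolved_le1 n f01 T hx.
have m3 := window_le d sigma0' MY.
have m4 : window (Num.sqrt n%:R * Y') <= window (Num.sqrt n%:R * Y).
  by apply: window_le => //; rewrite ler_pM2l.
have m5 := window_le1 d sigma (Num.sqrt n%:R * Y).
rewrite ler_norml; move: m1 m2 m3 m4 m5 hlo Mhi; clear - hf sigma0' sigmaE' eta1E.
move: (window _) (window _) (window _) (iter _ _ _ _) (iter _ _ _ _) => w1 w2 w3 i1 i2.
by move=> m1 m2 m3 m4 m5 hlo Mhi; apply/andP; split; lra.
Qed.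

End Assembly.

(** * The limiting random variable and the theorem *)

Section LimitLaw.
Variables (R : realType) (f : R -> R) (m : nat) (beta gamma : R).
Hypothesis hf : majority_type f m beta gamma.
Variables (d sigma : R).

Local Notation H := (abel_half f m gamma).
Local Notation mu := (normal_prob d sigma).

Lemma normal_prob_countable (F : set R) : countable F -> measurable F /\ mu F = 0%E.
Proof.
move=> cF; have mF : measurable F by apply: countable_measurable.
split=> //; have /null_content_dominatesP := @normal_prob_dominates R d sigma.
by apply=> //; exact: countable_lebesgue_measure0.
Qed.

(** Countable sets are measurable and null. *)
Lemma normal_prob_eq (A B F : set R) : countable F -> measurable B ->
  A `\` F = B `\` F -> measurable A /\ mu A = mu B.
Proof.
move=> cF mB AB; have [mF F0] := normal_prob_countable cF.
have [mAF AF0] : measurable (A `&` F) /\ mu (A `&` F) = 0%E.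
  by apply: normal_prob_countable; apply: sub_countable cF; apply: subset_card_le => x [].
have [mBF BF0] : measurable (B `&` F) /\ mu (B `&` F) = 0%E.
  by apply: normal_prob_countable; apply: sub_countable cF; apply: subset_card_le => x [].
have mA : measurable A.
  by rewrite -(setUIDK A F) AB; apply: measurableU => //; exact: measurableD.
split=> //; rewrite (measureDI (normal_prob d sigma) mA mF) (measureDI (normal_prob d sigma) mB mF) AB.
by rewrite [X in (_ + X = _)%E]AF0 [X in (_ = _ + X)%E]BF0.
Qed.

#[local] Transparent gauss_cdf gauss_window.

Lemma normal_prob_window (z : R) : 0 < sigma -> 0 <= z ->
  fine (mu `]- z, z]) = gauss_window d sigma z.
Proof.
move=> s0 z0.
have Dd y : d + sigma * ((y - d) / sigma) = y by field; rewrite gt_eqF.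
rewrite /gauss_window /gauss_cdf !Dd.
have mz y : measurable (`]-oo, y] : set R) by [].
have -> : `]-oo, z]%classic = `]-oo, (- z)] `|` `]- z, z] :> set R.
  by rewrite -itv_bndbnd_setU // bnd_simp; lra.
have [A AE] : exists A : set R, A = `]-oo, (- z)]%classic by eexists.
have [B BE] : exists B : set R, B = `]- z, z]%classic by eexists.
have mA : measurable A by rewrite AE.
have mB : measurable B by rewrite BE.
rewrite -AE -BE; have -> : mu (A `|` B) = (mu A + mu B)%E.
  apply: measureU => //; rewrite AE BE.
  by rewrite -subset0 => y [] /=; rewrite !in_itv /= => ? /andP[]; lra.
have finA : mu A \is a fin_num by apply: (@fin_num_measure _ _ _ (normal_prob d sigma)).
have finB : mu B \is a fin_num by apply: (@fin_num_measure _ _ _ (normal_prob d sigma)).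
by rewrite (fineD finA finB) addrAC subrr add0r.
Qed.

#[local] Opaque gauss_cdf gauss_window.

Definition late_set (n : nat) (s : R) : set R :=
  [set z | s <= 2^-1 * log gamma (n%:R / z ^+ 2) + log m%:R (ln n%:R) +
            limit_g f m gamma (2^-1 * log gamma (n%:R / z ^+ 2))].

(** The limiting expression is [1 + log_m (ln n) + H (|z| / sqrt n)]: the linear
    part [1 - x] of [limit_g] cancels [Z_n]. *)
Lemma late_setE n s z : (0 < n)%N -> z != 0 ->
  late_set n s z = (s <= 1 + log m%:R (ln n%:R) + H (`|z| / Num.sqrt n%:R)) :> Prop.
Proof.
move=> n0 z0; have g1 := maj_gamma hf.
have lg : 0 < ln gamma by rewrite ln_gt0.
have sn : 0 < Num.sqrt n%:R :> R by rewrite sqrtr_gt0 ltr0n.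
have az : 0 < `|z| by rewrite normr_gt0.
have [u uE] : exists u, u = `|z| / Num.sqrt n%:R by eexists.
have u0 : 0 < u by rewrite uE divr_gt0.
have lu : 2^-1 * log gamma (n%:R / z ^+ 2) = - (ln u / ln gamma).
  rewrite /log; have -> : n%:R / z ^+ 2 = u ^- 2.
    rewrite uE expr_div_n sqr_sqrtr ?ler0n // real_normK ?num_real //.
    by rewrite invf_div.
  by rewrite lnV ?posrE ?exprn_gt0 // lnXn // mulr2n; field; rewrite gt_eqF.
rewrite /late_set /= lu (limit_gE hf) -uE opprK.
have -> : gamma `^ (ln u / ln gamma) = u.
  rewrite /powR gt_eqF; last by lra.
  by rewrite divfK ?lnK // gt_eqF.
congr (is_true (_ <= _)); ring.
Qed.

Lemma late_set_prob n (s Y : R) : (0 < n)%N -> 0 < sigma ->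
  is_threshold H (s - 1 - log m%:R (ln n%:R)) Y ->
  measurable (late_set n s) /\ fine (mu (late_set n s)) = gauss_window d sigma (Num.sqrt n%:R * Y).
Proof.
move=> n0 s0 [Y0 thr1 thr2].
have sn : 0 < Num.sqrt n%:R :> R by rewrite sqrtr_gt0 ltr0n.
have [z zE] : exists z, z = Num.sqrt n%:R * Y by eexists.
have z0 : 0 < z by rewrite zE mulr_gt0.
rewrite -zE -normal_prob_window ?(ltW z0) //.
suff [mL ->] : measurable (late_set n s) /\ mu (late_set n s) = mu `]- z, z] by [].
apply: (@normal_prob_eq _ _ [set x | x \in [:: 0; z; - z]]) => //.
  exact: finite_set_countable (finite_seq _).
have inE' x : x != 0 -> x != z -> x != - z -> late_set n s x <-> `]- z, z]%classic x.
  move=> x0 xz xz'; rewrite late_setE // /= in_itv /=.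
  have xE : `|x| = Num.sqrt n%:R * (`|x| / Num.sqrt n%:R).
    by rewrite mulrCA divff ?mulr1 // gt_eqF.
  have u0 : 0 < `|x| / Num.sqrt n%:R by rewrite divr_gt0 // normr_gt0.
  have [xlt|xge] := ltrP `|x| z.
    have h := thr1 (`|x| / Num.sqrt n%:R).
    rewrite u0 ltr_pdivrMr // mulrC -zE xlt in h.
    have {}h := h erefl; split=> _; last by move: h; rewrite lerBlDr lerBlDr; lra.
    by move: xlt; rewrite ltr_norml => /andP[-> /ltW ->].
  have xgt : z < `|x|.
    by rewrite lt_neqAle xge andbT eq_sym eqr_norml negb_and negb_or xz xz'.
  have h := thr2 (`|x| / Num.sqrt n%:R).
  rewrite ltr_pdivlMr // mulrC -zE xgt in h.
  have {}h := h erefl; split=> [hs|]; first by exfalso; lra.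
  by move: xgt; rewrite ltNge => + hx; rewrite ler_norml; move: hx; lra.
apply/seteqP; split => x [Ax]; rewrite /= !inE => /negP xF; split; try exact/negP;
  move: xF; rewrite !negb_or => /and3P[x0 xz xz'].
  exact/inE'.
exact/(inE' x x0 xz xz').
Qed.

End LimitLaw.

Theorem theorem1p3 (R : realType) (d : R)
    (f : R -> R) (m : nat) (beta gamma : R)
    (hf : majority_type f m beta gamma)
    (X0 : nat -> R)
    (hX0_range : forall n : nat, 0 <= X0 n <= n%:R)
    (hX0 : (fun n : nat => X0 n - (n%:R / 2 + d * Num.sqrt n%:R)) =o_\oo
             (fun n : nat => Num.sqrt n%:R))
    (disp : nat -> measure_display)
    (Omega : forall n : nat, measurableType (disp n))
    (P : forall n : nat, probability (Omega n) R)
    (X : forall n : nat, nat -> {RV (P n) >-> R})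
    (hX : forall n : nat, binomial_chain f n (X0 n) (X n))
    (dispZ : measure_display) (OmegaZ : measurableType dispZ)
    (Q : probability OmegaZ R) (Z : {RV Q >-> R})
    (hZ : forall A : set R, measurable A ->
       distribution Q Z A =
       normal_prob d (Num.sqrt (1 / (4 * (gamma ^+ 2 - 1)))) A) :
  let Zn (n : nat) (w : OmegaZ) : R := 2^-1 * log gamma (n%:R / Z w ^+ 2) in
  sup [set `| fine (P n [set w | ((s%:~R : R)%:E <= runtime n (X n) w)%E])
              - fine (Q [set w | s%:~R <= Zn n w + log m%:R (ln n%:R)
                                          + limit_g f m gamma (Zn n w)]) |
      | s in [set: int]] @[n --> \oo] --> (0 : R).
Proof.
move=> Zn; have g1 := maj_gamma hf.
have [sigma sE] : exists sigma, sigma = Num.sqrt (1 / (4 * (gamma ^+ 2 - 1))) by eexists.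
have g2 : 0 < gamma ^+ 2 - 1.
  by rewrite subr_gt0 expr_gt1 // ltW // (lt_trans ltr01).
have c0 : 0 < 1 / (4 * (gamma ^+ 2 - 1)) by rewrite divr_gt0 // mulr_gt0.
have s0 : 0 < sigma by rewrite sE sqrtr_gt0.
have s2 : sigma ^+ 2 = (4 * (gamma ^+ 2 - 1))^-1 by rewrite sE sqr_sqrtr ?ltW // div1r.
rewrite -sE in hZ.
apply/cvgrPdist_le => eta eta0.
have [rho rho0 [N main]] := unresolved_asymptotic hf d s0 s2 eta0.
have D0 : 0 < `|d| + rho by rewrite ltr_wpDl.
have D4 : 0 < (4 * (`|d| + rho))^-1 by rewrite invr_gt0 mulr_gt0.
have [N' large] := large_log hf 0 D4.
have /eqoP/(_ _ rho0) start := hX0.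
near=> n.
have nN : (N <= n)%N by near: n; exact: nbhs_infty_ge.
have nN' : (N' <= n)%N by near: n; exact: nbhs_infty_ge.
have [n0 sn1 _] := large n nN'.
have nR : 0 < n%:R :> R by rewrite ltr0n.
have sn : 0 < Num.sqrt n%:R :> R by rewrite sqrtr_gt0.
have [x xE] : exists x, x = X0 n / n%:R by eexists.
have hx : 0 <= x <= 1.
  have /andP[h1 h2] := hX0_range n.
  by rewrite xE divr_ge0 ?(ltW nR) //= ler_pdivrMr // mul1r.
have dx : `|deviation n x - d| <= rho.
  have : `|X0 n - (n%:R / 2 + d * Num.sqrt n%:R)| <= rho * `|Num.sqrt n%:R| by near: n.
  rewrite (gtr0_norm sn) -ler_pdivrMr //; apply: le_trans.
  suff -> : deviation n x - d = (X0 n - (n%:R / 2 + d * Num.sqrt n%:R)) / Num.sqrt n%:R.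
    by rewrite normrM normfV (gtr0_norm sn).
  rewrite /deviation xE; have nE : n%:R = Num.sqrt n%:R ^+ 2 :> R by rewrite sqr_sqrtr // ltW.
  by move: nE; move: (n%:R : R) (Num.sqrt n%:R) sn => a b b0 ->; field; rewrite gt_eqF.
have ux : unresolved x = 1.
  have dev : `|x - 2^-1| <= 4^-1.
    have : `|deviation n x| <= `|d| + rho.
      by rewrite -[deviation n x](subrK d) addrC (le_trans (ler_normD _ _)) // lerD2l.
    rewrite /deviation normrM (gtr0_norm sn) => h.
    move: sn1; rewrite mulrC ler_pdivlMr ?mulr_gt0 // mul1r => h'.
    have : Num.sqrt n%:R * `|x - 2^-1| <= Num.sqrt n%:R * 4^-1.
      by apply: le_trans h _; rewrite ler_pdivlMr // mulrC.
    by rewrite ler_pM2l.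
  by rewrite /unresolved ifT //; move: dev; rewrite ler_norml; clear; lra.
have runP T : fine (P n [set w | ((T.+1%:R : R)%:E <= runtime n (X n) w)%E]) =
    iter T (step f n) unresolved x.
  have := open_until_prob (hX n) (maj_f_range hf) (maj0 hf) (maj_symE hf) n0 T (hX0_range n).
  by rewrite -xE -(runtime_gtE n (X n)) => ->.
have limP r Y : is_threshold (abel_half f m gamma) (r - 1 - log m%:R (ln n%:R)) Y ->
    fine (Q [set w | r <= Zn n w + log m%:R (ln n%:R) + limit_g f m gamma (Zn n w)]) =
    gauss_window d sigma (Num.sqrt n%:R * Y).
  move=> thr; have [mA <-] := late_set_prob hf d n0 s0 thr.
  by rewrite -(hZ _ mA).
have bound (s : int) : `|fine (P n [set w | ((s%:~R : R)%:E <= runtime n (X n) w)%E])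
    - fine (Q [set w | s%:~R <= Zn n w + log m%:R (ln n%:R)
                                + limit_g f m gamma (Zn n w)])| <= eta.
  have [Y Y0 [thr1 thr2]] := abel_half_threshold hf (s%:~R - 1 - log m%:R (ln n%:R)).
  have thr : is_threshold (abel_half f m gamma) (s%:~R - 1 - log m%:R (ln n%:R)) Y.
    by split.
  rewrite (limP _ _ thr).
  (* for [s <= 0] the first event is certain, and the second one is at least as
     likely as for [s = 1], where both probabilities are close to [1] *)
  have [sle|sgt] := lerP s 0.
    have [Y' Y0' [thr1' thr2']] := abel_half_threshold hf (0%:R - log m%:R (ln n%:R)).
    have thr' : is_threshold (abel_half f m gamma) (0%:R - log m%:R (ln n%:R)) Y'.
      by split.
    have := main n 0%N x Y' nN hx dx thr'; rewrite /= ux => h.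
    rewrite (runtime_ge0E n (X n) sle) probability_setT /=.
    have YY : Y' <= Y.
      apply: (threshold_le thr thr'); rewrite lerD2r.
      have : (s%:~R : R) <= 0 by rewrite lerz0.
      by move=> h'; rewrite subr_le0 (le_trans h').
    have w1 := window_le1 d sigma (Num.sqrt n%:R * Y).
    have w2 : gauss_window d sigma (Num.sqrt n%:R * Y') <= gauss_window d sigma (Num.sqrt n%:R * Y).
      by apply: window_le => //; rewrite ler_pM2l.
    rewrite ger0_norm ?subr_ge0 //; apply: le_trans h.
    by apply: le_trans (ler_norm _); rewrite lerD2l lerN2.
  have [T sT] : exists T : nat, s = T.+1 by case: s sgt {thr thr1 thr2} => [[|T]|] // _; exists T.
  rewrite sT (runP T); apply: main => //.
  by move: thr; rewrite sT -pmulrn -natr1 addrK.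
rewrite sub0r normrN ger0_norm.
  by apply: ge_sup => [|_ [s _ <-]]; [eexists; exists 0|exact: bound].
apply: le_trans (normr_ge0 _) _; last first.
  by apply: ub_le_sup; [exists eta => _ [s _ <-]; exact: bound|exists 0].
Unshelve. all: by end_near.
Qed.
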